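(* Let $b=(b_j)_{j\in\mathbb{N}}$ be a sequence of positive reals, let $a=(a_j)_{j\in\mathbb{N}}$ be a non-decreasing sequence of positive reals with $a_j\to+\infty$, and consider, in the Gaussian sequence model $Y_j=b_j\theta_j+\varepsilon\xi_j$, $j\in\mathbb{N}$, the signal detection problem $H_0:\theta=0$ versus $H_1:\theta\in\Theta_a(r_\varepsilon)$. Let $\alpha\in\,]0,1[$ and let $(r_\varepsilon)_{\varepsilon>0}$ be a given family of positive radii (with $\Theta_a(r_\varepsilon)\neq\emptyset$). Let $\boldsymbol{\beta}_{\varepsilon,\alpha}(\Theta_a(r_\varepsilon))$ be the minimax second kind error probability, and let $u_\varepsilon(r_\varepsilon)\ge0$ and $\omega_{0,r_\varepsilon}$ be the quantities attached to the extremal problem as defined in the context. Then, as $\varepsilon\to0$: (a) If $u_\varepsilon(r_\varepsilon)=o_\varepsilon(1)$, then $\boldsymbol{\beta}_{\varepsilon,\alpha}(\Theta_a(r_\varepsilon))=1-\alpha+o_\varepsilon(1)$. (b) If $u_\varepsilon(r_\varepsilon)=\mathcal{O}_\varepsilon(1)$ and $\omega_{0,r_\varepsilon}=o_\varepsilon(1)$, then $\boldsymbol{\beta}_{\varepsilon,\alpha}(\Theta_a(r_\varepsilon))=\Phi(t_{1-\alpha}-u_\varepsilon(r_\varepsilon))+o_\varepsilon(1)$. (c) If $u_\varepsilon(r_\varepsilon)\to+\infty$, then $\boldsymbol{\beta}_{\varepsilon,\alpha}(\Theta_a(r_\varepsilon))=o_\varepsilon(1)$.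
   Context: $\mathbb{N}=\{1,2,\ldots\}$. Gaussian sequence model: one observes $Y=(Y_j)_{j\in\mathbb{N}}$ with $Y_j=b_j\theta_j+\varepsilon\xi_j$, where $b_j>0$ is known, $\varepsilon>0$ is the known noise level, $\theta\in l^2(\mathbb{N})$ is unknown, and the $\xi_j$ are independent standard Gaussian variables. $\mathbb{P}_\theta$ denotes the law of $Y$, and $\|\theta\|^2=\sum_j\theta_j^2$. The sequences $a,b$ do not depend on $\varepsilon$. $\mathcal{E}_a=\{\theta\in l^2(\mathbb{N}):\sum_ja_j^2\theta_j^2\le1\}$, and for $r>0$, $\Theta_a(r)=\{\theta\in\mathcal{E}_a:\|\theta\|\ge r\}$. A test is a measurable function $\Psi=\Psi(Y)$ with values in $\{0,1\}$ ($H_0$ is rejected iff $\Psi=1$). The minimax second kind error probability is $$\boldsymbol{\beta}_{\varepsilon,\alpha}(\Theta_a(r))=\inf_{\Psi:\ \mathbb{P}_0(\Psi=1)\le\alpha}\ \sup_{\theta\in\Theta_a(r)}\mathbb{P}_\theta(\Psi=0).$$ Extremal problem: $u_\varepsilon(r)\ge0$ is defined by $$u_\varepsilon^2(r)=\inf_{\theta\in\Theta_a(r)}\frac{1}{2\varepsilon^4}\sum_{k\in\mathbb{N}}b_k^4\theta_k^4,$$ $\bar\theta=\bar\theta(r)\in\Theta_a(r)$ denotes a sequence attaining this infimum, and $$\omega_{0,r}=\sup_{j\in\mathbb{N}}\frac{b_j^2\bar\theta_j^2}{\sqrt{2\sum_{k\in\mathbb{N}}b_k^4\bar\theta_k^4}}.$$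 $\Phi$ is the standard Gaussian distribution function and $t_{1-\alpha}=\Phi^{-1}(1-\alpha)$. $o_\varepsilon(1)$ (resp. $\mathcal{O}_\varepsilon(1)$) denotes a quantity tending to $0$ (resp. bounded) as $\varepsilon\to0$. *)

(* Defs.v *)
From HB Require Import structures.
From mathcomp Require Import all_boot all_order all_algebra finmap.
From mathcomp Require Import all_classical all_reals all_analysis.

Set Implicit Arguments.
Unset Strict Implicit.
Unset Printing Implicit Defensive.

Import Order.TTheory GRing.Theory Num.Theory.
Import numFieldNormedType.Exports.

Local Open Scope classical_set_scope.
Local Open Scope ring_scope.

(* Sequences indexed by {1, 2, ...} are written as functions on nat: the entry
   of index j here is the entry of index j + 1 of the mathematical text. *)

Section Gaussian_variables.
Context {d : measure_display} {Om : measurableType d} {R : realType}.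
Variable P : probability Om R.

Definition mutually_independent (X : nat -> {RV P >-> R}) : Prop :=
  forall (J : {fset nat}) (A : nat -> set R),
    (forall j, j \in J -> measurable (A j)) ->
    P (\bigcap_(j in [set` J]) (X j @^-1` A j)) =
    (\prod_(j <- J) P (X j @^-1` A j))%E.

(* Two measures are compared on measurable sets only: their values elsewhere
   are not meaningful. *)
Definition standard_gaussian (X : {RV P >-> R}) : Prop :=
  forall A : set R, measurable A -> distribution P X A = normal_prob 0 1 A.

End Gaussian_variables.

Section Normal_cdf.
Context {R : realType}.

Definition Phi (x : R) : R := fine (normal_prob 0 1 `]-oo, x]).

Definition Phi_inv : R -> R := pinv [set: R] Phi.

End Normal_cdf.

Section Alternatives.
Context {R : realType}.
Implicit Types a b th : nat -> R.

Definition ell2 : set (nat -> R) :=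
  [set th | (\sum_(0 <= k <oo) (th k ^+ 2)%:E < +oo)%E].

Definition ell2_norm th : R :=
  Num.sqrt (fine (\sum_(0 <= k <oo) (th k ^+ 2)%:E)%E).

Definition ellipsoid a : set (nat -> R) :=
  [set th | ell2 th /\
            (\sum_(0 <= k <oo) (a k ^+ 2 * th k ^+ 2)%:E <= 1)%E].

Definition Theta a (r : R) : set (nat -> R) :=
  [set th | ellipsoid a th /\ r <= ell2_norm th].

End Alternatives.

Section Extremal_problem.
Context {R : realType}.
Implicit Types a b th : nat -> R.

Definition sum_b4th4 b th : \bar R :=
  (\sum_(0 <= k <oo) (b k ^+ 4 * th k ^+ 4)%:E)%E.

(* Extended-real valued, since the sum may diverge when b is unbounded. *)
Definition objective b (eps : R) th : \bar R :=
  (((2 * eps ^+ 4)^-1)%:E * sum_b4th4 b th)%E.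

Definition u2 a b (eps r : R) : \bar R :=
  ereal_inf [set objective b eps th | th in Theta a r].

Definition u a b (eps r : R) : R := Num.sqrt (fine (u2 a b eps r)).

Definition is_extremal a b (eps r : R) th : Prop :=
  Theta a r th /\ objective b eps th = u2 a b eps r.

Definition omega0 b th : R :=
  sup (range (fun j : nat =>
    b j ^+ 2 * th j ^+ 2 / Num.sqrt (2 * fine (sum_b4th4 b th)))).

End Extremal_problem.

Section Sequence_model.
Context {R : realType}.

Definition cylinders : set (set (nat -> R)) :=
  \bigcup_j preimage_set_system [set: nat -> R] (fun y => y j) measurable.

(* The space of sequences with the product sigma-algebra. *)
Definition obs : measurableType _ := g_sigma_algebraType cylinders.

Definition test : Type := {mfun obs >-> bool}.

Context {d : measure_display} {Om : measurableType d}.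
Variables (P : probability Om R) (xi : nat -> {RV P >-> R}).
Variables (b : nat -> R) (eps : R).

Definition observation (th : nat -> R) (w : Om) : obs :=
  fun j => b j * th j + eps * xi j w.

Definition law (th : nat -> R) : set obs -> \bar R :=
  pushforward P (observation th).

Definition beta (alpha : R) (Th : set (nat -> R)) : \bar R :=
  ereal_inf
    [set ereal_sup [set law th [set y | psi y = false] | th in Th]
    | psi in [set psi : test |
              (law (fun=> 0%R) [set y | psi y = true] <= alpha%:E)%E]].

End Sequence_model.

(* Main.v *)
Require Import Defs.
From HB Require Import structures.
From mathcomp Require Import all_boot all_order all_algebra finmap.
From mathcomp Require Import all_classical all_reals all_analysis.
From mathcomp Require Import measurable_realfun.
From mathcomp Require Import ring lra.

(* Lower bounds: put an independent random sign on each coordinate of an almost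
   extremal sequence with finitely many nonzero entries. All these alternatives
   are in the ellipsoid, the averaged likelihood ratio L is a product of terms
   exp(-c^2/2) cosh(c x), and B + l * alpha >= E (min L l) for every test of
   level alpha and every l >= 0. A Taylor expansion of ln cosh gives
   ln L = u X - u^2/2 up to an error small in probability, with X a weighted sum
   of centred chi-squares of variance 1. When u -> 0, L -> 1; when the largest
   weight tends to 0, X is asymptotically normal (Lindeberg replacement), and
   l = exp (u t - u^2/2) yields Phi (t - u).

   Upper bounds: reject when X > T. A minimizer of the convex functional
   sum b^4 eta^2 in eta = theta^2 satisfies the variational inequality
   sum b^4 eta eta' >= sum b^4 eta^2 for all admissible eta', so the mean of X
   under any alternative is at least about u. The infimum is approached by
   sequences with finitely many nonzero entries because mass can be moved from
   high indices to the first one without leaving the ellipsoid. *)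

Set Implicit Arguments.
Unset Strict Implicit.
Unset Printing Implicit Defensive.

Import Order.TTheory GRing.Theory Num.Theory.
Import numFieldNormedType.Exports.

Local Open Scope classical_set_scope.
Local Open Scope ring_scope.

(** * The standard Gaussian law *)

(** Every estimate holds at a fixed noise level, with tolerances that depend on alpha, on the
    precision kappa and on a bound M for u, never on eps: in (b) nothing but boundedness of u is
    known, and u may also come close to 0. Hence the normal approximation is a bound uniform in the
    weights and not a limit theorem. Tests take only the values 0 and 1, so the upper bound 1 -
    alpha in (a) cannot come from a constant randomized test. A two-sided test on the first
    coordinate, unbiased by Anderson's inequality, takes its place. For the same reason the level
    has to be at most alpha although the law of X is known only approximately: in (b) the threshold
    lies slightly above t, and the strict increase of [Phi] pays for the approximation error. In (a)
    and (c) no extremal sequence is given. Near minimizers stand in for it; in (c) they satisfy the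
    variational inequality up to a factor 2, which is harmless when u tends to infinity. Finite
    support makes L a finite product and lets coordinates be treated one at a time, by redrawing a
    single one. *)

Section lebesgue_affine.
Context {R : realType}.
Notation mu := (@lebesgue_measure R).

Let affine (t m : R) (x : measurableTypeR R) : measurableTypeR R := t * x + m.

Let measurable_affine t m : measurable_fun [set: measurableTypeR R] (affine t m).
Proof. by apply: measurable_funD => //; exact: measurable_funM. Qed.

Let scaled_pushforward (t m : R) (t0 : 0 < t) :
    {measure set (measurableTypeR R) -> \bar R} :=
  mscale (NngNum (ltW t0))
    (measure_function_pushforward__canonical__measure_function_Measure mu
       (measurable_affine t m)).

Let lebesgue_measure_affine (t m : R) (t0 : 0 < t) (A : set R) :
  measurable A -> mu A = scaled_pushforward m t0 A.
Proof.
apply: lebesgue_measure_unique => _ [[a b]] _ <-.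
rewrite /= /mscale /= /pushforward.
have -> : affine t m @^-1` `]a, b] = `](a - m) / t, (b - m) / t]%classic.
  apply/seteqP; split => x /=; rewrite !in_itv /= ltr_pdivrMr// ler_pdivlMr//;
  by rewrite ltrBlDr lerBrDr mulrC.
rewrite !lebesgue_measure_itv /= !lte_fin ltr_pM2r ?invr_gt0// ltrD2r.
case: ifPn => _; last by rewrite mule0.
by rewrite -!EFinB -EFinM; congr (_%:E); field; rewrite gt_eqF.
Qed.

Lemma ge0_integral_affine (t m : R) (f : R -> \bar R) : 0 < t ->
  measurable_fun [set: R] f -> (forall x, 0 <= f x)%E ->
  (\int[mu]_x f x = t%:E * \int[mu]_x f (t * x + m)%R)%E.
Proof.
move=> t0 mf f0.
transitivity (\int[scaled_pushforward m t0]_x f x)%E.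
  by apply: eq_measure_integral => A mA _; rewrite -lebesgue_measure_affine.
rewrite ge0_integral_mscale//=; congr (_ * _)%E.
by rewrite (ge0_integral_pushforward (measurable_affine t m)).
Qed.

Lemma ge0_integral_opp (f : R -> \bar R) :
  measurable_fun [set: R] f -> (forall x, 0 <= f x)%E ->
  (\int[mu]_x f x = \int[mu]_x f (- x)%R)%E.
Proof.
move=> mf f0.
transitivity (\int[pushforward mu (-%R : _ -> measurableTypeR R)]_x f x)%E.
  by apply: eq_measure_integral => A mA _; exact/esym/lebesgue_measureN.
by rewrite ge0_integral_pushforward.
Qed.

End lebesgue_affine.

Section gauss.
Context {R : realType}.
Notation mu := (@lebesgue_measure R).
Notation phi := (@normal_pdf R 0 1).

(* [normal_prob] lives on [measurableTypeR R], a type convertible to [R] but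
   carrying another measurable structure; the random variables are [R]-valued. *)
Definition gauss : set R -> \bar R := @normal_prob R 0 1.

Let gauss0 : gauss set0 = 0%E.
Proof. exact: (@measure0 _ _ _ (@normal_prob R 0 1)). Qed.

Let gauss_ge0 A : (0 <= gauss A)%E.
Proof. exact: (@measure_ge0 _ _ _ (@normal_prob R 0 1)). Qed.

Let gauss_sigma_additive : semi_sigma_additive gauss.
Proof. exact: (@measure_semi_sigma_additive _ _ _ (@normal_prob R 0 1)). Qed.

HB.instance Definition _ :=
  isMeasure.Build _ _ _ gauss gauss0 gauss_ge0 gauss_sigma_additive.

Let gauss_setT : gauss setT = 1%E.
Proof. exact: (@probability_setT _ _ _ (@normal_prob R 0 1)). Qed.

HB.instance Definition _ := Measure_isProbability.Build _ _ R gauss gauss_setT.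

Import HBNNSimple.

Lemma gaussE (A : set R) : gauss A = (\int[mu]_(x in A) (phi x)%:E)%E.
Proof. by []. Qed.

Lemma measurable_phi : measurable_fun [set: R] phi.
Proof. exact: measurable_normal_pdf. Qed.

(** Checked on the level sets of simple functions, then passed to the limit on both sides by
    monotone convergence. *)
Lemma ge0_integral_gauss (f : R -> \bar R) :
  measurable_fun [set: R] f -> (forall x, 0 <= f x)%E ->
  (\int[gauss]_x f x = \int[mu]_x (f x * (phi x)%:E))%E.
Proof.
move=> mf f0.
have mT : measurable [set: R] by [].
pose f_ := nnsfun_approx mT mf.
have mf_ n : measurable_fun [set: R] (f_ n) by [].
have mind n r : measurable_fun [set: R] (\1_(f_ n @^-1` [set r]) : R -> R).
  exact: measurable_indic.
have ri0 n r x : 0 <= r * (\1_(f_ n @^-1` [set r]) : R -> R) x.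
  rewrite indicE; have [|_] := boolP (x \in _); last by rewrite mulr0.
  by rewrite inE /= => <-; rewrite mulr1.
have ndf_ x m n : (m <= n)%N -> f_ m x <= f_ n x.
  by move=> mn; exact/lefP/nd_nnsfun_approx.
have mphi := measurable_phi.
have phi0 x : 0 <= phi x by exact: normal_pdf_ge0.
transitivity (limn (fun n => \int[gauss]_x (f_ n x)%:E)%E).
  rewrite -monotone_convergence//.
  - by apply: eq_integral => y _; apply/esym/cvg_lim => //;
      exact: cvg_nnsfun_approx.
  - by move=> n; exact/measurable_EFinP.
  - by move=> n y _; rewrite lee_fin.
  - by move=> y _ m n mn; rewrite lee_fin; exact/lefP/nd_nnsfun_approx.
transitivity (limn (fun n => \int[mu]_x ((f_ n x)%:E * (phi x)%:E))%E); last first.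
  rewrite -monotone_convergence//.
  - apply: eq_integral => y _; apply/cvg_lim => //.
    apply: cvgeZr => //.
    exact: cvg_nnsfun_approx.
  - move=> n; apply/measurable_EFinP.
    by apply: measurable_funM; [exact: mf_|exact: mphi].
  - by move=> n y _; rewrite mule_ge0// lee_fin.
  - move=> y _ m n mn; rewrite lee_wpmul2r ?lee_fin//.
    exact: ndf_.
congr (limn _); apply/funext => n.
under eq_integral do rewrite fimfunE -fsumEFin//.
rewrite [LHS]ge0_integral_fsum//; last 2 first.
  - by move=> r; apply/measurable_EFinP/measurable_funM => //; exact: mind.
  - by move=> r x _; rewrite nnfun_muleindic_ge0.
under [RHS]eq_integral do rewrite fimfunE -fsumEFin//.
transitivity (\int[mu]_x (\sum_(r \in range (f_ n)) (r * \1_(f_ n @^-1` [set r]) x)%:E * (phi x)%:E)%E)%E; last first.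
  apply: eq_integral => x _; rewrite ge0_mule_fsuml// => r.
  by rewrite lee_fin ri0.
rewrite ge0_integral_fsum//; last 2 first.
  - move=> r; apply: emeasurable_funM; last exact/measurable_EFinP.
    by apply/measurable_EFinP/measurable_funM => //; exact: mind.
  - by move=> r x _; rewrite mule_ge0 ?lee_fin// ri0.
apply: eq_fsbigr => r _.
under [LHS]eq_integral do rewrite EFinM.
rewrite integralZl_indic_nnsfun// integral_indic// setIT /= gaussE.
(* Pulling [r] out of the integral requires a sign; a negative [r] is not a value of [f_ n], and its
   level set is empty. *)
have [r0|r0] := ltP r 0.
  rewrite preimage_nnfun0// integral_set0 mule0 integral0_eq// => x _.
  by rewrite indic0 mulr0 mul0e.
rewrite integral_mkcond -ge0_integralZl//; last 2 first.
  - have mA : measurable (f_ n @^-1` [set r]).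
      by rewrite -[X in measurable X]setTI; exact: mf_.
    have mphiE : measurable_fun [set: R] (EFin \o phi).
      exact/measurable_EFinP.
    have /(measurable_restrictT _ mA) : measurable_fun (f_ n @^-1` [set r]) (EFin \o phi).
      exact: measurable_funTS.
    exact.
  - by move=> x _; apply: erestrict_ge0 => y _; rewrite lee_fin.
apply: eq_integral => x _; rewrite EFinM -muleA; congr (_ * _)%E.
by rewrite patchE indicE; case: ifPn => _; rewrite ?mul1e ?mul0e.
Qed.

End gauss.

Section gauss_theory.
Context {R : realType}.
Notation mu := (@lebesgue_measure R).
Notation phi := (@normal_pdf R 0 1).
Notation gauss := (@gauss R).

Lemma phiE (x : R) : phi x = normal_peak 1 * expR (- x ^+ 2 / 2).
Proof.
by rewrite normal_pdfE ?oner_eq0// /normal_fun subr0 expr1n.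
Qed.

Lemma phi_ge0 (x : R) : 0 <= phi x.
Proof. exact: normal_pdf_ge0. Qed.

Lemma integral_phi : (\int[mu]_x (phi x)%:E = 1)%E.
Proof. exact: integral_normal_pdf. Qed.

Lemma measurable_phi_affine (t m : R) : measurable_fun [set: R] (fun x : R => phi (t * x + m)).
Proof.
apply: measurableT_comp; first exact: measurable_phi.
by apply: measurable_funD => //; exact: measurable_funM.
Qed.

(** One-dimensional Cameron-Martin formula: completing the square in (x - c)^2 produces the
    exponential density. *)
Lemma gauss_shift (c : R) (f : R -> \bar R) :
  measurable_fun [set: R] f -> (forall x, 0 <= f x)%E ->
  (\int[gauss]_x f (x + c)%R =
   \int[gauss]_x (f x * (expR (c * x - c ^+ 2 / 2))%:E))%E.
Proof.
move=> mf f0.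
have mshift : measurable_fun [set: R] (fun x : R => f (x + c)).
  by apply: measurableT_comp => //; exact: measurable_funD.
have mE : measurable_fun [set: R] (fun x : R => (expR (c * x - c ^+ 2 / 2))%:E).
  apply/measurable_EFinP; apply: measurableT_comp => //.
  by apply: measurable_funB => //; exact: measurable_funM.
have mphiE : measurable_fun [set: R] (fun x : R => (phi x)%:E).
  by apply/measurable_EFinP; exact: measurable_phi.
rewrite !ge0_integral_gauss//; last 2 first.
  by apply: emeasurable_funM.
  by move=> x; rewrite mule_ge0// lee_fin expR_ge0.
rewrite (@ge0_integral_affine _ 1 (- c))//; last 2 first.
  by apply: emeasurable_funM.
  by move=> x; rewrite mule_ge0// lee_fin phi_ge0.
rewrite mul1e; apply: eq_integral => x _.
rewrite mul1r subrK -muleA -EFinM; congr (_ * _%:E)%E.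
rewrite !phiE mulrCA -expRD; congr (_ * expR _).
by field.
Qed.

Lemma gauss_opp (f : R -> \bar R) :
  measurable_fun [set: R] f -> (forall x, 0 <= f x)%E ->
  (\int[gauss]_x f (- x)%R = \int[gauss]_x f x)%E.
Proof.
move=> mf f0.
have mshift : measurable_fun [set: R] (fun x : R => f (- x)).
  by apply: measurableT_comp => //; exact: oppr_measurable.
have mphiE : measurable_fun [set: R] (fun x : R => (phi x)%:E).
  by apply/measurable_EFinP; exact: measurable_phi.
apply: etrans (ge0_integral_gauss mshift (fun x => f0 (- x))) _.
have mg : measurable_fun [set: R] (fun x : R => f x * (phi x)%:E)%E.
  exact: emeasurable_funM.
have g0 x : (0 <= f x * (phi x)%:E)%E by rewrite mule_ge0// lee_fin phi_ge0.
apply: etrans (esym (ge0_integral_gauss mf f0)).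
apply: etrans (esym (ge0_integral_opp mg g0)).
by apply: eq_integral => x _; rewrite !phiE sqrrN.
Qed.

(** For fixed x, the substitution v = s x + t y turns the inner integral into one against a
    transition density [K x v]. After Tonelli, the identity phi x * K x y = phi y * K y x reduces
    the claim to [K y] having mass 1. *)
Lemma gauss_rotation (s t : R) (f : R -> \bar R) : 0 <= s -> 0 <= t ->
  s ^+ 2 + t ^+ 2 = 1 ->
  measurable_fun [set: R] f -> (forall x, 0 <= f x)%E ->
  (\int[gauss]_x \int[gauss]_y f (s * x + t * y)%R = \int[gauss]_x f x)%E.
Proof.
move=> s0; rewrite le_eqVlt => /predU1P[<- s1 mf f0|t0 st mf f0].
  have {s0 s1} -> : s = 1.
    by apply/eqP; rewrite -sqrp_eq1//; apply/eqP; move: s1; rewrite expr0n addr0.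
  apply: eq_integral => x _.
  under eq_integral do rewrite mul1r mul0r addr0.
  by rewrite integral_cst// [X in (_ * X)%E](@probability_setT _ _ _ gauss) mule1.
have tn0 : t != 0 by rewrite gt_eqF.
have mphiE : measurable_fun [set: R] (fun x : R => (phi x)%:E).
  by apply/measurable_EFinP; exact: measurable_phi.
pose K (x y : R) := t^-1 * phi ((y - s * x) / t).
have K0 x y : 0 <= K x y by rewrite mulr_ge0 ?invr_ge0 ?(ltW t0)// phi_ge0.
have mK2 x : measurable_fun [set: R] (K x).
  apply: measurable_funM => //.
  rewrite (_ : (fun _ => _) = (fun y => phi (t^-1 * y + (- (s * x) / t)))).
    exact: measurable_phi_affine.
  by apply/funext => y; rewrite mulrBl mulrC mulNr.
have step x : (\int[gauss]_y f (s * x + t * y)%R = \int[mu]_y (f y * (K x y)%:E))%E.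
  have mfx : measurable_fun [set: R] (fun y : R => f (s * x + t * y)).
    by apply: measurableT_comp => //; apply: measurable_funD => //; exact: measurable_funM.
  rewrite ge0_integral_gauss// (@ge0_integral_affine _ t^-1 (- (s * x) / t)) ?invr_gt0//.
  - have e y : s * x + t * (t^-1 * y + - (s * x) / t) = y by field.
    under eq_integral do rewrite e.
    rewrite -ge0_integralZl//; last 3 first.
    + have : measurable_fun [set: R]
          (fun y : R => f y * (phi (t^-1 * y + - (s * x) / t)%R)%:E)%E.
        apply: emeasurable_funM => //.
        by apply/measurable_EFinP; exact: measurable_phi_affine.
      exact.
    + by move=> y _; rewrite mule_ge0// lee_fin phi_ge0.
    + by rewrite lee_fin invr_ge0 ltW.
    apply: eq_integral => y _; rewrite muleCA -EFinM /K; congr (f _ * (_ * phi _)%:E)%E.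
    by field.
  - by apply: emeasurable_funM.
  - by move=> y; rewrite mule_ge0// lee_fin phi_ge0.
under eq_integral do rewrite step.
have mF : measurable_fun [set: R * measurableTypeR R]
    (fun z : R * measurableTypeR R => (f z.2 * (K z.1 z.2)%:E)%E).
  apply: emeasurable_funM.
    apply: measurableT_comp; [exact: mf|exact: measurable_snd].
  apply/measurable_EFinP; apply: measurable_funM => //.
  apply: measurableT_comp; first exact: measurable_phi.
  apply: measurable_funM => //; apply: measurable_funB; first exact: measurable_snd.
  by apply: measurable_funM => //; exact: measurable_fst.
rewrite (@fubini_tonelli _ _ _ _ _ gauss mu (fun z => f z.2 * (K z.1 z.2)%:E)%E)//; last first.
  by move=> z; rewrite mule_ge0// lee_fin.
rewrite [RHS]ge0_integral_gauss//; apply: eq_integral => y _ /=.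
have mK1 : measurable_fun [set: R] (fun x => (K x y)%:E).
  apply/measurable_EFinP/measurable_funM => //.
  rewrite (_ : (fun _ => _) = (fun x => phi ((- s / t) * x + (y / t)))).
    exact: measurable_phi_affine.
  by apply/funext => x; congr phi; field.
rewrite ge0_integralZl//; last by move=> x _; rewrite lee_fin.
congr (_ * _)%E.
rewrite ge0_integral_gauss//.
(* Reversibility of [K]: the two exponents agree because s^2 + t^2 = 1. *)
transitivity (\int[mu]_x ((phi y)%:E * (K y x)%:E))%E.
  apply: eq_integral => x _; rewrite -!EFinM /K !phiE; congr _%:E.
  rewrite [LHS](_ : _ = t^-1 * normal_peak 1 * normal_peak 1 * (expR (- ((y - s * x) / t) ^+ 2 / 2) * expR (- x ^+ 2 / 2))); last by ring.
  rewrite [RHS](_ : _ = t^-1 * normal_peak 1 * normal_peak 1 * (expR (- ((x - s * y) / t) ^+ 2 / 2) * expR (- y ^+ 2 / 2))); last by ring.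
  rewrite -!expRD; congr (_ * expR _).
  apply/eqP; rewrite -subr_eq0.
  rewrite [X in X == 0](_ : _ = (s ^+ 2 + t ^+ 2 - 1) * (y ^+ 2 - x ^+ 2) / t ^+ 2 / 2); last by field.
  by rewrite st subrr !mul0r.
rewrite ge0_integralZl//; last 2 first.
  by move=> x _; rewrite lee_fin.
  by rewrite lee_fin phi_ge0.
rewrite -[RHS]mule1; congr (_ * _)%E.
rewrite -[RHS]integral_phi [RHS](@ge0_integral_affine _ t^-1 (- (s * y) / t)) ?invr_gt0//.
have mphis : measurable_fun [set: R]
    (fun x : R => (phi (t^-1 * x + - (s * y) / t)%R)%:E).
  by apply/measurable_EFinP; exact: measurable_phi_affine.
have t10 : (0 <= (t^-1)%:E :> \bar R)%E by rewrite lee_fin invr_ge0 ltW.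
apply: etrans (ge0_integralZl mu measurableT mphis _ t10); last first.
  by move=> x _; rewrite lee_fin phi_ge0.
apply: eq_integral => x _; rewrite -EFinM /K; congr (_ * phi _)%:E.
by field.
- by move=> x; rewrite lee_fin phi_ge0.
- have : measurable_fun [set: R] (fun x : R => (K y x)%:E) by exact/measurable_EFinP.
  exact.
- by move=> x; rewrite lee_fin.
Qed.
End gauss_theory.

(** * Gaussian moments up to order four *)

Section gauss_moments.
Context {R : realType}.
Notation mu := (@lebesgue_measure R).
Notation gauss := (@gauss R).
Implicit Types (f g : R -> R) (c x y : R).

Lemma integral_gauss_cst c : (\int[gauss]_x c%:E = c%:E)%E.
Proof.
rewrite integral_cst// [X in (_ * X)%E](@probability_setT _ _ _ gauss).
by rewrite mule1.
Qed.

Lemma gauss_expR c : (\int[gauss]_x (expR (c * x))%:E = (expR (c ^+ 2 / 2))%:E)%E.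
Proof.
have mE : measurable_fun [set: R] (fun x : R => (expR (c * x))%:E).
  by apply/measurable_EFinP; apply: measurableT_comp => //; exact: measurable_funM.
have := @gauss_shift R c (cst 1%E) (measurable_cst _) (fun _ : R => lee01).
rewrite integral_gauss_cst => e.
transitivity ((expR (c ^+ 2 / 2))%:E * 1)%E; last by rewrite mule1.
rewrite e -ge0_integralZl//.
- by apply: eq_integral => x _; rewrite mul1e -EFinM -expRD addrC subrK.
- apply: emeasurable_funM => //; apply/measurable_EFinP; apply: measurableT_comp => //.
  by apply: measurable_funB => //; exact: measurable_funM.
- by move=> x _; rewrite mul1e lee_fin expR_ge0.
Qed.

Lemma gauss_integrable_expR c : gauss.-integrable setT (fun x => (expR (c * x))%:E).
Proof.
apply/integrableP; split.
  by apply/measurable_EFinP; apply: measurableT_comp => //; exact: measurable_funM.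
under eq_integral do rewrite gee0_abs ?lee_fin ?expR_ge0//.
by rewrite gauss_expR ltry.
Qed.

(** Exponential moments are explicit, so this domination makes every power integrable. *)
Lemma normX_le_expR n x : `|x| ^+ n <= n`!%:R * (expR x + expR (- x)).
Proof.
wlog x0 : x / 0 <= x => [H|].
  have [/H//|x0] := leP 0 x.
  by have := H (- x); rewrite normrN opprK [_ (- x) + _]addrC; apply; rewrite oppr_ge0 ltW.
rewrite ger0_norm// (@le_trans _ _ (n`!%:R * expR x))//; last first.
  by rewrite ler_wpM2l// lerDl expR_ge0.
case: n => [|n].
  by rewrite expr0 fact0 mul1r (le_trans _ (expR_ge1Dx x))// lerDl.
rewrite mulrC -ler_pdivrMr ?ltr0n ?fact_gt0//.
by apply: le_trans (expR_ge1Dxn n x0); rewrite lerDr.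
Qed.

Lemma gauss_integrableX n : gauss.-integrable setT (fun x => (x ^+ n)%:E).
Proof.
have h : gauss.-integrable setT
    (fun x => (n`!%:R%:E * ((expR (1 * x))%:E + (expR ((-1) * x))%:E))%E).
  apply: integrableZl => //; apply: integrableD => //; exact: gauss_integrable_expR.
apply: le_integrable h => //.
  by apply/measurable_EFinP; exact: exprn_measurable.
move=> x _ /=; rewrite lee_fin normrX mul1r mulN1r.
by rewrite (le_trans (normX_le_expR n x))// ler_norm.
Qed.

(* [E e^{(1-t^2) x^2/2} = 1/t] together with [1 + y <= e^y] pins the second
   moment from both sides as [t -> 1]. *)
Lemma gauss_expR_sqr t : 0 < t ->
  (\int[gauss]_x (expR ((1 - t ^+ 2) * x ^+ 2 / 2))%:E = (t^-1)%:E)%E.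
Proof.
move=> t0.
have mE : measurable_fun [set: R] (fun x : R => (expR ((1 - t ^+ 2) * x ^+ 2 / 2))%:E).
  apply/measurable_EFinP; apply: measurableT_comp => //; apply: measurable_funM => //.
  by apply: measurable_funM => //; exact: exprn_measurable.
have mphiE : measurable_fun [set: R] (fun x : R => (normal_pdf 0 1 x)%:E).
  by apply/measurable_EFinP; exact: measurable_phi.
rewrite ge0_integral_gauss//.
have t1 := @integral_phi R.
rewrite -[RHS]mule1 -t1 [X in (_ = _ * X)%E](@ge0_integral_affine _ t 0)//.
rewrite muleA -EFinM mulVf ?gt_eqF// mul1e.
apply: eq_integral => x _; rewrite -EFinM addr0 !phiE mulrCA -expRD.
  by congr (_ * expR _)%:E; field.
by move=> x; rewrite lee_fin phi_ge0.
Qed.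

Lemma gauss_integrable_poly4 (a b c d e : R) : gauss.-integrable setT
  (EFin \o (fun x => a + b * x + c * x ^+ 2 + d * x ^+ 3 + e * x ^+ 4)).
Proof.
have cst0 : gauss.-integrable setT (EFin \o (fun=> a)).
  exact: finite_measure_integrable_cst.
have Z k n : gauss.-integrable setT (EFin \o (fun x => k * x ^+ n)).
  have := integrableZl measurableT k (gauss_integrableX n).
  by congr integrable; apply/funext => x; rewrite /= EFinM.
have D f g : gauss.-integrable setT (EFin \o f) -> gauss.-integrable setT (EFin \o g) ->
    gauss.-integrable setT (EFin \o (fun x => f x + g x)).
  move=> fi gi; have := integrableD measurableT fi gi.
  by congr integrable; apply/funext => x; rewrite /= EFinD.
exact: (D _ _ (D _ _ (D _ _ (D _ _ cst0 (Z b 1%N)) (Z c 2%N)) (Z d 3%N)) (Z e 4%N)).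
Qed.

Lemma Rintegral_gauss_poly4 (a b c d e : R) :
  \int[gauss]_x (a + b * x + c * x ^+ 2 + d * x ^+ 3 + e * x ^+ 4) =
  a + b * \int[gauss]_x x + c * \int[gauss]_x (x ^+ 2) +
  d * \int[gauss]_x (x ^+ 3) + e * \int[gauss]_x (x ^+ 4).
Proof.
have i1 : gauss.-integrable setT (EFin \o (fun x => x)).
  have := gauss_integrable_poly4 0 1 0 0 0; congr integrable.
  by apply/funext => x /=; congr _%:E; ring.
have iX n : gauss.-integrable setT (EFin \o (fun x => x ^+ n)) by exact: gauss_integrableX.
rewrite RintegralD//; last 2 first.
- have := gauss_integrable_poly4 a b c d 0; congr integrable.
  by apply/funext => x /=; congr _%:E; ring.
- have := gauss_integrable_poly4 0 0 0 0 e; congr integrable.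
  by apply/funext => x /=; congr _%:E; ring.
rewrite RintegralD//; last 2 first.
- have := gauss_integrable_poly4 a b c 0 0; congr integrable.
  by apply/funext => x /=; congr _%:E; ring.
- have := gauss_integrable_poly4 0 0 0 d 0; congr integrable.
  by apply/funext => x /=; congr _%:E; ring.
rewrite RintegralD//; last 2 first.
- have := gauss_integrable_poly4 a b 0 0 0; congr integrable.
  by apply/funext => x /=; congr _%:E; ring.
- have := gauss_integrable_poly4 0 0 c 0 0; congr integrable.
  by apply/funext => x /=; congr _%:E; ring.
rewrite RintegralD//; last 2 first.
- have := gauss_integrable_poly4 a 0 0 0 0; congr integrable.
  by apply/funext => x /=; congr _%:E; ring.
- have := gauss_integrable_poly4 0 b 0 0 0; congr integrable.
  by apply/funext => x /=; congr _%:E; ring.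
rewrite !RintegralZl//; congr (_ + _ + _ + _ + _).
by rewrite /Rintegral integral_gauss_cst.
Qed.

Lemma Rintegral_gauss_opp f : measurable_fun [set: R] f ->
  (forall x, 0 <= f x) -> \int[gauss]_x f (- x) = \int[gauss]_x f x.
Proof.
move=> mf f0; rewrite /Rintegral (@gauss_opp _ (EFin \o f))//.
exact/measurable_EFinP.
Qed.

(** [Rintegral_gauss_opp] asks for a nonnegative integrand, hence the detour through (x + 1)^2:
    reflection changes only the sign of its linear term. *)
Lemma gauss_mean : \int[gauss]_x x = 0 :> R.
Proof.
have : \int[gauss]_x ((- x + 1) ^+ 2) = \int[gauss]_x ((x + 1) ^+ 2) :> R.
  apply: (@Rintegral_gauss_opp (fun x => (x + 1) ^+ 2)); last by move=> x; exact: sqr_ge0.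
  by apply: measurable_funX; exact: measurable_funD.
rewrite (_ : (fun x : R => (- x + 1) ^+ 2) = (fun x => 1 + (- 2%:R) * x + 1 * x ^+ 2 + 0 * x ^+ 3 + 0 * x ^+ 4)); last by apply/funext => x; ring.
rewrite (_ : (fun x : R => (x + 1) ^+ 2) = (fun x => 1 + 2%:R * x + 1 * x ^+ 2 + 0 * x ^+ 3 + 0 * x ^+ 4)); last by apply/funext => x; ring.
rewrite !Rintegral_gauss_poly4.
by set m := (\int[gauss]_x x); lra.
Qed.

(** Same device with (x + 1)^4; its linear terms disappear because the mean is known to be 0. *)
Lemma gauss_moment3 : \int[gauss]_x (x ^+ 3) = 0 :> R.
Proof.
have : \int[gauss]_x ((- x + 1) ^+ 4) = \int[gauss]_x ((x + 1) ^+ 4) :> R.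
  apply: (@Rintegral_gauss_opp (fun x => (x + 1) ^+ 4)).
    by apply: measurable_funX; exact: measurable_funD.
  by move=> x; rewrite exprn_even_ge0.
rewrite (_ : (fun x : R => (- x + 1) ^+ 4) = (fun x => 1 + (- 4%:R) * x + 6%:R * x ^+ 2 + (- 4%:R) * x ^+ 3 + 1 * x ^+ 4)); last by apply/funext => x; ring.
rewrite (_ : (fun x : R => (x + 1) ^+ 4) = (fun x => 1 + 4%:R * x + 6%:R * x ^+ 2 + 4%:R * x ^+ 3 + 1 * x ^+ 4)); last by apply/funext => x; ring.
rewrite !Rintegral_gauss_poly4 gauss_mean.
by set m := (\int[gauss]_x (x ^+ 3)); lra.
Qed.

Lemma gauss_var : \int[gauss]_x (x ^+ 2) = 1 :> R.
Proof.
have key t : 0 < t -> 1 + (1 - t ^+ 2) / 2 * (\int[gauss]_x (x ^+ 2)) <= t^-1.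
  move=> t0; have := Rintegral_gauss_poly4 1 0 ((1 - t ^+ 2) / 2) 0 0.
  rewrite !mul0r !addr0 => <-.
  have -> : t^-1 = \int[gauss]_x (expR ((1 - t ^+ 2) * x ^+ 2 / 2)).
    by rewrite /Rintegral gauss_expR_sqr.
  apply: le_Rintegral => //.
  - exact: gauss_integrable_poly4.
  - apply/integrableP; split.
      apply/measurable_EFinP; apply: measurableT_comp => //; apply: measurable_funM => //.
      by apply: measurable_funM => //; exact: exprn_measurable.
    under eq_integral do rewrite gee0_abs ?lee_fin ?expR_ge0//.
    by rewrite gauss_expR_sqr// ltry.
  - move=> x _; rewrite !mul0r !addr0.
    by rewrite (le_trans _ (expR_ge1Dx _))// mulrAC.
set m := Rintegral _ _ _ in key *.
have key2 t : 0 < t -> t + (t - t ^+ 3) / 2 * m <= 1.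
  move=> t0; have := key _ t0; rewrite -(ler_pM2l t0) divff ?gt_eqF//.
  by apply: le_trans; rewrite le_eqVlt; apply/orP; left; apply/eqP; ring.
have m0 : 0 <= m by apply: Rintegral_ge0 => x _; exact: sqr_ge0.
apply/eqP; rewrite eq_le; apply/andP; split; apply/ler_addgt0Pr => e e0.
- have [em|em] := leP m (1 + e) => //.
  (* At t = 1 - d the factor t - t^3 equals d (1 - d) (2 - d): dividing by d leaves (1 - d) (2 - d)
     m <= 2, which excludes m > 1 + e for small d. *)
  pose d := Num.min (1 / 8%:R) (e / 4%:R).
  have d0 : 0 < d by rewrite lt_min !divr_gt0.
  have d1 : d <= 1 / 8%:R by rewrite ge_min lexx.
  have d2 : d <= e / 4%:R by rewrite ge_min lexx orbT.
  have {}key2 := key2 (1 - d) ltac:(lra).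
  have h1 : (1 - d) * (2 - d) * d * m <= 2 * d by nra.
  have h2 : (1 - d) * (2 - d) * m <= 2.
    by rewrite -(ler_pM2r d0) mulrAC.
  have h3 : (2 - 3 * d) * m <= 2 by have : 0 <= d ^+ 2 * m by [rewrite mulr_ge0 ?sqr_ge0]; lra.
  have h4 : (2 - 3 * d) * (1 + e) <= 2.
    by apply: le_trans h3; rewrite ler_wpM2l ?ltW//; lra.
  have h5 : d * e <= e / 8%:R by nra.
  lra.
- have [//|m1] := leP 1 (m + e).
  (* At t = 1 + d the factor t - t^3 is negative, so the same inequality now bounds m from below. *)
  pose d := Num.min 1 (e / 4%:R).
  have d0 : 0 < d by rewrite lt_min ltr01 divr_gt0.
  have d1 : d <= 1 by rewrite ge_min lexx.
  have d2 : d <= e / 4%:R by rewrite ge_min lexx orbT.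
  have {}key2 := key2 (1 + d) ltac:(lra).
  have h1 : 2 * d <= (1 + d) * (2 + d) * d * m by nra.
  have h2 : 2 <= (1 + d) * (2 + d) * m.
    by rewrite -(ler_pM2r d0) mulrAC.
  have h3 : (1 + d) * (2 + d) * m <= 2 * m + 4 * d.
    have -> : (1 + d) * (2 + d) * m = 2 * m + 3 * (d * m) + d * (d * m) by ring.
    have dm : d * m <= d by rewrite ler_piMr// ?ltW//; lra.
    have : d * (d * m) <= d * m by rewrite ler_piMl// mulr_ge0// ltW.
    lra.
  lra.
Qed.

(* Rotation by the rational angle [(3/5, 4/5)] applied to [x ^+ 4]. *)
Lemma gauss_moment4 : \int[gauss]_x (x ^+ 4) = 3 :> R.
Proof.
set m4 := (X in X = _).
have i4 := gauss_integrable_poly4.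
have toE f : gauss.-integrable setT (EFin \o f) ->
    (\int[gauss]_x (f x)%:E = (\int[gauss]_x f x)%:E)%E.
  by move=> fi; rewrite /Rintegral fineK// integrable_fin_num.
have m4E : (\int[gauss]_x (x ^+ 4)%:E = m4%:E)%E by rewrite toE//; exact: gauss_integrableX.
have := @gauss_rotation R (3%:R / 5%:R) (4%:R / 5%:R) (fun x => (x ^+ 4)%:E).
rewrite m4E => H.
have {H} := H ltac:(lra) ltac:(lra) ltac:(lra).
have mX : measurable_fun [set: R] (fun x : R => (x ^+ 4)%:E).
  by apply/measurable_EFinP; exact: exprn_measurable.
have X0 : (forall x : R, (0 <= (x ^+ 4)%:E)%E).
  by move=> x; rewrite lee_fin exprn_even_ge0.
move=> /(_ mX X0).
pose s : R := 3%:R / 5%:R; pose t : R := 4%:R / 5%:R; rewrite -/s -/t.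
(* The rotation gives m4 = (s^4 + t^4) m4 + 6 s^2 t^2, and 1 - s^4 - t^4 = 2 s^2 t^2. *)
have inner x : (\int[gauss]_y ((s * x + t * y) ^+ 4)%:E =
    (t ^+ 4 * m4 + 0 * x + (6%:R * s ^+ 2 * t ^+ 2) * x ^+ 2 + 0 * x ^+ 3 + s ^+ 4 * x ^+ 4)%:E)%E.
  rewrite (_ : (fun y => _) = (fun y => (s ^+ 4 * x ^+ 4 +
      (4%:R * s ^+ 3 * t * x ^+ 3) * y + (6%:R * s ^+ 2 * t ^+ 2 * x ^+ 2) * y ^+ 2 +
      (4%:R * s * t ^+ 3 * x) * y ^+ 3 + t ^+ 4 * y ^+ 4)%:E)); last first.
    by apply/funext => y; congr _%:E; ring.
  rewrite toE; last exact: i4.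
  by rewrite Rintegral_gauss_poly4 gauss_mean gauss_var gauss_moment3 -/m4; congr _%:E; ring.
under eq_integral do rewrite inner.
rewrite toE; last exact: i4.
rewrite Rintegral_gauss_poly4 gauss_mean gauss_var gauss_moment3 -/m4 => -[].
rewrite /s /t; lra.
Qed.

End gauss_moments.

(** * Hyperbolic functions and smooth steps *)

Section calculus.
Context {R : realType}.
Implicit Types (f g p q r : R -> R) (a b x y z : R).

Let mvt f f' a b : a <= b -> (forall x, is_derive x (1 : R) f (f' x)) ->
  exists2 c, a <= c <= b & f b - f a = f' c * (b - a).
Proof.
move=> ab df.
have cf : {within `[a, b], continuous f}.
  by apply: derivable_within_continuous => x _; exact: (@ex_derive _ _ _ _ _ _ _ (df x)).
by have [c hc e] := MVT_segment ab (fun x _ => df x) cf; exists c.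
Qed.

Lemma mean_value f f' a b : (forall x, is_derive x (1 : R) f (f' x)) ->
  exists2 c, `|c - a| <= `|b - a| & f b - f a = f' c * (b - a).
Proof.
move=> df; have [ab|/ltW ba] := leP a b.
  have [c /andP[h1 h2] e] := mvt ab df; exists c => //.
  by rewrite !ger0_norm ?subr_ge0//; lra.
have [c /andP[h1 h2] e] := mvt ba df; exists c; last by rewrite -opprB e; ring.
by rewrite !ler0_norm ?subr_le0//; lra.
Qed.

Lemma nondecreasing_ge0 f f' x : (forall x, is_derive x (1 : R) f (f' x)) ->
  0 <= f 0 -> (forall y, 0 <= y -> 0 <= f' y) -> 0 <= x -> 0 <= f x.
Proof.
move=> df f0 f'0 x0; have [c /andP[c0 _] e] := mvt x0 df.
by rewrite -(subrK (f 0) (f x)) e addr_ge0// mulr_ge0 ?f'0// subr_ge0.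
Qed.

(** The remainders of [q], [p] and [f] are bounded in turn by the mean value theorem, each being the
    derivative of the next. The constant M instead of M / 6 is enough. *)
Lemma taylor2 f p q r (M : R) :
  (forall x, is_derive x (1 : R) f (p x)) ->
  (forall x, is_derive x (1 : R) p (q x)) ->
  (forall x, is_derive x (1 : R) q (r x)) ->
  (forall x, `|r x| <= M) ->
  forall x y, `|f (x + y) - f x - p x * y - q x * y ^+ 2 / 2| <= M * `|y| ^+ 3.
Proof.
move=> df dp dq rM x y.
have M0 : 0 <= M by rewrite (le_trans _ (rM 0)).
have shift (h h' : R -> R) : (forall z, is_derive z (1 : R) h (h' z)) ->
    forall z, is_derive z (1 : R) (fun z => h (x + z)) (h' (x + z)).
  move=> dh z.
  have dz : is_derive z (1 : R) (fun z => x + z) (1 : R).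
    by apply: is_derive_eq; ring.
  have := @is_derive1_comp _ h (fun z => x + z) z (h' (x + z)) 1 (dh _) dz.
  by rewrite mulr1.
have q1 z : `|q (x + z) - q x| <= M * `|z|.
  have [c _ ->] := mean_value x (x + z) dq.
  by rewrite normrM addrAC subrr add0r ler_wpM2r.
have p1 z : `|p (x + z) - p x - q x * z| <= M * `|z| ^+ 2.
  pose k z := p (x + z) - p x - q x * z.
  have dk z' : is_derive z' (1 : R) k (q (x + z') - q x).
    have := shift _ _ dp z' => dd; apply: is_derive_eq.
    by rewrite /GRing.scale /=; ring.
  have k0 : k 0 = 0 by rewrite /k addr0; ring.
  have [c] := mean_value 0 z dk; rewrite k0 !subr0 => hc; rewrite {1}/k => ->.
  by rewrite normrM expr2 mulrA ler_wpM2r// (le_trans (q1 _))// ler_wpM2l.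
pose k z := f (x + z) - f x - p x * z - q x * z ^+ 2 / 2.
have dk z' : is_derive z' (1 : R) k (p (x + z') - p x - q x * z').
  have := shift _ _ df z' => dd; apply: is_derive_eq.
  by rewrite /GRing.scale /=; field.
have k0 : k 0 = 0 by rewrite /k addr0 expr0n /=; ring.
have [c] := mean_value 0 y dk; rewrite k0 !subr0 => hc; rewrite {1}/k => ->.
rewrite normrM exprSr mulrA ler_wpM2r// (le_trans (p1 _))// ler_wpM2l//.
by rewrite lerXn2r// nnegrE.
Qed.

(** A smooth substitute for the indicator of the negative half-line, with exponential tails. Since
    l' = l^2 - l, all its derivatives are polynomials in l and hence bounded. *)
Definition logistic x : R := (1 + expR x)^-1.

Lemma logistic_gt0 x : 0 < logistic x.
Proof. by rewrite invr_gt0 addr_gt0// expR_gt0. Qed.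

Lemma logistic_lt1 x : logistic x < 1.
Proof. by rewrite invf_lt1 ?addr_gt0 ?expR_gt0// ltrDl expR_gt0. Qed.

Lemma logistic_le_expR x : logistic x <= expR (- x).
Proof. by rewrite expRN lef_pV2 ?posrE ?addr_gt0 ?expR_gt0// lerDr. Qed.

Lemma logistic_ge1B x : 1 - expR x <= logistic x.
Proof.
rewrite -[leRHS]mul1r ler_pdivlMr ?addr_gt0 ?expR_gt0//.
by have := expR_gt0 x; nra.
Qed.

Lemma is_derive_logistic x : is_derive x (1 : R) logistic (logistic x ^+ 2 - logistic x).
Proof.
have h : 1 + expR x != 0 by rewrite gt_eqF// addr_gt0// expR_gt0.
have dd : is_derive x (1 : R) (fun x => 1 + expR x) (expR x).
  by apply: is_derive_eq; rewrite /GRing.scale /=; ring.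
have := @is_deriveV _ (fun x => 1 + expR x) x (expR x) 1 h dd => H.
apply: (is_derive_eq H).
by rewrite /logistic /GRing.scale /=; field.
Qed.

Lemma logistic_taylor : exists p q : R -> R,
  [/\ measurable_fun setT p, measurable_fun setT q,
      forall x, `|p x| <= 1, forall x, `|q x| <= 1 &
      forall x y, `|logistic (x + y) - logistic x - p x * y - q x * y ^+ 2 / 2|
                  <= 3 * `|y| ^+ 3].
Proof.
pose l := logistic.
pose p x := l x ^+ 2 - l x.
pose q x := (2 * l x - 1) * p x.
pose r x := 2 * p x * p x + (2 * l x - 1) * q x.
have dl := is_derive_logistic.
have dp x : is_derive x (1 : R) p (q x).
  have := dl x => dx; apply: is_derive_eq.
  by rewrite /q /p /l /GRing.scale /=; ring.
have dq x : is_derive x (1 : R) q (r x).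
  have := dl x => dx; have := dp x => dpx; apply: is_derive_eq.
  by rewrite /r /q /p /l /GRing.scale /=; ring.
have l01 x : 0 <= l x <= 1.
  by rewrite ltW ?logistic_gt0// ltW// logistic_lt1.
have p1 x : `|p x| <= 1.
  by have /andP[] := l01 x; rewrite /p ler_norml => h1 h2; apply/andP; split; nra.
have q1 x : `|q x| <= 1.
  rewrite /q normrM; have := p1 x; have : `|2 * l x - 1| <= 1.
    by have /andP[] := l01 x; rewrite ler_norml => h1 h2; apply/andP; split; lra.
  by move=> h1 h2; rewrite mulr_ile1.
have r3 x : `|r x| <= 3.
  rewrite /r; move: (q x) (q1 x) => Q Q1; apply: le_trans (ler_normD _ _) _; rewrite !normrM.
  have h : `|2 * l x - 1| <= 1.
    by have /andP[] := l01 x; rewrite ler_norml => h1 h2; apply/andP; split; lra.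
  have h2 : `|p x| * `|p x| <= 1 by rewrite mulr_ile1.
  have h3 : `|2 * l x - 1| * `|Q| <= 1 by rewrite mulr_ile1.
  have -> : `|2 : R| = 2 by rewrite ger0_norm.
  have : 2 * `|p x| * `|p x| = 2 * (`|p x| * `|p x|) by rewrite mulrA.
  by move=> ->; lra.
have ml : measurable_fun setT l.
  apply: continuous_measurable_fun => x; apply: differentiable_continuous.
  by apply/derivable1_diffP; exact: (@ex_derive _ _ _ _ _ _ _ (dl x)).
have mp : measurable_fun setT p by apply: measurable_funB => //; exact: measurable_funX.
exists p, q; split => //.
  apply: measurable_funM => //; apply: measurable_funB => //; exact: measurable_funM.
exact: (taylor2 dl dp dq).
Qed.

End calculus.

(** * A lower bound for ln cosh *)

Section cosh.
Context {R : realType}.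
Implicit Type x : R.

Definition cosh x : R := (expR x + expR (- x)) / 2.
Definition sinh x : R := (expR x - expR (- x)) / 2.

Lemma is_derive_expRN x : is_derive x (1 : R) (fun x : R => expR (- x)) (- expR (- x)).
Proof.
have := @is_derive1_comp _ expR -%R x (expR (- x)) (-1).
by rewrite mulrN1; apply.
Qed.

Lemma is_derive_cosh x : is_derive x (1 : R) cosh (sinh x).
Proof.
have := is_derive_expRN x => dd; apply: is_derive_eq.
by rewrite /sinh /GRing.scale /=; ring.
Qed.

Lemma is_derive_sinh x : is_derive x (1 : R) sinh (cosh x).
Proof.
have := is_derive_expRN x => dd; apply: is_derive_eq.
by rewrite /cosh /GRing.scale /=; ring.
Qed.

Lemma cosh_gt0 x : 0 < cosh x.
Proof. by rewrite divr_gt0// addr_gt0// expR_gt0. Qed.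

Lemma coshN x : cosh (- x) = cosh x.
Proof. by rewrite /cosh opprK addrC. Qed.

Lemma sinh_ge0 x : 0 <= x -> 0 <= sinh x.
Proof.
by move=> x0; rewrite divr_ge0// subr_ge0 ler_expR lerNl (le_trans _ x0)// oppr_le0.
Qed.

Lemma cosh_homo x y : `|x| <= `|y| -> cosh x <= cosh y.
Proof.
have cn z : cosh z = cosh `|z| by case: (ger0P z) => // _; rewrite coshN.
rewrite (cn x) (cn y); move: `|x| `|y| (normr_ge0 x) => {cn}x {}y x0 xy.
rewrite -subr_ge0; have := @nondecreasing_ge0 R (fun t => cosh (x + t) - cosh x) (fun t => sinh (x + t)) (y - x).
rewrite subrKC; apply => //; last 3 first.
- by rewrite addr0 subrr.
- by move=> t t0; apply: sinh_ge0; rewrite addr_ge0.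
- by rewrite subr_ge0.
move=> t; have := @is_derive1_comp _ cosh (fun z => x + z) t (sinh (x + t)) 1.
rewrite mulr1 => H.
have {}H : is_derive t (1 : R) (cosh \o (fun z => x + z)) (sinh (x + t)).
  apply: H; first exact: is_derive_cosh.
  by apply: is_derive_eq; rewrite /GRing.scale /=; ring.
by apply: is_derive_eq; rewrite /GRing.scale /=; ring.
Qed.

Lemma sinh_le_xcosh x : 0 <= x -> sinh x <= x * cosh x.
Proof.
move=> x0; rewrite -subr_ge0.
apply: (@nondecreasing_ge0 R (fun x => x * cosh x - sinh x) (fun x => x * sinh x)) => //.
- move=> z; have := is_derive_cosh z => d1; have := is_derive_sinh z => d2.
  by apply: is_derive_eq; rewrite /GRing.scale /=; ring.
- by rewrite mul0r /sinh oppr0 subrr mul0r subrr.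
- by move=> y y0; rewrite mulr_ge0// sinh_ge0.
Qed.

(** The Taylor minorant of tanh, multiplied by [cosh] to avoid a quotient; the derivative of the
    difference is a sum of nonnegative terms by [sinh_le_xcosh]. *)
Lemma sinh_lower x : 0 <= x -> (x - x ^+ 3 / 3) * cosh x <= sinh x.
Proof.
move=> x0; rewrite -subr_ge0.
apply: (@nondecreasing_ge0 R (fun x => sinh x - (x - x ^+ 3 / 3) * cosh x)
  (fun x => x * (x * cosh x - sinh x) + x ^+ 3 / 3 * sinh x)) => //.
- move=> z; have := is_derive_cosh z => d1; have := is_derive_sinh z => d2.
  by apply: is_derive_eq; rewrite /GRing.scale /=; field.
- by rewrite /sinh oppr0 expr0n /=; lra.
- move=> y y0; rewrite addr_ge0// mulr_ge0//.
  + by rewrite subr_ge0 sinh_le_xcosh.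
  + by rewrite divr_ge0// exprn_ge0.
  + exact: sinh_ge0.
Qed.

(** Integrated form of [sinh_lower]. One side of the expansion suffices, as the likelihood ratio
    only has to be bounded from below. *)
Lemma expR_le_cosh x : expR (x ^+ 2 / 2 - x ^+ 4 / 12) <= cosh x.
Proof.
wlog x0 : x / 0 <= x => [H|].
  have [/H//|x0] := leP 0 x.
  have := H (- x); rewrite coshN sqrrN (_ : (- x) ^+ 4 = x ^+ 4); last by ring.
  by apply; rewrite oppr_ge0 ltW.
pose e (x : R) := - x ^+ 2 / 2 + x ^+ 4 / 12.
have de z : is_derive z (1 : R) e (- z + z ^+ 3 / 3).
  by apply: is_derive_eq; rewrite /GRing.scale /=; field.
have dE z : is_derive z (1 : R) (fun z => expR (e z)) (expR (e z) * (- z + z ^+ 3 / 3)).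
  exact: (@is_derive1_comp _ expR e z _ _ (is_derive_expR _) (de z)).
have : 0 <= cosh x * expR (e x) - 1.
  apply: (@nondecreasing_ge0 R (fun x => cosh x * expR (e x) - 1)
    (fun x => (sinh x - (x - x ^+ 3 / 3) * cosh x) * expR (e x))) => //.
  - move=> z; have := is_derive_cosh z => d1; have := dE z => d2.
    by apply: is_derive_eq; rewrite /GRing.scale /=; ring.
  - by rewrite /e /cosh oppr0 !expr0n /= oppr0 !mul0r addr0 expR0; lra.
  - by move=> y y0; rewrite mulr_ge0 ?expR_ge0// subr_ge0 sinh_lower.
rewrite subr_ge0 (_ : x ^+ 2 / 2 - x ^+ 4 / 12 = - e x); last by rewrite /e; ring.
by move=> h; rewrite expRN -div1r ler_pdivrMr ?expR_gt0.
Qed.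
End cosh.

(** * Observation laws *)

Section obs_space.
Context {R : realType}.
Notation obs := (@obs R).

Definition rect (A : nat -> set R) : set obs := [set y | forall j, A j (y j)].

(** Only finitely many coordinates are constrained, so that [mutually_independent] gives the
    probability of these sets; they form a generating system closed under intersection. *)
Definition rects : set (set obs) :=
  [set S | exists A : nat -> set R, [/\ (forall j, measurable (A j)),
     (exists m : nat, forall j, (m <= j)%N -> A j = setT) & S = rect A]].

Lemma measurable_coord j : measurable_fun [set: obs] (fun y : obs => y j).
Proof.
move=> _ B mB; apply: sub_sigma_algebra.
by exists j => //; exists B.
Qed.

Lemma measurable_rect (A : nat -> set R) : (forall j, measurable (A j)) ->
  measurable (rect A).
Proof.
move=> mA; rewrite (_ : rect A = \bigcap_j ((fun y : obs => y j) @^-1` A j)); last first.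
  by apply/seteqP; split => [y Ay j _|y Ay j]; [exact: Ay|exact: Ay].
apply: bigcapT_measurable => j.
by rewrite -[X in measurable X]setTI; exact: measurable_coord.
Qed.

Lemma measurable_obsE : (measurable : set (set obs)) = <<s rects >>.
Proof.
apply/seteqP; split.
  apply: smallest_sub; first exact: smallest_sigma_algebra.
  move=> _ [j _ [B mB <-]]; apply: sub_sigma_algebra.
  exists (fun i => if i == j then B else setT); split.
  - by move=> i; case: ifP.
  - by exists j.+1 => i ji; rewrite gtn_eqF.
  - apply/seteqP; split => [y [_ By] i|y Ay]; first by case: eqP => [->|].
    by split => //; have := Ay j; rewrite eqxx.
apply: smallest_sub.
  exact: (@sigma_algebra_measurable _ obs).
by move=> _ [A [mA _ ->]]; exact: measurable_rect.
Qed.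

Lemma rects_setI : setI_closed rects.
Proof.
move=> _ _ [A [mA [m Am] ->]] [B [mB [n Bn] ->]].
exists (fun j => A j `&` B j); split.
- by move=> j; exact: measurableI.
- exists (maxn m n) => j; rewrite geq_max => /andP[mj nj].
  by rewrite Am// Bn// setTI.
- by apply/seteqP; split => [y [Ay By] j|y ABy]; [split|split => j; case: (ABy j)].
Qed.

Lemma obs_measure_unique (m1 m2 : {measure set obs -> \bar R}) :
  (m1 setT < +oo)%E -> (forall S, rects S -> m1 S = m2 S) ->
  forall S, measurable S -> m1 S = m2 S.
Proof.
move=> m1T m12; apply: (@measure_unique _ R obs rects (fun=> setT)) => //.
- exact: measurable_obsE.
- exact: rects_setI.
- move=> _; exists (fun=> setT); split => //; first by exists 0%N.
  by apply/seteqP.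
- by rewrite bigcup_const//; exists 0%N.
Qed.

Lemma measurable_fun_obs d (T : measurableType d) (f : T -> obs) :
  (forall j, measurable_fun setT (fun t => f t j)) -> measurable_fun setT f.
Proof.
move=> mf; apply: (@measurability _ _ _ _ setT f rects).
  exact: measurable_obsE.
move=> _ [_ [A [mA _ ->]] <-]; rewrite setTI.
rewrite (_ : f @^-1` rect A = \bigcap_j ((fun t => f t j) @^-1` A j)); last first.
  by apply/seteqP; split => [y Ay j _|y Ay j]; [exact: Ay|exact: Ay].
apply: bigcapT_measurable => j.
by rewrite -[X in measurable X]setTI; exact: mf.
Qed.

Definition upd (k : nat) (y : obs) (z : R) : obs :=
  fun j => if j == k then z else y j.

End obs_space.

(** * Redrawing one coordinate of the noise *)

Section noise.
Context {R : realType} {d : measure_display} {Om : measurableType d}.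
Variables (P : probability Om R) (xi : nat -> {RV P >-> R}).
Hypothesis xi_indep : mutually_independent xi.
Hypothesis xi_gauss : forall j, standard_gaussian (xi j).
Notation obs := (@obs R).
Notation gauss := (@gauss R).

Definition noise (w : Om) : obs := fun j => xi j w.

Lemma measurable_noise : measurable_fun [set: Om] noise.
Proof. by apply: measurable_fun_obs => j; exact: measurable_funPT. Qed.

Lemma P_xi j (A : set R) : measurable A -> P (xi j @^-1` A) = gauss A.
Proof. by move=> mA; exact: (xi_gauss j mA). Qed.

Let P_rect (A : nat -> set R) m : (forall j, measurable (A j)) ->
  (forall j, (m <= j)%N -> A j = setT) ->
  P (noise @^-1` rect A) = (\prod_(j < m) gauss (A j))%E.
Proof.
move=> mA Am.
pose J : {fset nat} := [fset j in iota 0 m]%fset.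
have JE j : (j \in J) = (j < m)%N by rewrite !inE mem_iota.
rewrite (_ : noise @^-1` rect A = \bigcap_(j in [set` J]) (xi j @^-1` A j)); last first.
  apply/seteqP; split => [w Aw j _|w Aw j]; first exact: Aw.
  have [jm|mj] := ltnP j m; last by rewrite Am.
  by apply: Aw; rewrite /= JE.
rewrite xi_indep; last by move=> j _; exact: mA.
rewrite -(big_mkord xpredT (fun j => gauss (A j))) /index_iota subn0.
rewrite (perm_big (iota 0 m)); last first.
  apply: uniq_perm; [exact: fset_uniq|exact: iota_uniq|move=> j].
  by rewrite JE mem_iota.
by apply: eq_bigr => j _; exact: P_xi.
Qed.

Let resample k (wz : Om * R) : obs := upd k (noise wz.1) wz.2.

Lemma measurable_resample k :
  measurable_fun [set: Om * R] (fun wz : Om * R => upd k (noise wz.1) wz.2).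
Proof.
apply: measurable_fun_obs => j; rewrite /upd.
case: eqP => _; first exact: measurable_snd.
by apply: measurableT_comp; [exact: measurable_funPT|exact: measurable_fst].
Qed.

Let law0 : {measure set obs -> \bar R} :=
  measure_function_pushforward__canonical__measure_function_Measure P measurable_noise.

Let law1 k : {measure set obs -> \bar R} :=
  measure_function_pushforward__canonical__measure_function_Measure (P \x gauss)%E
    (measurable_resample k).

Let law01 k S : measurable S -> law0 S = law1 k S.
Proof.
apply: obs_measure_unique.
  by rewrite /= /pushforward preimage_setT [ltLHS](@probability_setT _ _ _ P) ltry.
move=> _ [A [mA [m0 Am0] ->]] /=; rewrite /pushforward.
(* The range of the product must contain [k], whose factor is split off below. *)
pose m := maxn m0 k.+1.
have Am j : (m <= j)%N -> A j = setT.
  by rewrite geq_max => /andP[m0j _]; exact: Am0.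
have km : (k < m)%N by rewrite leq_max leqnn orbT.
pose A' j := if j == k then setT else A j.
have mA' j : measurable (A' j) by rewrite /A'; case: ifP.
have A'm j : (m <= j)%N -> A' j = setT.
  by move=> mj; rewrite /A' Am//; case: ifP.
rewrite (_ : resample k @^-1` rect A = (noise @^-1` rect A') `*` A k); last first.
  apply/seteqP; split => [[w z] Awz|[w z] [/= Aw Az] j]; last first.
    by rewrite /resample /upd /=; have := Aw j; rewrite /A'; case: eqP => [->|].
  split => /=; last by have := Awz k; rewrite /resample /upd eqxx.
  by move=> j; have := Awz j; rewrite /resample /upd /A' /=; case: eqP.
rewrite product_measure1E//; last first.
  rewrite -[X in measurable X]setTI.
  by apply: measurable_noise => //; exact: measurable_rect.
rewrite (P_rect mA Am) [X in (X * _)%E](P_rect mA' A'm).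
rewrite (bigD1 (Ordinal km))//= [in RHS](bigD1 (Ordinal km))//=.
rewrite {1}/A' eqxx [X in (X * _ * _)%E](@probability_setT _ _ _ gauss) mul1e muleC.
congr (_ * _)%E; apply: eq_bigr => j jk.
by rewrite /A' -val_eqE /= in jk *; rewrite (negbTE jk).
Qed.

(** Replacing coordinate [k] by an independent copy leaves the law unchanged, because both laws
    agree on finite rectangles. All later uses of independence go through this identity. *)
Lemma resampling k (F : obs -> \bar R) : measurable_fun setT F -> (forall y, 0 <= F y)%E ->
  (\int[P]_w F (noise w) = \int[P]_w \int[gauss]_z F (upd k (noise w) z))%E.
Proof.
move=> mF F0.
transitivity (\int[law0]_y F y)%E.
  by rewrite (ge0_integral_pushforward measurable_noise).
transitivity (\int[law1 k]_y F y)%E.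
  by apply: eq_measure_integral => S mS _; exact: law01.
rewrite (ge0_integral_pushforward (measurable_resample k))//.
rewrite preimage_setT fubini_tonelli1//.
  by apply: measurableT_comp => //; exact: measurable_resample.
by move=> x; exact: F0.
Qed.

End noise.

Section noise_sums.
Context {R : realType} {d : measure_display} {Om : measurableType d}.
Variables (P : probability Om R) (xi : nat -> {RV P >-> R}).
Hypothesis xi_indep : mutually_independent xi.
Hypothesis xi_gauss : forall j, standard_gaussian (xi j).
Notation obs := (@obs R).
Notation gauss := (@gauss R).
Notation noise := (noise xi).

Lemma measurable_xi j : measurable_fun [set: Om] (xi j).
Proof. exact: measurable_funPT. Qed.

Lemma measurable_sum_xi n (h : nat -> R -> R) :
  (forall j, measurable_fun setT (h j)) ->
  measurable_fun [set: Om] (fun w => \sum_(j < n) h j (xi j w)).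
Proof.
move=> mh; apply: measurable_sum => j.
by apply: measurableT_comp; [exact: mh|exact: measurable_xi].
Qed.

Lemma measurable_sum_coord n (h : nat -> R -> R) :
  (forall j, measurable_fun setT (h j)) ->
  measurable_fun [set: obs] (fun y : obs => \sum_(j < n) h j (y j)).
Proof.
move=> mh; apply: measurable_sum => j.
by apply: measurableT_comp; [exact: mh|exact: measurable_coord].
Qed.

Lemma sum_upd n (h : nat -> R -> R) (y : obs) z :
  \sum_(j < n.+1) h j (upd n y z j) = \sum_(j < n) h j (y j) + h n z.
Proof.
rewrite big_ord_recr /= {2}/upd eqxx; congr (_ + _); apply: eq_bigr => j _.
by rewrite /upd ltn_eqF.
Qed.

Lemma gauss_RintegralE (f : R -> R) : gauss.-integrable setT (EFin \o f) ->
  (\int[gauss]_x (f x)%:E = (\int[gauss]_x f x)%:E)%E.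
Proof. by move=> fi; rewrite /Rintegral fineK// integrable_fin_num. Qed.

Let gauss_sqrD (h : R -> R) a : gauss.-integrable setT (EFin \o h) ->
  gauss.-integrable setT (EFin \o (fun x => h x ^+ 2)) ->
  \int[gauss]_x h x = 0 ->
  (\int[gauss]_x ((a + h x) ^+ 2)%:E = (a ^+ 2 + \int[gauss]_x (h x ^+ 2))%:E)%E.
Proof.
move=> ih ih2 h0.
rewrite EFinD -(gauss_RintegralE ih2) -(integral_gauss_cst (a ^+ 2)).
transitivity (\int[gauss]_x ((a ^+ 2 + 2 * a * h x)%:E + (h x ^+ 2)%:E))%E.
  by apply: eq_integral => x _; rewrite -EFinD; congr _%:E; ring.
have ic : gauss.-integrable setT (EFin \o (fun=> a ^+ 2 : R)).
  exact: finite_measure_integrable_cst.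
have iZ : gauss.-integrable setT (EFin \o (fun x => 2 * a * h x)).
  have := integrableZl measurableT (2 * a) ih.
  by congr integrable; apply/funext => x; rewrite /= EFinM.
have iD : gauss.-integrable setT (EFin \o (fun x => a ^+ 2 + 2 * a * h x)).
  have := integrableD measurableT ic iZ.
  by congr integrable; apply/funext => x; rewrite /= EFinD.
rewrite integralD//; congr (_ + _)%E.
rewrite (gauss_RintegralE iD) (RintegralD measurableT ic iZ) RintegralZl// h0 mulr0 addr0.
by rewrite -(gauss_RintegralE ic).
Qed.

(** Redrawing the last coordinate, the cross term integrates to 0 since [h n] is centred. *)
Lemma noise_variance n (h : nat -> R -> R) :
  (forall j, gauss.-integrable setT (EFin \o h j)) ->
  (forall j, gauss.-integrable setT (EFin \o (fun x => h j x ^+ 2))) ->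
  (forall j, \int[gauss]_x h j x = 0) ->
  (\int[P]_w ((\sum_(j < n) h j (xi j w)) ^+ 2)%:E =
   (\sum_(j < n) \int[gauss]_x (h j x ^+ 2))%:E)%E.
Proof.
move=> ih ih2 h0.
have mh j : measurable_fun setT (h j).
  by apply/measurable_EFinP; exact: (measurable_int _ (ih j)).
elim: n => [|n IH].
  under eq_integral do rewrite big_ord0 expr0n /=.
  by rewrite big_ord0 integral0.
have := @resampling _ _ _ _ _ xi_indep xi_gauss n
  (fun y => ((\sum_(j < n.+1) h j (y j)) ^+ 2)%:E).
rewrite /noise => -> //; last 2 first.
  by apply/measurable_EFinP/measurable_funX; exact: measurable_sum_coord.
  by move=> y; rewrite lee_fin sqr_ge0.
under eq_integral do under eq_integral do rewrite sum_upd.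
under eq_integral do rewrite gauss_sqrD// EFinD.
rewrite ge0_integralD//; first last.
- by move=> w _; rewrite lee_fin; apply: Rintegral_ge0 => x _; exact: sqr_ge0.
- by apply/measurable_EFinP/measurable_funX; exact: measurable_sum_xi.
- by move=> w _; rewrite lee_fin sqr_ge0.
rewrite IH integral_cst// [X in (_ * X)%E](@probability_setT _ _ _ P) mule1.
by rewrite big_ord_recr.
Qed.

Definition displace n (c : nat -> R) (y : obs) : obs :=
  fun j => if (j < n)%N then y j + c j else y j.

Lemma measurable_displace n c : measurable_fun [set: obs] (displace n c).
Proof.
apply: measurable_fun_obs => j; rewrite /displace; case: (j < n)%N.
  by apply: measurable_funD => //; exact: measurable_coord.
exact: measurable_coord.
Qed.

Lemma measurable_upd k (y : obs) : measurable_fun [set: R] (upd k y).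
Proof. by apply: measurable_fun_obs => j; rewrite /upd; case: eqP. Qed.

(** Density, relative to the standard Gaussian law, of the equal mixture of the Gaussian laws with
    means c and -c and variance 1. *)
Definition tilt (c x : R) : R := expR (- c ^+ 2 / 2) * cosh (c * x).

Lemma measurable_cosh : measurable_fun setT (@cosh R).
Proof.
apply: measurable_funM => //; apply: measurable_funD => //.
by apply: measurableT_comp => //; exact: oppr_measurable.
Qed.

Lemma measurable_tilt c : measurable_fun setT (tilt c).
Proof.
by apply: measurable_funM => //; apply: (measurableT_comp measurable_cosh).
Qed.

Lemma tilt_ge0 c x : 0 <= tilt c x.
Proof. by rewrite mulr_ge0 ?expR_ge0// ltW// cosh_gt0. Qed.

Lemma gauss_tilt (c : R) (f : R -> \bar R) :
  measurable_fun setT f -> (forall x, 0 <= f x)%E ->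
  (\int[gauss]_x (f x * (tilt c x)%:E) =
   2^-1%:E * \int[gauss]_x f (x + c)%R + 2^-1%:E * \int[gauss]_x f (x - c)%R)%E.
Proof.
move=> mf f0; rewrite !gauss_shift//.
have mE a : measurable_fun setT (fun x : R => (expR (a * x - a ^+ 2 / 2))%:E).
  apply/measurable_EFinP; apply: measurableT_comp => //.
  by apply: measurable_funB => //; exact: measurable_funM.
have mfE a : measurable_fun setT (fun x : R => f x * (expR (a * x - a ^+ 2 / 2))%:E)%E.
  exact: emeasurable_funM.
have E0 a x : (0 <= f x * (expR (a * x - a ^+ 2 / 2))%:E)%E.
  by rewrite mule_ge0// lee_fin expR_ge0.
have h0 : (0 <= 2^-1%:E :> \bar R)%E by rewrite lee_fin invr_ge0.
rewrite -(ge0_integralZl gauss measurableT (mfE c) (fun x _ => E0 c x) h0).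
rewrite -(ge0_integralZl gauss measurableT (mfE (- c)) (fun x _ => E0 (- c) x) h0).
rewrite -ge0_integralD//; first last.
- exact: emeasurable_funM.
- by move=> x _; rewrite mule_ge0// lee_fin invr_ge0.
- exact: emeasurable_funM.
- by move=> x _; rewrite mule_ge0// lee_fin invr_ge0.
apply: eq_integral => x _; rewrite !(muleCA _ (f x)) -ge0_muleDr; last 2 first.
  by rewrite -EFinM lee_fin mulr_ge0 ?invr_ge0 ?expR_ge0.
  by rewrite -EFinM lee_fin mulr_ge0 ?invr_ge0 ?expR_ge0.
congr (_ * _)%E; rewrite -!EFinM -EFinD; congr _%:E.
rewrite /tilt /cosh sqrrN !expRD !mulNr; by field.
Qed.

(* Averaging over the sign of one coordinate turns its shift into a factor [tilt]. *)
Lemma sign_mixture n (c : nat -> R) (B : R) (H : obs -> \bar R) :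
  measurable_fun setT H -> (forall y, 0 <= H y)%E ->
  (forall c', (forall j, c' j = c j \/ c' j = - c j) ->
     (\int[P]_w H (displace n c' (noise w)) <= B%:E)%E) ->
  (\int[P]_w (H (noise w) *
     (\prod_(j < n) (expR (- c j ^+ 2 / 2) * cosh (c j * xi j w)))%:E) <= B%:E)%E.
Proof.
elim: n H => [|n IH] H mH H0 HB.
  under eq_integral do rewrite big_ord0 mule1.
  by have := HB c (fun=> or_introl erefl).
(* The factor of coordinate [n] is absorbed in the integrand, so that the induction hypothesis
   applies to the first [n] coordinates. *)
pose H' (y : obs) := (H y * (tilt (c n) (y n))%:E)%E.
have mH' : measurable_fun setT H'.
  apply: emeasurable_funM => //; apply/measurable_EFinP.
  by apply: measurableT_comp; [exact: measurable_tilt|exact: measurable_coord].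
have H'0 y : (0 <= H' y)%E by rewrite mule_ge0// lee_fin tilt_ge0.
under eq_integral.
  move=> w _; rewrite big_ord_recr /= mulrC EFinM muleA.
  rewrite -/(tilt _ _) (_ : (_ * (tilt _ _)%:E)%E = H' (noise w))//.
  over.
apply: IH => // c' cc'.
pose cp (e : R) j := if j == n then e else c' j.
have cpc e j : e = c n \/ e = - c n -> cp e j = c j \/ cp e j = - c j.
  by rewrite /cp; case: eqP => // ->.
have displace_upd e y z : displace n.+1 (cp e) (upd n y z) = upd n (displace n c' y) (z + e).
  apply/funext => j; rewrite /displace /upd /cp ltnS leq_eqVlt.
  by case: eqP => [->|].
have mHs e : measurable_fun setT (fun y => H (displace n.+1 (cp e) y)).
  by apply: measurableT_comp => //; exact: measurable_displace.
rewrite (@resampling _ _ _ _ _ xi_indep xi_gauss n (fun y => H' (displace n c' y)))//; last first.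
  by apply: measurableT_comp => //; exact: measurable_displace.
(* With coordinate [n] redrawn, its tilt becomes the half-sum of the shifts by [c n] and [- c n],
   and each of them is covered by [HB]. *)
have step y : (\int[gauss]_z H' (displace n c' (upd n y z)) =
   2^-1%:E * \int[gauss]_z H (displace n.+1 (cp (c n)) (upd n y z)) +
   2^-1%:E * \int[gauss]_z H (displace n.+1 (cp (- c n)%R) (upd n y z)))%E.
  transitivity (\int[gauss]_z (H (upd n (displace n c' y) z) * (tilt (c n) z)%:E))%E.
    apply: eq_integral => z _; rewrite /H' /displace ltnn {3}/upd eqxx; congr (H _ * _)%E.
    by apply/funext => j; rewrite /upd; case: eqP => [->|//]; rewrite ltnn.
  rewrite (@gauss_tilt _ (fun z => H (upd n (displace n c' y) z)))//; last first.
    by apply: measurableT_comp => //; exact: measurable_upd.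
  by congr (_ * _ + _ * _)%E; apply: eq_integral => z _; rewrite displace_upd.
under eq_integral do rewrite step.
have mI e : measurable_fun setT (fun w => \int[gauss]_z H (displace n.+1 (cp e) (upd n (noise w) z)))%E.
  apply: (@measurable_fun_fubini_tonelli_F _ _ _ _ _ gauss
    (fun wz : Om * R => H (displace n.+1 (cp e) (upd n (noise wz.1) wz.2)))) => //.
  exact: (measurableT_comp (mHs e) (measurable_resample xi n)).
have I0 e w : (0 <= \int[gauss]_z H (displace n.+1 (cp e) (upd n (noise w) z)))%E.
  by apply: integral_ge0 => z _; exact: H0.
rewrite ge0_integralD//; first last.
- exact: emeasurable_funM.
- by move=> w _; rewrite mule_ge0// lee_fin invr_ge0.
- exact: emeasurable_funM.
- by move=> w _; rewrite mule_ge0// lee_fin invr_ge0.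
rewrite !ge0_integralZl//; try by rewrite lee_fin invr_ge0.
rewrite -!(@resampling _ _ _ _ _ xi_indep xi_gauss n (fun y => H (displace n.+1 (cp _) y)))//.
have -> : B%:E = (2^-1%:E * B%:E + 2^-1%:E * B%:E)%E.
  by rewrite -!EFinM -EFinD; congr _%:E; field.
apply: leeD; apply: lee_wpmul2l; rewrite ?lee_fin ?invr_ge0//; apply: HB => j; apply: cpc.
  by left.
by right.
Qed.
End noise_sums.

(** * A central limit theorem by Lindeberg replacement *)

Section bounded_integral.
Context {R : realType} {d : measure_display} {T : measurableType d}.
Variable P : probability T R.
Implicit Types (f g : T -> R) (C : R).

Lemma bounded_integrable f C : measurable_fun setT f ->
  (forall x, `|f x| <= C) -> P.-integrable setT (EFin \o f).
Proof.
move=> mf fC; apply: measurable_bounded_integrable => //.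
  by rewrite [ltLHS](@probability_setT _ _ _ P) ltry.
exists C; split; first by rewrite num_real.
by move=> M CM x _; apply: le_trans (fC x) _; exact: ltW.
Qed.

Lemma Rintegral_cst_prob C : \int[P]_x C = C.
Proof. by rewrite Rintegral_cst// [X in fine X](@probability_setT _ _ _ P) mulr1. Qed.

Lemma Rintegral_norm_le f C : measurable_fun setT f -> (forall x, `|f x| <= C) ->
  `|\int[P]_x f x| <= C.
Proof.
move=> mf fC; have fi := bounded_integrable mf fC.
apply: le_trans (le_normr_Rintegral _ fi) _ => //.
rewrite -[leRHS]Rintegral_cst_prob; apply: le_Rintegral => //.
  by apply: (@bounded_integrable _ C) => [|x]; [exact: measurableT_comp|rewrite normr_id].
exact: finite_measure_integrable_cst.
Qed.

Lemma RintegralE f : P.-integrable setT (EFin \o f) ->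
  (\int[P]_x (f x)%:E = (\int[P]_x f x)%:E)%E.
Proof. by move=> fi; rewrite /Rintegral fineK// integrable_fin_num. Qed.

End bounded_integral.

(** * Gaussian smoothing and exchange of one variable *)

Section smoothing.
Context {R : realType}.
Notation gauss := (@gauss R).
Implicit Types (f g p q : R -> R) (M B s t x y z : R).

Definition smear s g x := \int[gauss]_z g (x + s * z).

Definition tame B g := measurable_fun setT g /\ forall x, `|g x| <= B.

Lemma measurable_line x s : measurable_fun setT (fun z : R => x + s * z).
Proof. by apply: measurable_funD => //; exact: measurable_funM. Qed.

Lemma tame_integrable B g s x : tame B g ->
  gauss.-integrable setT (EFin \o (fun z => g (x + s * z))).
Proof.
move=> [mg gB]; apply: (@bounded_integrable _ _ _ _ _ B) => //.
by apply: measurableT_comp => //; exact: measurable_line.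
Qed.

(** Measurability in x is that of a partial integral over a product measure, where boundedness
    provides integrability. *)
Lemma tame_average B g (X : R -> R) : measurable_fun setT X -> tame B g ->
  tame B (fun x => \int[gauss]_z g (x + X z)).
Proof.
move=> mX [mg gB]; split; last first.
  move=> x; apply: Rintegral_norm_le => //.
  by apply: measurableT_comp => //; exact: measurable_funD.
pose F (z : R * R) : \bar R := (g (z.1 + X z.2))%:E.
have mF : measurable_fun setT F.
  apply/measurable_EFinP; apply: measurableT_comp => //.
  apply: measurable_funD; first exact: measurable_fst.
  by apply: measurableT_comp => //; exact: measurable_snd.
have h : measurable_fun setT (fubini_F gauss F).
  apply: (@measurable_fubini_F _ _ _ _ _ gauss gauss).
  apply/integrableP; split => //.
  apply: (@le_lt_trans _ _ (\int[gauss \x gauss]_z (cst B%:E) z)%E).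
    apply: ge0_le_integral => //.
    - exact: measurableT_comp.
    - by move=> z _; rewrite /= lee_fin; exact: gB.
  have hT : (gauss \x gauss)%E [set: R * R] = 1%E.
    rewrite -setXTT; apply: etrans (product_measure1E _ _ _ _) _ => //.
    by rewrite [X in (X * X)%E](@probability_setT _ _ _ gauss) mule1.
  by rewrite integral_cst// [X in (_ * X)%E]hT mule1 ltry.
rewrite (_ : (fun x => _) = fine \o fubini_F gauss F)//.
by apply: measurableT_comp => //; exact: fine_measurable.
Qed.

Lemma tame_smear B g s : tame B g -> tame B (smear s g).
Proof. by apply: tame_average; exact: measurable_funM. Qed.

Lemma smear0 g : smear 0 g = g.
Proof.
apply/funext => x; rewrite /smear.
transitivity (\int[gauss]_z g x); last exact: Rintegral_cst_prob.
by apply: eq_Rintegral => z _; rewrite mul0r addr0.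
Qed.

(** The variances of independent Gaussian variables add: this is [gauss_rotation] after rescaling by
    [r], which must be nonzero, hence the separate case. *)
Lemma smear_smear s t g : 0 <= s -> 0 <= t -> measurable_fun setT g ->
  (forall x, 0 <= g x <= 1) ->
  smear s (smear t g) = smear (Num.sqrt (s ^+ 2 + t ^+ 2)) g.
Proof.
move=> s0 t0 mg g01; set r := Num.sqrt _.
have r2 : r ^+ 2 = s ^+ 2 + t ^+ 2 by rewrite sqr_sqrtr// addr_ge0// sqr_ge0.
have [r00|r0] := eqVneq r 0.
  move/eqP : r2; rewrite r00 expr0n /= eq_sym paddr_eq0 ?sqr_ge0// !sqrf_eq0.
  by move=> /andP[/eqP -> /eqP ->]; rewrite !smear0.
have tg : tame 1 g.
  by split => // x; have /andP[? ?] := g01 x; rewrite ger0_norm.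
apply/funext => x; apply: EFin_inj.
rewrite /smear -!RintegralE; last 2 first.
  exact: tame_integrable tg.
  exact: (tame_integrable _ _ (tame_smear t tg)).
have := @gauss_rotation R (s / r) (t / r) (fun v => (g (x + r * v))%:E).
have rp : 0 <= r by rewrite sqrtr_ge0.
move=> <-; rewrite ?divr_ge0//; last 3 first.
- by rewrite !exprMn -mulrDl -r2 exprVn divff// sqrf_eq0.
- by apply/measurable_EFinP; apply: measurableT_comp => //; exact: measurable_line.
- by move=> v; rewrite lee_fin; case/andP: (g01 (x + r * v)).
apply: eq_integral => z _; rewrite -RintegralE; last exact: tame_integrable tg.
by apply: eq_integral => z' _; congr (g _)%:E; field.
Qed.

(** Derivatives enter only through the third-order Taylor bound. In this form smoothness is
    inherited by [smear] with the same M, by averaging [p] and [q], without differentiating under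
    the integral. *)
Definition smooth M g := [/\ measurable_fun setT g, forall x, 0 <= g x <= 1 &
  exists p q, [/\ exists B, tame B p, exists B, tame B q & forall x y,
    `|g (x + y) - g x - p x * y - q x * y ^+ 2 / 2| <= M * `|y| ^+ 3]].

Lemma smooth_tame M g : smooth M g -> tame 1 g.
Proof.
by move=> [mg g01 _]; split => // x; have /andP[? ?] := g01 x; rewrite ger0_norm.
Qed.

Lemma smooth_smear M g s : smooth M g -> smooth M (smear s g).
Proof.
move=> sg; have tg := smooth_tame sg; case: sg => mg g01 [p [q [[B tp] [B' tq] hpq]]].
have [ms _] := tame_smear s tg.
split => //.
  move=> x; apply/andP; split.
    by apply: Rintegral_ge0 => z _; case/andP: (g01 (x + s * z)).
  rewrite -[leRHS](Rintegral_cst_prob gauss); apply: le_Rintegral => //.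
  - exact: tame_integrable tg.
  - exact: finite_measure_integrable_cst.
  - by move=> z _; case/andP: (g01 (x + s * z)).
exists (smear s p), (smear s q); split.
- by exists B; exact: tame_smear.
- by exists B'; exact: tame_smear.
move=> x y; rewrite /smear.
have i1 := tame_integrable s (x + y) tg.
have i2 := tame_integrable s x tg.
have i3 := tame_integrable s x tp.
have i4 := tame_integrable s x tq.
have Zr f c : gauss.-integrable setT (EFin \o f) ->
    gauss.-integrable setT (EFin \o (fun z => f z * c)).
  move=> fi; have := integrableZr measurableT c fi.
  by congr integrable; apply/funext => z; rewrite /= EFinM.
have Bi f f' : gauss.-integrable setT (EFin \o f) -> gauss.-integrable setT (EFin \o f') ->
    gauss.-integrable setT (EFin \o (fun z => f z - f' z)).
  move=> fi f'i; have := integrableB measurableT fi f'i.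
  by congr integrable; apply/funext => z; rewrite /= EFinB.
rewrite -mulrA -RintegralZr// -[X in _ - X]RintegralZr//.
rewrite -RintegralB// -RintegralB//; [|exact: Bi|exact: Zr].
rewrite -RintegralB//; [|by apply: (Bi _ _ (Bi _ _ i1 i2) (Zr _ _ i3))|exact: Zr].
apply: Rintegral_norm_le.
  have mz f v : measurable_fun setT f -> measurable_fun setT (fun z => f (v + s * z)).
    by move=> mf; apply: measurableT_comp => //; exact: measurable_line.
  apply: measurable_funB; first apply: measurable_funB; first apply: measurable_funB.
  - exact: mz.
  - exact: mz.
  - by apply: measurable_funM => //; apply: mz; case: tp.
  - by apply: measurable_funM => //; apply: mz; case: tq.
by move=> z; have := hpq (x + s * z) y; rewrite -[_ * _ / 2]mulrA (addrAC x).
Qed.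

Lemma taylor_integral M g p q (X : R -> R) x : tame 1 g ->
  (forall x y, `|g (x + y) - g x - p x * y - q x * y ^+ 2 / 2| <= M * `|y| ^+ 3) ->
  gauss.-integrable setT (EFin \o X) ->
  gauss.-integrable setT (EFin \o (fun z => X z ^+ 2)) ->
  gauss.-integrable setT (EFin \o (fun z => `|X z| ^+ 3)) ->
  \int[gauss]_z X z = 0 ->
  `|\int[gauss]_z g (x + X z) - g x - q x / 2 * \int[gauss]_z (X z ^+ 2)|
     <= M * \int[gauss]_z (`|X z| ^+ 3).
Proof.
move=> [mg gB] hpq iX iX2 iX3 X0.
have mX : measurable_fun setT X by apply/measurable_EFinP; exact: (measurable_int _ iX).
have ig : gauss.-integrable setT (EFin \o (fun z => g (x + X z))).
  apply: (@bounded_integrable _ _ _ _ _ 1) => //.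
  by apply: measurableT_comp => //; exact: measurable_funD.
have ic : gauss.-integrable setT (EFin \o (fun=> g x)) by exact: finite_measure_integrable_cst.
have Zl f c : gauss.-integrable setT (EFin \o f) ->
    gauss.-integrable setT (EFin \o (fun z => c * f z)).
  move=> fi; have := integrableZl measurableT c fi.
  by congr integrable; apply/funext => z; rewrite /= EFinM.
have Bi f f' : gauss.-integrable setT (EFin \o f) -> gauss.-integrable setT (EFin \o f') ->
    gauss.-integrable setT (EFin \o (fun z => f z - f' z)).
  move=> fi f'i; have := integrableB measurableT fi f'i.
  by congr integrable; apply/funext => z; rewrite /= EFinB.
have i1 := Bi _ _ ig ic.
have i2 := Bi _ _ i1 (Zl _ (p x) iX).
have i3 := Bi _ _ i2 (Zl _ (q x / 2) iX2).
have -> : \int[gauss]_z g (x + X z) - g x - q x / 2 * \int[gauss]_z (X z ^+ 2) =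
    \int[gauss]_z (g (x + X z) - g x - p x * X z - q x / 2 * X z ^+ 2).
  rewrite (RintegralB measurableT i2 (Zl _ (q x / 2) iX2)).
  rewrite (RintegralB measurableT i1 (Zl _ (p x) iX)) (RintegralB measurableT ig ic).
  by rewrite !RintegralZl// X0 mulr0 subr0 Rintegral_cst_prob.
apply: le_trans (le_normr_Rintegral _ i3) _ => //.
rewrite -RintegralZl//; apply: le_Rintegral => //.
- exact: (integrable_norm i3).
- exact: Zl.
- by move=> z _; have := hpq x (X z); rewrite [_ * _ / 2]mulrAC.
Qed.

(** Two centred variables of equal variance give the same second-order expansion of the mean of g,
    so only the third absolute moments remain. *)
Lemma smooth_swap M g (X Y : R -> R) x : smooth M g ->
  (forall Z, Z = X \/ Z = Y -> [/\ gauss.-integrable setT (EFin \o Z),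
     gauss.-integrable setT (EFin \o (fun z => Z z ^+ 2)),
     gauss.-integrable setT (EFin \o (fun z => `|Z z| ^+ 3)) &
     \int[gauss]_z Z z = 0]) ->
  \int[gauss]_z (X z ^+ 2) = \int[gauss]_z (Y z ^+ 2) ->
  `|\int[gauss]_z g (x + X z) - \int[gauss]_z g (x + Y z)| <=
    M * (\int[gauss]_z (`|X z| ^+ 3) + \int[gauss]_z (`|Y z| ^+ 3)).
Proof.
move=> sg XY v; have tg := smooth_tame sg; case: sg => mg g01 [p [q [_ _ hpq]]].
have [i1 i2 i3 X0] := XY X (or_introl erefl).
have [j1 j2 j3 Y0] := XY Y (or_intror erefl).
have := taylor_integral x tg hpq i1 i2 i3 X0.
have := taylor_integral x tg hpq j1 j2 j3 Y0.
rewrite -v; set a := Rintegral _ _ _; set b := Rintegral _ _ (fun z => g (x + X z)).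
set c := q x / 2 * _ => h1 h2.
rewrite (_ : b - a = (b - g x - c) - (a - g x - c)); last by ring.
by rewrite mulrDr (le_trans (ler_normB _ _))// lerD.
Qed.

End smoothing.

Section chi_square_moments.
Context {R : realType}.
Notation gauss := (@gauss R).

Lemma gauss_dominated (f : R -> R) (A B : R) n : measurable_fun setT f ->
  (forall z, `|f z| <= A + B * z ^+ n) -> gauss.-integrable setT (EFin \o f).
Proof.
move=> mf fAB.
have h : gauss.-integrable setT (EFin \o (fun z => A + B * z ^+ n)).
  have ic : gauss.-integrable setT (EFin \o (fun=> A)) by exact: finite_measure_integrable_cst.
  have iZ := integrableZl measurableT B (gauss_integrableX n).
  have := integrableD measurableT ic iZ.
  by congr integrable; apply/funext => x; rewrite /= EFinD EFinM.
apply: le_integrable h => //; first exact/measurable_EFinP.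
by move=> x _; rewrite /= lee_fin (le_trans (fAB x))// ler_norm.
Qed.

Definition chi (z : R) : R := z ^+ 2 - 1.

Lemma measurable_chi : measurable_fun setT chi.
Proof. by apply: measurable_funB => //; exact: exprn_measurable. Qed.

Lemma integrable_chi : gauss.-integrable setT (EFin \o chi).
Proof.
apply: (@gauss_dominated _ 1 1 2); first exact: measurable_chi.
move=> z; rewrite mul1r /chi (le_trans (ler_normB _ _))// normr1 addrC.
by rewrite ger0_norm// sqr_ge0.
Qed.

Lemma chi_mean : \int[gauss]_z chi z = 0.
Proof.
have := Rintegral_gauss_poly4 (-1 : R) 0 1 0 0.
rewrite gauss_var gauss_mean !mul0r !addr0 mulr1 addNr => <-.
by apply: eq_Rintegral => z _; rewrite /chi; ring.
Qed.

Lemma integrable_chi2 : gauss.-integrable setT (EFin \o (fun z => chi z ^+ 2)).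
Proof.
apply: (@gauss_dominated _ 2 2 4); first by apply: measurable_funX; exact: measurable_chi.
move=> z; rewrite ger0_norm ?sqr_ge0// /chi; have := sqr_ge0 (z ^+ 2 + 1).
rewrite !expr2; nra.
Qed.

Lemma chi_var : \int[gauss]_z (chi z ^+ 2) = 2.
Proof.
have := Rintegral_gauss_poly4 (1 : R) 0 (-2) 0 1.
rewrite gauss_moment4 gauss_var gauss_mean gauss_moment3.
rewrite (_ : _ + _ = 2 :> R); last by ring.
by move=> <-; apply: eq_Rintegral => z _; rewrite /chi; ring.
Qed.

Lemma integrable_chi3 : gauss.-integrable setT (EFin \o (fun z => `|chi z| ^+ 3)).
Proof.
apply: (@gauss_dominated _ 4 4 6).
  by apply: measurable_funX; apply: measurableT_comp => //; exact: measurable_chi.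
move=> z; rewrite ger0_norm ?exprn_ge0//.
have h : `|chi z| <= z ^+ 2 + 1.
  by rewrite (le_trans (ler_normB _ _))// normr1 ger0_norm ?sqr_ge0.
have : `|chi z| ^+ 3 <= (z ^+ 2 + 1) ^+ 3 by rewrite lerXn2r// nnegrE (le_trans _ h).
move=> /le_trans; apply; have -> : z ^+ 6 = (z ^+ 2) ^+ 3 by rewrite -exprM.
move: (z ^+ 2) (sqr_ge0 z) => x x0.
rewrite -subr_ge0 (_ : _ - _ = 3 * ((x - 1) ^+ 2 * (x + 1))); last by ring.
by rewrite mulr_ge0// mulr_ge0 ?sqr_ge0// addr_ge0.
Qed.

Lemma integrable_norm3 : gauss.-integrable setT (EFin \o (fun z : R => `|z| ^+ 3)).
Proof.
apply: (@gauss_dominated _ 1 1 4); first by apply: measurable_funX; exact: normr_measurable.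
move=> z; rewrite ger0_norm ?exprn_ge0// mul1r.
have -> : z ^+ 4 = `|z| ^+ 4 by rewrite -normrX ger0_norm// exprn_even_ge0.
move: `|z| (normr_ge0 z) => x x0.
have := sqr_ge0 (x ^+ 2 - x / 2); have := sqr_ge0 (x - 1); rewrite !exprS expr0; nra.
Qed.

(** The centred form of the quartic term in the lower bound for ln cosh. *)
Definition quad4 (z : R) : R := z ^+ 4 - 3.

Lemma quad4_mean : \int[gauss]_z quad4 z = 0.
Proof.
have := Rintegral_gauss_poly4 (-3 : R) 0 0 0 1.
rewrite gauss_moment4 !mul0r !addr0 mul1r addNr => <-.
by apply: eq_Rintegral => z _; rewrite /quad4; ring.
Qed.

Lemma measurable_quad4 : measurable_fun setT quad4.
Proof. by apply: measurable_funB => //; exact: exprn_measurable. Qed.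

Lemma integrable_quad4 : gauss.-integrable setT (EFin \o quad4).
Proof.
apply: (@gauss_dominated _ 3 1 4); first exact: measurable_quad4.
move=> z; rewrite mul1r /quad4 (le_trans (ler_normB _ _))// addrC ger0_norm// lerD2l.
by rewrite ger0_norm// exprn_even_ge0.
Qed.

Lemma integrable_quad42 : gauss.-integrable setT (EFin \o (fun z => quad4 z ^+ 2)).
Proof.
apply: (@gauss_dominated _ 18 2 8); first by apply: measurable_funX; exact: measurable_quad4.
move=> z; rewrite ger0_norm ?sqr_ge0// /quad4 (_ : z ^+ 8 = (z ^+ 4) ^+ 2); last by rewrite -exprM.
have := sqr_ge0 (z ^+ 4 + 3); rewrite !expr2; nra.
Qed.

End chi_square_moments.

Section lindeberg.
Context {R : realType} {d : measure_display} {Om : measurableType d}.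
Variables (P : probability Om R) (xi : nat -> {RV P >-> R}).
Hypothesis xi_indep : mutually_independent xi.
Hypothesis xi_gauss : forall j, standard_gaussian (xi j).
Notation gauss := (@gauss R).

Definition chi_sum (w : nat -> R) n (om : Om) : R := \sum_(j < n) w j * chi (xi j om).

Lemma measurable_chi_sum w n : measurable_fun setT (chi_sum w n).
Proof.
apply: (@measurable_sum_xi _ _ _ P xi n (fun j z => w j * chi z)) => j.
by apply: measurable_funM => //; exact: measurable_chi.
Qed.

(** Third absolute moments of [chi] and of the centred Gaussian variable with the same variance
    2. *)
Definition lindeberg_cst : R :=
  \int[gauss]_z (`|chi z| ^+ 3) + Num.sqrt 2 ^+ 3 * \int[gauss]_z (`|z| ^+ 3).

Lemma lindeberg_cst_ge0 : 0 <= lindeberg_cst.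
Proof.
rewrite addr_ge0// ?mulr_ge0 ?exprn_ge0 ?sqrtr_ge0//; apply: Rintegral_ge0 => z _;
by rewrite exprn_ge0.
Qed.

Let swap M g v x : 0 <= v -> smooth M g ->
  `|\int[gauss]_z g (x + v * chi z) - smear (Num.sqrt 2 * v) g x| <=
    lindeberg_cst * M * v ^+ 3.
Proof.
move=> v0 sg.
have Zl f c : gauss.-integrable setT (EFin \o f) ->
    gauss.-integrable setT (EFin \o (fun z => c * f z)).
  move=> fi; have := integrableZl measurableT c fi.
  by congr integrable; apply/funext => z; rewrite /= EFinM.
have i1 : gauss.-integrable setT (EFin \o (fun z => z)) by exact: (gauss_integrableX 1).
have i2 : gauss.-integrable setT (EFin \o (fun z => z ^+ 2)) by exact: gauss_integrableX.
have -> : lindeberg_cst * M * v ^+ 3 =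
   M * (\int[gauss]_z (`|v * chi z| ^+ 3) + \int[gauss]_z (`|Num.sqrt 2 * v * z| ^+ 3)).
  have e (c : R) f : 0 <= c -> (fun z : R => `|c * f z| ^+ 3) = (fun z => c ^+ 3 * `|f z| ^+ 3).
    by move=> c0; apply/funext => z; rewrite normrM (ger0_norm c0) exprMn.
  rewrite (e v)// (e (Num.sqrt 2 * v) (fun z => z)); last by rewrite mulr_ge0// sqrtr_ge0.
  rewrite !RintegralZl//; [|exact: integrable_norm3|exact: integrable_chi3].
  by rewrite /lindeberg_cst; ring.
apply: smooth_swap => //; last first.
  under eq_Rintegral do rewrite exprMn.
  under [in RHS]eq_Rintegral do rewrite 2!exprMn.
  rewrite !RintegralZl//; last exact: integrable_chi2.
  by rewrite chi_var gauss_var sqr_sqrtr//; ring.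
move=> Z [->|->]; split.
- by apply: Zl; exact: integrable_chi.
- rewrite (_ : (fun z => _) = (fun z => v ^+ 2 * chi z ^+ 2)); last first.
    by apply/funext => z; rewrite exprMn.
  by apply: Zl; exact: integrable_chi2.
- rewrite (_ : (fun z => _) = (fun z => `|v| ^+ 3 * `|chi z| ^+ 3)); last first.
    by apply/funext => z; rewrite normrM exprMn.
  by apply: Zl; exact: integrable_chi3.
- by rewrite RintegralZl// ?chi_mean ?mulr0//; exact: integrable_chi.
- by apply: Zl; exact: i1.
- rewrite (_ : (fun z => _) = (fun z => (Num.sqrt 2 * v) ^+ 2 * z ^+ 2)); last first.
    by apply/funext => z; rewrite exprMn.
  by apply: Zl; exact: i2.
- rewrite (_ : (fun z => _) = (fun z => `|Num.sqrt 2 * v| ^+ 3 * `|z| ^+ 3)); last first.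
    by apply/funext => z; rewrite normrM exprMn.
  by apply: Zl; exact: integrable_norm3.
- by rewrite RintegralZl// ?gauss_mean ?mulr0.
Qed.

(* The summands [w j * chi (xi j)] are replaced by Gaussian variables of the
   same variance one at a time, the remaining ones being absorbed in [smear]. *)
Lemma lindeberg M g w n : (forall j, 0 <= w j) -> smooth M g ->
  `|\int[P]_om g (chi_sum w n om) -
    smear (Num.sqrt (2 * \sum_(j < n) w j ^+ 2)) g 0| <=
  lindeberg_cst * M * \sum_(j < n) w j ^+ 3.
Proof.
(* The induction is over all smooth g at once: its hypothesis is used for [V], the smearing of g by
   the Gaussian variable that replaces the last summand. *)
move=> w0; elim: n g => [|n IH] g sg.
  rewrite !big_ord0 mulr0 sqrtr0 smear0 mulr0.
  rewrite (_ : Rintegral _ _ _ = g 0) ?subrr ?normr0//.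
  rewrite -[RHS](Rintegral_cst_prob P); apply: eq_Rintegral => om _.
  by rewrite /chi_sum big_ord0.
have [mg g01 _] := sg.
have tg := smooth_tame sg.
have mX : measurable_fun setT (fun z : R => w n * chi z).
  by apply: measurable_funM => //; exact: measurable_chi.
have tU x : gauss.-integrable setT (EFin \o (fun z => g (x + w n * chi z))).
  apply: (@bounded_integrable _ _ _ _ _ 1); last by move=> z; case: tg.
  by apply: measurableT_comp => //; exact: measurable_funD.
pose U x := \int[gauss]_z g (x + w n * chi z).
pose V := smear (Num.sqrt 2 * w n) g.
have sV : smooth M V by exact: smooth_smear.
have EU : \int[P]_om g (chi_sum w n.+1 om) = \int[P]_om U (chi_sum w n om).
  rewrite /Rintegral; congr fine.
  pose h j z := w j * chi z.
  have mh j : measurable_fun setT (h j).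
    by apply: measurable_funM => //; exact: measurable_chi.
  have := @resampling _ _ _ _ _ xi_indep xi_gauss n
    (fun y => (g (\sum_(j < n.+1) h j (y j)))%:E).
  rewrite /noise => ->; last 2 first.
  - apply/measurable_EFinP; apply: measurableT_comp => //.
    exact: (@measurable_sum_coord _ n.+1 h).
  - by move=> y; rewrite lee_fin; case/andP: (g01 (\sum_(j < n.+1) h j (y j))).
  apply: eq_integral => om _; rewrite /U -RintegralE//.
  by apply: eq_integral => z _; rewrite (sum_upd n h).
have mS := measurable_chi_sum w n.
have UV x : `|U x - V x| <= lindeberg_cst * M * w n ^+ 3 by exact: swap.
have [mV tV] := smooth_tame sV.
have [mU _] := tame_average mX tg.
have iU : P.-integrable setT (EFin \o (U \o chi_sum w n)).
  apply: (@bounded_integrable _ _ _ _ _ 1); first exact: measurableT_comp.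
  move=> om; apply: Rintegral_norm_le; last by move=> z; case: tg.
  by apply: measurableT_comp => //; exact: measurable_funD.
have iV : P.-integrable setT (EFin \o (V \o chi_sum w n)).
  by apply: (@bounded_integrable _ _ _ _ _ 1) => [|om]; [exact: measurableT_comp|exact: tV].
have h1 : `|\int[P]_om U (chi_sum w n om) - \int[P]_om V (chi_sum w n om)| <=
    lindeberg_cst * M * w n ^+ 3.
  rewrite -RintegralB//; apply: Rintegral_norm_le => //.
  by apply: measurable_funB; exact: measurableT_comp.
have h2 := IH V sV.
have e : smear (Num.sqrt (2 * \sum_(j < n) w j ^+ 2)) V =
    smear (Num.sqrt (2 * \sum_(j < n.+1) w j ^+ 2)) g.
  have s0 : 0 <= \sum_(j < n) w j ^+ 2 by apply: sumr_ge0 => j _; exact: sqr_ge0.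
  rewrite /V smear_smear// ?sqrtr_ge0 ?mulr_ge0 ?sqrtr_ge0//.
  congr (smear (Num.sqrt _) g).
  by rewrite sqr_sqrtr ?mulr_ge0// exprMn sqr_sqrtr// big_ord_recr /= mulrDr.
rewrite -e EU big_ord_recr /= mulrDr.
set a := Rintegral _ _ _; set b := smear _ _ _.
rewrite (_ : a - b = (\int[P]_om V (chi_sum w n om) - b) + (a - \int[P]_om V (chi_sum w n om))); last by ring.
by rewrite (le_trans (ler_normD _ _))// lerD.
Qed.

End lindeberg.

(** * The Gaussian distribution function *)

Section Phi_theory.
Context {R : realType}.
Notation gauss := (@gauss R).
Notation Phi := (@Phi R).
Notation mu := (@lebesgue_measure R).
Implicit Types x y : R.

Lemma PhiE x : (gauss `]-oo, x] = (Phi x)%:E)%E.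
Proof.
by rewrite /Phi -[normal_prob 0 1 _]/(gauss _) fineK// fin_num_measure.
Qed.

Lemma gauss_gt x : (gauss `]x, +oo[ = (1 - Phi x)%:E)%E.
Proof.
have := @probability_setC _ _ _ gauss `]-oo, x]%classic (measurable_itv _).
by rewrite setCitvl => H; apply: etrans H _; rewrite -[X in (_ - X)%E]/(gauss _) PhiE.
Qed.

Let gauss_oc x y : x <= y -> (gauss `]x, y] = (Phi y - Phi x)%:E)%E.
Proof.
move=> xy.
have : (gauss `]-oo, y] = gauss `]-oo, x] + gauss `]x, y])%E.
  rewrite (_ : `]-oo, y]%classic = `]-oo, x] `|` `]x, y]).
    apply: (@measureU _ _ _ gauss) => //; rewrite -subset0 => z /= [].
    by rewrite !in_itv /= => h /andP[]; rewrite ltNge h.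
  by rewrite -itv_bndbnd_setU.
have /fineK <- := @fin_num_measure _ _ _ gauss `]x, y]%classic (measurable_itv _).
by rewrite !PhiE -EFinD => -[->]; rewrite addrC addKr.
Qed.

Lemma phi_le1 x : normal_pdf 0 1 x <= 1 :> R.
Proof.
rewrite phiE mulr_ile1 ?normal_peak_ge0 ?expR_ge0//.
  have pi2 : 1 <= pi *+ 2 :> R by have := @pi_ge2 R; rewrite mulr2n; lra.
  have h : 1 <= Num.sqrt (pi *+ 2) :> R by rewrite -[leLHS]sqrtr1 ler_wsqrtr.
  by rewrite /normal_peak expr1n mul1r invf_le1// (lt_le_trans ltr01).
by rewrite expR_le1 mulNr oppr_le0 divr_ge0// sqr_ge0.
Qed.

Lemma Phi_lipschitz x y : x <= y -> 0 <= Phi y - Phi x <= y - x.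
Proof.
move=> xy; rewrite -!lee_fin -gauss_oc// measure_ge0/= gaussE.
have mphiE : measurable_fun [set: R] (fun x : R => (normal_pdf 0 1 x)%:E).
  by apply/measurable_EFinP; exact: measurable_phi.
apply: (@le_trans _ _ (\int[mu]_(x in `]x, y]) (cst 1%E x))%E).
  apply: ge0_le_integral => //.
  - by move=> z _; rewrite lee_fin phi_ge0.
  - exact: measurable_funTS.
  - by move=> z _; rewrite lee_fin phi_le1.
by rewrite integral_cst//= mul1e lebesgue_measure_itv /= lte_fin; case: ifPn => // _; rewrite lee_fin subr_ge0.
Qed.

Lemma Phi_homo x y : x <= y -> Phi x <= Phi y.
Proof. by move=> xy; have /andP[] := Phi_lipschitz xy; rewrite subr_ge0. Qed.

(** On the interval the density is at least [c], its value at the larger of |x| and |y|. Strictness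
    will later leave room to correct the level of a test. *)
Lemma Phi_lt x y : x < y -> Phi x < Phi y.
Proof.
move=> xy; rewrite -subr_gt0 -lte_fin -gauss_oc ?ltW// gaussE.
have mphiE : measurable_fun [set: R] (fun x : R => (normal_pdf 0 1 x)%:E).
  by apply/measurable_EFinP; exact: measurable_phi.
pose m := Num.max `|x| `|y|; pose c := normal_pdf 0 1 m : R.
have c0 : 0 < c by rewrite /c phiE mulr_gt0 ?expR_gt0// normal_peak_gt0// oner_eq0.
apply: (@lt_le_trans _ _ (\int[mu]_(x in `]x, y]) (cst c%:E x))%E).
  rewrite integral_cst//= lebesgue_measure_itv /= lte_fin xy -EFinD -EFinM lte_fin.
  by rewrite mulr_gt0// subr_gt0.
apply: ge0_le_integral => //.
- by move=> z _; rewrite lee_fin ltW.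
- exact: measurable_funTS.
move=> z; rewrite /= in_itv /= => /andP[xz zy]; rewrite lee_fin /c !phiE.
rewrite ler_wpM2l ?normal_peak_ge0// ler_expR ler_wpM2r// lerN2 -(real_normK (num_real z)).
suff zm : `|z| <= m by rewrite -[m ^+ 2]real_normK ?num_real// lerXn2r// ?nnegrE// (le_trans zm) ?ler_norm.
rewrite /m le_max; have [z0|z0] := ger0P z.
  by rewrite (le_trans zy (ler_norm _)) orbT.
by rewrite -(normrN x) (le_trans _ (ler_norm (- x)))// lerN2 ltW.
Qed.

Lemma Phi_continuous : continuous Phi.
Proof.
move=> x; apply/cvgrPdist_le => /= e e0; near=> y.
have xye : `|x - y| <= e by near: y; apply: cvgr_dist_le.
apply: le_trans xye; have [xy|yx] := leP x y.
  have /andP[h1 h2] := Phi_lipschitz xy.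
  by rewrite distrC (distrC x) ger0_norm// ger0_norm// subr_ge0.
have /andP[h1 h2] := Phi_lipschitz (ltW yx).
by rewrite ger0_norm// ger0_norm// subr_ge0 ltW.
Unshelve. all: by end_near. Qed.

(** A random variable with distribution function [Phi], through which the limits of [Phi] at both
    infinities are obtained. *)
Let idR : {RV gauss >-> R} := HB.pack (fun x : R => x) (isMeasurableFun.Build _ _ _ _ _ (@measurable_id _ R setT)).

Lemma Phi_surj p : 0 < p < 1 -> exists x, Phi x = p.
Proof.
move=> /andP[p0 p1].
have cdfE x : cdf idR x = (Phi x)%:E by rewrite -PhiE.
have [a ha] : exists a, Phi a <= p.
  have := @cvg_cdfNy0 _ _ _ gauss idR.
  rewrite (_ : (cdf _ : R -> \bar R) = EFin \o Phi); last exact/funext.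
  move=> /fine_cvgP[_] /cvgrPdist_le /(_ _ p0)[M [_ hM]].
  exists (M - 1); have := hM (M - 1); rewrite ltrBlDr ltrDl ltr01 => /(_ isT) /=.
  by rewrite sub0r normrN => /(le_trans (ler_norm _)).
have [b hb] : exists b, p <= Phi b.
  have := @cvg_cdfy1 _ _ _ gauss idR.
  rewrite (_ : (cdf _ : R -> \bar R) = EFin \o Phi); last exact/funext.
  move=> /fine_cvgP[_] /cvgrPdist_le /(_ (1 - p)); rewrite subr_gt0 => /(_ p1)[M [_ hM]].
  exists (M + 1); have := hM (M + 1); rewrite ltrDl ltr01 => /(_ isT) /=.
  by move=> /(le_trans (ler_norm _)); rewrite lerD2l lerN2.
have ab : a <= b.
  by rewrite leNgt; apply/negP => /Phi_lt; rewrite ltNge (le_trans ha hb).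
have [||x _ hx] := @IVT R Phi a b p ab; last by exists x.
  exact/continuous_subspaceT/Phi_continuous.
by rewrite ge_min ha /= le_max hb orbT.
Qed.

Lemma Phi_invK p : 0 < p < 1 -> Phi (Phi_inv p) = p.
Proof.
move=> /Phi_surj[x hx]; rewrite /Phi_inv; apply: pinvK.
by rewrite inE; exists x.
Qed.

End Phi_theory.

(** * Normal approximation, uniform in the weights *)

Section clt.
Context {R : realType}.
Notation gauss := (@gauss R).
Notation Phi := (@Phi R).

Lemma Rintegral_indic d (T : measurableType d) (P : probability T R) (A : set T) :
  measurable A -> \int[P]_x \1_A x = fine (P A).
Proof. by move=> mA; rewrite /Rintegral integral_indic// setIT. Qed.

Lemma indic_integrable d (T : measurableType d) (P : probability T R) (A : set T) :
  measurable A -> P.-integrable setT (EFin \o (\1_A : T -> R)).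
Proof.
move=> mA; apply: (@bounded_integrable _ _ _ _ _ 1) => [|x]; first exact: measurable_indic.
by rewrite indicE; case: (x \in A); rewrite ?normr1 ?normr0.
Qed.

Lemma logistic_smooth (s m : R) : 0 < s ->
  smooth (3 * s^-1 ^+ 3) (fun x => logistic ((x - m) / s)).
Proof.
move=> s0; have [p [q [mp mq p1 q1 H]]] := @logistic_taylor R.
have ml : measurable_fun setT (fun x : R => (x - m) / s).
  by apply: measurable_funM => //; exact: measurable_funB.
have mlog : measurable_fun setT (@logistic R).
  apply: continuous_measurable_fun => x; apply: differentiable_continuous.
  by apply/derivable1_diffP; exact: (@ex_derive _ _ _ _ _ _ _ (is_derive_logistic x)).
split.
- exact: measurableT_comp.
- by move=> x; rewrite ltW ?logistic_gt0// ltW// logistic_lt1.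
have s10 : 0 <= s^-1 by rewrite invr_ge0 ltW.
exists (fun x => s^-1 * p ((x - m) / s)), (fun x => s^-1 ^+ 2 * q ((x - m) / s)); split.
- exists s^-1; split; first by apply: measurable_funM => //; exact: measurableT_comp.
  by move=> x; rewrite normrM ger0_norm// ler_piMr.
- exists (s^-1 ^+ 2); split; first by apply: measurable_funM => //; exact: measurableT_comp.
  by move=> x; rewrite normrM ger0_norm ?exprn_ge0// ler_piMr ?exprn_ge0.
move=> x y; rewrite [leRHS](_ : _ = 3 * `|y / s| ^+ 3); last first.
  by rewrite normrM (ger0_norm s10); ring.
apply: le_trans (H ((x - m) / s) (y / s)); rewrite le_eqVlt; apply/orP; left; apply/eqP.
have -> : (x - m) / s + y / s = (x + y - m) / s by ring.
by congr (`|_|); ring.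
Qed.

Variables (d : measure_display) (Om : measurableType d).
Variables (P : probability Om R) (xi : nat -> {RV P >-> R}).
Hypothesis xi_indep : mutually_independent xi.
Hypothesis xi_gauss : forall j, standard_gaussian (xi j).

Let smear_logistic (s m : R) : 0 < s ->
  gauss.-integrable setT (EFin \o (fun z => logistic ((z - m) / s))) /\
  smear 1 (fun x => logistic ((x - m) / s)) 0 = \int[gauss]_z logistic ((z - m) / s).
Proof.
move=> s0; have tg := smooth_tame (logistic_smooth m s0); split.
  by have := tame_integrable 1 0 tg; congr integrable; apply/funext => z /=; rewrite mul1r add0r.
by apply: eq_Rintegral => z _; rewrite mul1r add0r.
Qed.

Let clt_logistic (w : nat -> R) n (W s m : R) : 0 < s ->
  (forall j, 0 <= w j) -> (forall j, (j < n)%N -> w j <= W) ->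
  2 * \sum_(j < n) w j ^+ 2 = 1 ->
  `|\int[P]_om logistic ((chi_sum xi w n om - m) / s) -
    \int[gauss]_z logistic ((z - m) / s)| <= 3 * lindeberg_cst * s^-1 ^+ 3 * W.
Proof.
move=> s0 w0 wW w2; have [_ <-] := smear_logistic m s0.
have := lindeberg xi_indep xi_gauss n w0 (logistic_smooth m s0).
rewrite w2 sqrtr1 => /le_trans; apply.
rewrite (_ : 3 * _ * _ * W = lindeberg_cst * (3 * s^-1 ^+ 3) * W); last by ring.
rewrite ler_wpM2l?mulr_ge0 ?lindeberg_cst_ge0 ?exprn_ge0 ?invr_ge0 ?(ltW s0)//.
have n0 : (0 < n)%N.
  rewrite lt0n; apply: contra_eqN w2 => /eqP ->.
  by rewrite big_ord0 mulr0 eq_sym oner_eq0.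
have W0 : 0 <= W by rewrite (le_trans (w0 0%N))// wW.
apply: (@le_trans _ _ (W * \sum_(j < n) w j ^+ 2)); last first.
  by rewrite ler_piMr//; lra.
by rewrite mulr_sumr; apply: ler_sum => j _; rewrite exprSr mulrC ler_wpM2r ?sqr_ge0// wW.
Qed.

(** Indicators of half-lines are sandwiched between logistic steps. Their width [s] is fixed by k
    before the weights are given, so W serves all weights, all n and all x. *)
Lemma clt (k : R) : 0 < k -> exists2 W, 0 < W &
  forall (w : nat -> R) n, (forall j, 0 <= w j) -> (forall j, (j < n)%N -> w j <= W) ->
    2 * \sum_(j < n) w j ^+ 2 = 1 -> forall x,
    `|fine (P [set om | chi_sum xi w n om <= x]) - Phi x| <= k.
Proof.
(* The budget: two logistic tails [e] and one replacement error, each at most k / 8, and 2 dl = k /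
   4 from the Lipschitz bound on [Phi]. *)
have arith_up (k' x dl e a b c p q : R) : 0 < k' -> dl = k' / 8 -> e <= k' / 8 ->
    p <= a + e -> b <= c + e -> c - q <= x + 2 * dl - x -> a - b <= k' / 8 ->
    p <= q + k' by move=> *; lra.
have arith_lo (k' x dl e a b c p q : R) : 0 < k' -> dl = k' / 8 -> e <= k' / 8 ->
    a - e <= p -> c - e <= b -> q - c <= x - (x - 2 * dl) -> - (k' / 8) <= a - b ->
    q - k' <= p by move=> *; lra.
move=> k0; pose dl := k / 8; pose s := dl * (k / 8).
have dl0 : 0 < dl by rewrite divr_gt0.
have s0 : 0 < s by rewrite mulr_gt0// divr_gt0.
(* [K] exceeds the factor of W in [clt_logistic]; the summand 1 makes it positive, and W = k / 8 / K
   bounds the replacement error by k / 8. *)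
pose K := 3 * @lindeberg_cst R * s^-1 ^+ 3 + 1.
have K0 : 0 < K.
  apply: ltr_wpDl => //; rewrite mulr_ge0 ?exprn_ge0 ?invr_ge0 ?(ltW s0)//.
  by rewrite mulr_ge0 ?lindeberg_cst_ge0.
exists (k / 8 / K); first by rewrite !divr_gt0.
move=> w n w0 wW w2 x; pose S := chi_sum xi w n.
have mS : measurable_fun setT S by exact: measurable_chi_sum.
have mA : measurable [set om | S om <= x].
  have := mS measurableT _ (measurable_itv `]-oo, x]); rewrite setTI.
  by congr measurable; apply/seteqP; split => om /=; rewrite in_itv.
pose e := expR (- (dl / s)).
have ek : e <= k / 8.
  rewrite /e expRN; apply: (@le_trans _ _ (dl / s)^-1).
    rewrite lef_pV2 ?posrE ?expR_gt0 ?divr_gt0//.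
    by rewrite (le_trans _ (expR_ge1Dx _))// lerDr.
  by rewrite invf_div /s mulrAC divff ?gt_eqF// mul1r.
have close m : `|\int[P]_om logistic ((S om - m) / s) -
    \int[gauss]_z logistic ((z - m) / s)| <= k / 8.
  apply: le_trans (clt_logistic m s0 w0 wW w2) _.
  rewrite mulrA ler_pdivrMr// mulrC ler_wpM2l ?divr_ge0 ?(ltW k0)//.
  by rewrite /K lerDl.
have iP m : P.-integrable setT (EFin \o (fun om => logistic ((S om - m) / s))).
  have [mg g1] := smooth_tame (logistic_smooth m s0).
  by apply: (@bounded_integrable _ _ _ _ _ 1) => [|om]; [exact: (measurableT_comp mg mS)|exact: g1].
have iG m := (smear_logistic m s0).1.
have ic (C : R) d' (T : measurableType d') (Q : probability T R) :
    Q.-integrable setT (EFin \o (fun=> C)).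
  exact: finite_measure_integrable_cst.
have bound_le m (z : R) : z <= m - dl -> 1 - e <= logistic ((z - m) / s).
  move=> zm; apply: le_trans (logistic_ge1B _); rewrite lerD2l lerN2 ler_expR.
  by rewrite -mulNr ler_wpM2r ?invr_ge0 ?(ltW s0)//; lra.
have bound_ge m (z : R) : m + dl <= z -> logistic ((z - m) / s) <= e.
  move=> zm; apply: le_trans (logistic_le_expR _) _; rewrite ler_expR lerN2.
  by rewrite ler_wpM2r ?invr_ge0 ?(ltW s0)//; lra.
have l01 m (z : R) : 0 <= logistic ((z - m) / s) <= 1.
  by rewrite ltW ?logistic_gt0// ltW// logistic_lt1.
have e0 : 0 <= e by exact: expR_ge0.
have PAE : fine (P [set om | S om <= x]) = \int[P]_om \1_[set om | S om <= x] om.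
  by rewrite Rintegral_indic.
have iI (y : R) : gauss.-integrable setT (EFin \o \1_`]-oo, y]) by exact: indic_integrable.
have PhiI y : Phi y = \int[gauss]_z \1_`]-oo, y] z.
  by rewrite Rintegral_indic.
have up : fine (P [set om | S om <= x]) <= Phi x + k.
  have h1 : fine (P [set om | S om <= x]) <=
      \int[P]_om logistic ((S om - (x + dl)) / s) + e.
    rewrite PAE -[X in _ <= _ + X](Rintegral_cst_prob P e) -(RintegralD measurableT (iP _) (ic e _ _ P)).
    apply: le_Rintegral => //.
    - exact: indic_integrable.
    - have := integrableD measurableT (iP (x + dl)) (ic e _ _ P).
      by congr integrable; apply/funext => om; rewrite /= EFinD.
    - move=> om _; have [hx|hx] := leP (S om) x.
        rewrite indicE mem_set//=; have := bound_le (x + dl) (S om); rewrite addrK => /(_ hx); lra.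
      rewrite indicE memNset/= ?addr_ge0//; first by case/andP: (l01 (x + dl) (S om)).
      by move=> /=; rewrite leNgt hx.
  have h2 : \int[gauss]_z logistic ((z - (x + dl)) / s) <= Phi (x + 2 * dl) + e.
    rewrite PhiI -[X in _ <= _ + X](Rintegral_cst_prob gauss e) -(RintegralD measurableT (iI _) (ic e _ _ gauss)).
    apply: le_Rintegral => //.
    - have := integrableD measurableT (indic_integrable gauss (measurable_itv `]-oo, (x + 2 * dl)])) (ic e _ _ gauss).
      by congr integrable; apply/funext => om; rewrite /= EFinD.
    - move=> z _; have [hx|hx] := leP z (x + 2 * dl).
        rewrite indicE mem_set/= ?in_itv//=; have /andP[_] := l01 (x + dl) z; lra.
      rewrite indicE memNset/= ?add0r; last by rewrite in_itv/= leNgt hx.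
      by apply: bound_ge; lra.
  have /andP[_ h3] := @Phi_lipschitz R x (x + 2 * dl) ltac:(lra).
  have := close (x + dl); rewrite ler_norml => /andP[_ h4].
  exact: (arith_up _ _ _ _ _ _ _ _ _ k0 erefl ek h1 h2 h3 h4).
have lo : Phi x - k <= fine (P [set om | S om <= x]).
  have h1 : \int[P]_om logistic ((S om - (x - dl)) / s) - e <= fine (P [set om | S om <= x]).
    rewrite PAE -[X in _ - X <= _](Rintegral_cst_prob P e) -(RintegralB measurableT (iP _) (ic e _ _ P)).
    apply: le_Rintegral => //.
    - have := integrableB measurableT (iP (x - dl)) (ic e _ _ P).
      by congr integrable; apply/funext => om; rewrite /= EFinB.
    - exact: indic_integrable.
    - move=> om _; have [hx|hx] := leP (S om) x.
        rewrite indicE mem_set//=; have /andP[_] := l01 (x - dl) (S om); lra.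
      rewrite indicE memNset/=; last by move=> /=; rewrite leNgt hx.
      by rewrite subr_le0; apply: bound_ge; lra.
  have h2 : Phi (x - 2 * dl) - e <= \int[gauss]_z logistic ((z - (x - dl)) / s).
    rewrite PhiI -[X in _ - X <= _](Rintegral_cst_prob gauss e) -(RintegralB measurableT (iI _) (ic e _ _ gauss)).
    apply: le_Rintegral => //.
    - have := integrableB measurableT (indic_integrable gauss (measurable_itv `]-oo, (x - 2 * dl)])) (ic e _ _ gauss).
      by congr integrable; apply/funext => om; rewrite /= EFinB.
    - move=> z _; have [hx|hx] := leP z (x - 2 * dl).
        by rewrite indicE mem_set/= ?in_itv//=; apply: bound_le; lra.
      rewrite indicE memNset/=; last by rewrite in_itv/= leNgt hx.
      have /andP[] := l01 (x - dl) z; lra.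
  have /andP[_ h3] := @Phi_lipschitz R (x - 2 * dl) x ltac:(lra).
  have := close (x - dl); rewrite ler_norml => /andP[h4 _].
  exact: (arith_lo _ _ _ _ _ _ _ _ _ k0 erefl ek h1 h2 h3 h4).
by rewrite ler_norml lerBlDl up andbT lerBrDr addrC lo.
Qed.

End clt.

(** * Lower bounds by symmetric mixtures *)

Section layer_cake.
Context {R : realType}.
Notation gauss := (@gauss R).
Notation Phi := (@Phi R).
Variables (d : measure_display) (Om : measurableType d) (P : probability Om R).
Notation mu := (@lebesgue_measure R).

(** The likelihood ratio at z of the Gaussian law with mean u against the one with mean 0, truncated
    at its value at t, the Neyman-Pearson threshold. *)
Definition trunc_exp (u t z : R) : R := Num.min (expR (u * z - u ^+ 2 / 2)) (expR (u * t - u ^+ 2 / 2)).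

Lemma trunc_exp_ge0 u t z : 0 <= trunc_exp u t z.
Proof. by rewrite le_min !expR_ge0. Qed.

Lemma trunc_exp_le u t z : trunc_exp u t z <= expR (u * t - u ^+ 2 / 2).
Proof. by rewrite ge_min lexx orbT. Qed.

Let measurable_expu u : measurable_fun setT (fun z : R => expR (u * z - u ^+ 2 / 2)).
Proof.
by apply: measurableT_comp => //; apply: measurable_funB => //; exact: measurable_funM.
Qed.

Lemma measurable_trunc_exp u t : measurable_fun setT (trunc_exp u t).
Proof. by apply: measurable_minr => //; exact: measurable_expu. Qed.

Let tail_trunc u t r : 0 < u -> 0 <= r -> r < expR (u * t - u ^+ 2 / 2) ->
  [set z | r < trunc_exp u t z] = setT \/ exists x, [set z | r < trunc_exp u t z] = `]x, +oo[%classic.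
Proof.
move=> u0; rewrite le_eqVlt => /predU1P[<- _|r0 rt].
  by left; apply/seteqP; split => // z _ /=; rewrite lt_min !expR_gt0.
right; exists ((ln r + u ^+ 2 / 2) / u); apply/seteqP; split => z /=;
  rewrite in_itv /= andbT lt_min rt andbT ltr_pdivrMr// -ltrBrDr (mulrC z);
  by rewrite -[X in X < expR _]lnK ?posrE// ltr_expR.
Qed.

(** Both sides are integrals of tail probabilities over levels r. The tail events are half-lines or
    everything, so each costs at most k, and only levels below the truncation value contribute. *)
Lemma layer_cake (S : Om -> R) (u t k : R) : measurable_fun setT S -> 0 < u -> 0 <= k ->
  (forall x, `|fine (P [set om | S om <= x]) - Phi x| <= k) ->
  (\int[gauss]_z (trunc_exp u t z)%:E <=
   \int[P]_om (trunc_exp u t (S om))%:E + (expR (u * t - u ^+ 2 / 2) * k)%:E)%E.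
Proof.
move=> mS u0 k0 hS; set l := expR _.
pose XG : {RV gauss >-> R} := HB.pack (trunc_exp u t) (isMeasurableFun.Build _ _ _ _ _ (@measurable_trunc_exp u t)).
pose XP : {RV P >-> R} := HB.pack (trunc_exp u t \o S)
  (isMeasurableFun.Build _ _ _ _ _ (measurableT_comp (@measurable_trunc_exp u t) mS)).
have EG := @ge0_expectation_ccdf _ _ _ gauss XG (trunc_exp_ge0 u t).
have EP := @ge0_expectation_ccdf _ _ _ P XP (fun om => trunc_exp_ge0 u t (S om)).
rewrite expectation_def in EG; rewrite expectation_def in EP.
rewrite [X in (X <= _)%E]EG [X in (_ <= X + _)%E]EP.
have l0 : 0 < l by exact: expR_gt0.
pose K (r : R) : \bar R := (k * \1_`[0, l] r)%:E.
pose I : set R := `[0%R, +oo[%classic.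
have mK : measurable_fun I K.
  have mKT : measurable_fun [set: R] K.
    by apply/measurable_EFinP; apply: measurable_funM => //; exact: measurable_indic.
  exact: (measurable_funTS mKT).
have K0 r : (0 <= K r)%E by rewrite lee_fin mulr_ge0.
have mP : measurable_fun I (ccdf XP).
  exact: (measurable_funTS (@ccdf_measurable _ _ _ P XP)).
have mG : measurable_fun I (ccdf XG).
  exact: (measurable_funTS (@ccdf_measurable _ _ _ gauss XG)).
have P0 r : (0 <= ccdf XP r)%E by exact: measure_ge0.
have -> : ((l * k)%:E = \int[mu]_(r in `[0%R, +oo[) K r)%E.
  rewrite /K; under eq_integral do rewrite EFinM.
  rewrite ge0_integralZl//; last first.
    have mKT : measurable_fun [set: R] (fun r => (\1_`[0, l] r : R)%:E).
      by apply/measurable_EFinP; exact: measurable_indic.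
    exact: (measurable_funTS mKT).
  rewrite integral_indic// setIidl; last first.
    by move=> z; rewrite /= !in_itv /= andbT => /andP[].
  by rewrite /= lebesgue_measure_itv /= lte_fin l0 sube0 -EFinM mulrC.
rewrite -(ge0_integralD mu (measurable_itv _) (fun r _ => P0 r) mP (fun r _ => K0 r) mK).
apply: (ge0_le_integral mu (measurable_itv _) _ mG _ _).
- by move=> r _; exact: measure_ge0.
- exact: emeasurable_funD.
move=> r; rewrite /= in_itv /= andbT => r0.
have GE : ccdf XG r = gauss [set z | r < trunc_exp u t z].
  by rewrite /ccdf /distribution /pushforward; congr (gauss _); apply/seteqP; split => z; rewrite /= in_itv /= andbT.
have PE : ccdf XP r = P [set om | r < trunc_exp u t (S om)].
  by rewrite /ccdf /distribution /pushforward; congr (P _); apply/seteqP; split => z; rewrite /= in_itv /= andbT.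
suff H : (gauss [set z | (r < trunc_exp u t z)%R] <= P [set om | (r < trunc_exp u t (S om))%R] + K r)%E.
  by move: H; rewrite -GE -PE.
have [lr|rl] := leP l r.
  rewrite (_ : [set z | _] = set0) ?measure0 ?adde_ge0//.
  by apply/seteqP; split => // z /=; rewrite ltNge (le_trans (trunc_exp_le _ _ _) lr).
have -> : K r = k%:E by rewrite /K indicE mem_set ?mulr1//= in_itv /= r0 ltW.
have [e|[x e]] := tail_trunc u0 r0 rl.
  rewrite [X in (_ <= P X + _)%E](_ : _ = setT) ?probability_setT; last first.
    by apply/seteqP; split => // om _; have : [set z | r < trunc_exp u t z] (S om) by rewrite e.
  rewrite e [X in (X <= _)%E](@probability_setT _ _ _ gauss).
  by rewrite leeDl// lee_fin.
rewrite e gauss_gt.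
have mA : measurable [set om | S om <= x].
  have := mS measurableT _ (measurable_itv `]-oo, x]); rewrite setTI.
  by congr measurable; apply/seteqP; split => om /=; rewrite in_itv.
have -> : (P [set om | (r < trunc_exp u t (S om))%R] = 1 - P [set om | (S om <= x)%R])%E.
  rewrite -probability_setC//; congr (P _); apply/seteqP; split => om /=.
    move=> h; have : [set z | r < trunc_exp u t z] (S om) by [].
    by rewrite e /= in_itv /= andbT => /lt_geF ->.
  move=> /negP; rewrite -ltNge => h.
  have : `]x, +oo[%classic (S om) by rewrite /= in_itv /= h.
  by rewrite -e.
rewrite -[P _]fineK ?fin_num_measure// -!EFinD lee_fin.
have := hS x; rewrite ler_norml => /andP[_]; lra.
Qed.

(** Split at t: below t the exponential is the density of a shift by u, which gives [Phi (t - u)];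
    above t the integrand is constant. *)
Lemma gauss_trunc (u t : R) : 0 <= u ->
  ((Phi (t - u) + expR (u * t - u ^+ 2 / 2) * (1 - Phi t))%:E <=
   \int[gauss]_z (trunc_exp u t z)%:E)%E.
Proof.
move=> u0; set l := expR _.
have mE : measurable_fun setT (fun x : R => (expR (u * x - u ^+ 2 / 2))%:E).
  exact/measurable_EFinP.
have iL : measurable_fun setT (fun z : R => (\1_`]-oo, t] z : R)%:E).
  by apply/measurable_EFinP; exact: measurable_indic.
have iR : measurable_fun setT (fun z : R => (\1_`]t, +oo[ z : R)%:E).
  by apply/measurable_EFinP; exact: measurable_indic.
have h1 : ((Phi (t - u))%:E = \int[gauss]_z ((\1_`]-oo, t] z)%:E * (expR (u * z - u ^+ 2 / 2))%:E))%E.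
  rewrite -(@gauss_shift _ u (fun z => (\1_`]-oo, t] z)%:E))// -PhiE.
  rewrite -(setIT `]-oo, t - u]%classic) -[LHS]integral_indic//.
  apply: eq_integral => z _; rewrite !indicE; congr (_%:R)%:E; congr nat_of_bool.
  by apply/idP/idP; rewrite !inE /= !in_itv /= lerBrDr.
have h2 : ((l * (1 - Phi t))%:E = \int[gauss]_z (l%:E * (\1_`]t, +oo[ z)%:E))%E.
  rewrite ge0_integralZl ?lee_fin ?expR_ge0//.
  by rewrite integral_indic// setIT EFinM; congr (_ * _)%E; rewrite -gauss_gt.
rewrite EFinD h1 h2 -ge0_integralD//; first last.
- by apply: emeasurable_funM => //; exact: measurable_cst.
- by move=> z _; rewrite mule_ge0// lee_fin expR_ge0.
- exact: emeasurable_funM.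
apply: ge0_le_integral => //.
- by move=> z _; rewrite adde_ge0// mule_ge0// lee_fin expR_ge0.
- apply: emeasurable_funD; apply: emeasurable_funM => //; exact: measurable_cst.
- by apply/measurable_EFinP; exact: measurable_trunc_exp.
move=> z _; rewrite -!EFinM -EFinD lee_fin !indicE.
have [zt|tz] := leP z t.
  rewrite mem_set/= ?in_itv//= memNset/= ?in_itv/= ?andbT ?mulr0 ?addr0 ?mul1r; last first.
    by rewrite ltNge zt.
  by rewrite le_min lexx ler_expR lerD2r ler_wpM2l.
rewrite memNset/= ?in_itv/=; last by rewrite leNgt tz.
rewrite mem_set/= ?in_itv/= ?tz// mul0r add0r mulr1.
by rewrite le_min lexx andbT ler_expR lerD2r ler_wpM2l// ltW.
Qed.

End layer_cake.

(** * From a test to the averaged likelihood ratio *)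

Section bayes.
Context {R : realType} {d : measure_display} {Om : measurableType d}.
Variables (P : probability Om R) (xi : nat -> {RV P >-> R}).
Hypothesis xi_indep : mutually_independent xi.
Hypothesis xi_gauss : forall j, standard_gaussian (xi j).
Notation obs := (@obs R).
Notation noise := (noise xi).
Variables (b : nat -> R) (eps : R).
Hypothesis eps0 : 0 < eps.

Definition lratio (c : nat -> R) n (om : Om) : R :=
  \prod_(j < n) (expR (- c j ^+ 2 / 2) * cosh (c j * xi j om)).

Lemma measurable_lratio c n : measurable_fun setT (lratio c n).
Proof.
apply: measurable_prod => j _; apply: measurable_funM => //.
have mcx : measurable_fun setT (fun om => c j * xi j om).
  by apply: measurable_funM => //; exact: measurable_funPT.
apply: measurable_funM => //; apply: measurable_funD; apply: measurableT_comp => //.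
by apply: measurableT_comp => //; exact: oppr_measurable.
Qed.

Lemma lratio_ge0 c n om : 0 <= lratio c n om.
Proof. by apply: prodr_ge0 => j _; rewrite mulr_ge0 ?expR_ge0// ltW// cosh_gt0. Qed.

Lemma measurable_observation th : measurable_fun setT (observation xi b eps th).
Proof.
apply: measurable_fun_obs => j; apply: measurable_funD => //.
by apply: measurable_funM => //; exact: measurable_funPT.
Qed.

Lemma measurable_test (psi : @test R) v : measurable [set y | psi y = v].
Proof.
have mv : measurable [set v] by [].
have := measurable_funPT psi measurableT _ mv.
by rewrite setTI.
Qed.

(** Pointwise, the minimum is at most the likelihood ratio where the test accepts and at most l
    where it rejects. The first part integrates to the error averaged over signs, bounded through
    [sign_mixture], the second to at most l * alpha. *)
Lemma bayes_bound n (c : nat -> R) (Th : set (nat -> R)) (psi : @test R) (alpha B l : R) :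
  0 <= l ->
  (forall c', (forall j, c' j = c j \/ c' j = - c j) -> exists2 th, Th th &
     forall j, b j * th j = if (j < n)%N then eps * c' j else 0) ->
  (law xi b eps (fun=> 0%R) [set y | psi y = true] <= alpha%:E)%E ->
  (forall th, Th th -> (law xi b eps th [set y | psi y = false] <= B%:E)%E) ->
  (\int[P]_om (Num.min (lratio c n om) l)%:E <= (B + l * alpha)%:E)%E.
Proof.
move=> l0 hTh level hB.
(* Observations are eps times noise of unit variance, so [c] is measured in units of the noise
   level. *)
pose sc (y : obs) : obs := fun j => eps * y j.
have msc : measurable_fun setT sc.
  by apply: measurable_fun_obs => j; apply: measurable_funM => //; exact: measurable_coord.
pose A : set obs := [set y | psi (sc y) = false].
have mA : measurable A.
  rewrite (_ : A = sc @^-1` [set y | psi y = false])//.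
  by rewrite -[X in measurable X]setTI; apply: msc => //; exact: measurable_test.
have mA' : measurable (noise @^-1` A).
  by rewrite -[X in measurable X]setTI; exact: measurable_noise.
pose H (y : obs) : \bar R := (\1_A y)%:E.
have mH : measurable_fun setT H by apply/measurable_EFinP; exact: measurable_indic.
have H0 y : (0 <= H y)%E by rewrite lee_fin.
have mHn : measurable_fun setT (fun om => H (noise om)).
  by apply: measurableT_comp => //; exact: measurable_noise.
have h1 : (\int[P]_om (H (noise om) * (lratio c n om)%:E) <= B%:E)%E.
  apply: sign_mixture => // c' cc'; have [th Tth bth] := hTh c' cc'.
  have := hB th Tth; congr (_ <= _)%E.
  rewrite /law /pushforward -(setIT (_ @^-1` _)) -[LHS]integral_indic//; last first.
    rewrite -[X in measurable X]setTI; apply: measurable_observation => //.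
    exact: measurable_test.
  apply: eq_integral => om _; rewrite /H !indicE; congr (_%:R)%:E; congr nat_of_bool.
  have e : observation xi b eps th om = sc (displace n c' (noise om)).
    apply/funext => j; rewrite /observation bth /sc /displace.
    by case: ifP => _; rewrite ?add0r// mulrDr addrC.
  by apply/idP/idP; rewrite !inE /A /= e.
have h2 : (\int[P]_om (1 - H (noise om)) <= alpha%:E)%E.
  move: level; congr (_ <= _)%E.
  rewrite /law /pushforward -(setIT (_ @^-1` _)) -[LHS]integral_indic//; last first.
    rewrite -[X in measurable X]setTI; apply: measurable_observation => //.
    exact: measurable_test.
  apply: eq_integral => om _; rewrite /H -EFinB !indicE; congr _%:E.
  have e : observation xi b eps (fun=> 0) om = sc (noise om).
    by apply/funext => j; rewrite /observation mulr0 add0r.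
  have -> : (noise om \in A) = ~~ psi (sc (noise om)).
    by apply/idP/idP; rewrite inE /A /=; [move=> ->|move/negbTE].
  have -> : (om \in observation xi b eps (fun=> 0) @^-1` [set y | psi y = true]) =
      psi (sc (noise om)).
    by apply/idP/idP; rewrite inE /= e.
  by case: (psi _); rewrite ?subr0 ?subrr.
have mL := measurable_lratio c n.
have H1 om : (0 <= 1 - H (noise om))%E.
  by rewrite /H -EFinB lee_fin subr_ge0 indicE; case: (_ \in _).
have m1H : measurable_fun setT (fun om => (1 - H (noise om))%E).
  by apply: emeasurable_funB => //; exact: measurable_cst.
have mHL : measurable_fun setT (fun om => (H (noise om) * (lratio c n om)%:E)%E).
  by apply: emeasurable_funM => //; exact/measurable_EFinP.
have ml1H : measurable_fun setT (fun om => (l%:E * (1 - H (noise om)))%E).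
  by apply: emeasurable_funM => //; exact: measurable_cst.
apply: (@le_trans _ _ (\int[P]_om (H (noise om) * (lratio c n om)%:E + l%:E * (1 - H (noise om))))%E).
  apply: ge0_le_integral => //.
  - by move=> om _; rewrite lee_fin le_min lratio_ge0.
  - by apply/measurable_EFinP; exact: measurable_minr.
  - exact: emeasurable_funD.
  move=> om _; rewrite /H -EFinB -!EFinM -EFinD lee_fin indicE.
  by case: (_ \in _); rewrite ?subrr ?subr0 ?mulr0 ?addr0 ?mul1r ?mul0r ?add0r ?mulr1 ge_min lexx ?orbT.
rewrite ge0_integralD//; first last.
- by move=> om _; rewrite mule_ge0.
- by move=> om _; rewrite mule_ge0// lee_fin lratio_ge0.
by rewrite ge0_integralZl// EFinD EFinM leeD// lee_wpmul2l.
Qed.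

End bayes.

(** * Second kind error from below *)

Section lower_bound.
Context {R : realType} {d : measure_display} {Om : measurableType d}.
Variables (P : probability Om R) (xi : nat -> {RV P >-> R}).
Hypothesis xi_indep : mutually_independent xi.
Hypothesis xi_gauss : forall j, standard_gaussian (xi j).
Notation obs := (@obs R).
Notation noise := (noise xi).
Notation gauss := (@gauss R).
Notation Phi := (@Phi R).

Lemma noise_weighted_variance (f : R -> R) (k : nat -> R) n :
  gauss.-integrable setT (EFin \o f) ->
  gauss.-integrable setT (EFin \o (fun x => f x ^+ 2)) ->
  \int[gauss]_x f x = 0 ->
  (\int[P]_om ((\sum_(j < n) k j * f (xi j om)) ^+ 2)%:E =
   (\int[gauss]_x (f x ^+ 2) * \sum_(j < n) k j ^+ 2)%:E)%E.
Proof.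
move=> fi f2i f0.
have Zl g c : gauss.-integrable setT (EFin \o g) ->
    gauss.-integrable setT (EFin \o (fun z => c * g z)).
  move=> gi; have := integrableZl measurableT c gi.
  by congr integrable; apply/funext => z; rewrite /= EFinM.
have e j : (fun x => (k j * f x) ^+ 2) = (fun x => k j ^+ 2 * f x ^+ 2).
  by apply/funext => x; rewrite exprMn.
rewrite (noise_variance xi_indep xi_gauss n (h := fun j x => k j * f x)).
- congr _%:E; rewrite mulr_sumr; apply: eq_bigr => j _.
  by rewrite e RintegralZl// mulrC.
- by move=> j; exact: Zl.
- by move=> j; rewrite e; exact: Zl.
- by move=> j; rewrite RintegralZl// f0 mulr0.
Qed.

Let affine_expectation (f : Om -> R) (A B' w : R) : measurable_fun setT f ->
  (forall om, 0 <= f om) -> 0 <= A -> 0 <= B' ->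
  (\int[P]_om (f om)%:E = w%:E)%E ->
  (\int[P]_om (A + B' * f om)%:E = (A + B' * w)%:E)%E.
Proof.
move=> mf f0 A0 B0 fw.
have mfE : measurable_fun setT (fun om => (f om)%:E) by exact/measurable_EFinP.
have hB : (\int[P]_om (B' * f om)%:E = (B' * w)%:E)%E.
  have f0E om : setT om -> (0 <= (f om)%:E)%E by rewrite lee_fin.
  rewrite EFinM -fw -(ge0_integralZl P measurableT mfE f0E) ?lee_fin//.
under eq_integral do rewrite EFinD.
rewrite ge0_integralD//; first last.
- by apply/measurable_EFinP; exact: measurable_funM.
- by move=> om _; rewrite lee_fin mulr_ge0.
by rewrite hB integral_cst// [X in (_ * X + _)%E](@probability_setT _ _ _ P) mule1 -EFinD.
Qed.

Definition quad4_var : R := \int[gauss]_x (quad4 x ^+ 2).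

(** [Z], [D] and [v] decompose the lower bound for the logarithm of the likelihood ratio: leading
    term, centred quartic error, and mean; the fourth moment 3 turns v / 12 into v / 4. *)
Let Z (c : nat -> R) n om : R := \sum_(j < n) c j ^+ 2 / 2 * chi (xi j om).
Let D (c : nat -> R) n om : R := \sum_(j < n) c j ^+ 4 / 12 * quad4 (xi j om).
Let v (c : nat -> R) n : R := \sum_(j < n) c j ^+ 4.

Let lratio_ge c n om : expR (Z c n om - D c n om - v c n / 4) <= lratio xi c n om.
Proof.
rewrite /Z /D /v mulr_suml -!sumrB expR_sum; apply: ler_prod => j _.
rewrite expR_ge0 /=.
apply: le_trans (ler_wpM2l (expR_ge0 _) (expR_le_cosh (c j * xi j om))).
rewrite -expRD ler_expR le_eqVlt; apply/orP; left; apply/eqP; rewrite /chi /quad4.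
by field.
Qed.

(** Lets a second moment control a first absolute moment, at a cost k / 2 that is free to choose. *)
Let abs_le_sqr (k x : R) : 0 < k -> `|x| <= k / 2 + x ^+ 2 / (2 * k).
Proof.
move=> k0; rewrite -(real_normK (num_real x)); move: `|x| => y.
rewrite -subr_ge0 (_ : _ - _ = (y - k) ^+ 2 / (2 * k)); last by field; rewrite gt_eqF.
by rewrite divr_ge0 ?sqr_ge0// mulr_ge0// ltW.
Qed.

(** Truncation at l makes the loss linear in |e| even though the exponential is not Lipschitz; for
    |e| >= 1 the error term alone exceeds the left side. *)
Let min_perturb (a e l : R) : 0 < a -> 0 <= l -> forall L, a * expR (- e) <= L ->
  Num.min a l <= Num.min L l + l * `|e|.
Proof.
move=> a0 l0 L aL; have m0 : 0 <= Num.min a l by rewrite le_min l0 ltW.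
have ml : Num.min a l <= l by rewrite ge_min lexx orbT.
have ma : Num.min a l <= a by rewrite ge_min lexx.
rewrite -lerBlDr le_min; apply/andP; split; last first.
  by rewrite (le_trans _ ml)// gerBl mulr_ge0.
have [e1|e1] := leP 1 `|e|.
  apply: le_trans (le_trans (mulr_ge0 (ltW a0) (expR_ge0 (- e))) aL).
  by rewrite subr_le0 (le_trans ml)// ler_peMr.
apply: le_trans aL; apply: (@le_trans _ _ (Num.min a l * (1 - `|e|))).
  by rewrite mulrBr mulr1 lerD2l lerN2 ler_wpM2r.
apply: (@le_trans _ _ (a * (1 - `|e|))).
  by rewrite ler_wpM2r// subr_ge0 ltW.
rewrite ler_wpM2l ?(ltW a0)// (le_trans _ (expR_ge1Dx _))//.
by rewrite lerD2l lerN2 ler_norm.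
Qed.

Let measurable_wsum (f : R -> R) (k : nat -> R) n : measurable_fun setT f ->
  measurable_fun setT (fun om => \sum_(j < n) k j * f (xi j om)).
Proof.
move=> mf; apply: (@measurable_sum_xi _ _ _ P xi n (fun j z => k j * f z)) => j.
exact: measurable_funM.
Qed.

Let EZ c n : (\int[P]_om ((Z c n om) ^+ 2)%:E = (v c n / 2)%:E)%E.
Proof.
rewrite /Z (noise_weighted_variance (fun j => c j ^+ 2 / 2) n integrable_chi integrable_chi2 chi_mean).
congr _%:E; rewrite chi_var /v mulr_sumr mulr_suml; apply: eq_bigr => j _.
by field.
Qed.

Let ED c n : (\int[P]_om ((D c n om) ^+ 2)%:E =
  (quad4_var * \sum_(j < n) (c j ^+ 4 / 12) ^+ 2)%:E)%E.
Proof.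
exact: (noise_weighted_variance (fun j => c j ^+ 4 / 12) n integrable_quad4 integrable_quad42 quad4_mean).
Qed.

Lemma quad4_var_ge0 : 0 <= quad4_var.
Proof. by apply: Rintegral_ge0 => x _; exact: sqr_ge0. Qed.

Lemma lratio_trunc c n (l k : R) : 0 <= l -> 0 < k ->
  (\int[P]_om (Num.min (expR (Z c n om - v c n / 4)) l)%:E <=
   \int[P]_om (Num.min (lratio xi c n om) l)%:E +
   (l * (k / 2 + quad4_var * (\sum_(j < n) (c j ^+ 4 / 12) ^+ 2) / (2 * k)))%:E)%E.
Proof.
move=> l0 k0.
have mZ : measurable_fun setT (Z c n).
  exact: (@measurable_wsum _ (fun j => c j ^+ 2 / 2) n measurable_chi).
have mD : measurable_fun setT (D c n).
  exact: (@measurable_wsum _ (fun j => c j ^+ 4 / 12) n measurable_quad4).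
have mL := @measurable_lratio _ _ _ P xi c n.
pose q om : R := l * (k / 2) + l / (2 * k) * D c n om ^+ 2.
have mq : measurable_fun setT q.
  have h : measurable_fun setT (fun om => l / (2 * k) * D c n om ^+ 2).
    exact: (measurable_funM (measurable_cst (l / (2 * k))) (measurable_funX 2 mD)).
  exact: (measurable_funD (measurable_cst (l * (k / 2))) h).
have mm : measurable_fun setT (fun om => Num.min (lratio xi c n om) l).
  exact: measurable_minr.
have lk0 : 0 <= l / (2 * k) by rewrite divr_ge0// mulr_ge0// ltW.
have q0 om : 0 <= q om.
  by rewrite addr_ge0// mulr_ge0 ?sqr_ge0// divr_ge0// ltW.
have Eq : (\int[P]_om (q om)%:E = (l * (k / 2 + quad4_var * (\sum_(j < n) (c j ^+ 4 / 12) ^+ 2) / (2 * k)))%:E)%E.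
  rewrite (affine_expectation _ _ _ _ (ED c n))//.
  - by congr _%:E; field; rewrite gt_eqF.
  - exact: (measurable_funX 2 mD).
  - by move=> om; exact: sqr_ge0.
  - by rewrite mulr_ge0// divr_ge0// ltW.
rewrite -Eq -ge0_integralD//; first last.
- exact/measurable_EFinP.
- by move=> om _; rewrite lee_fin.
- exact/measurable_EFinP.
- by move=> om _; rewrite lee_fin le_min lratio_ge0.
apply: ge0_le_integral => //.
- by move=> om _; rewrite lee_fin le_min expR_ge0.
- apply/measurable_EFinP; apply: measurable_minr => //.
  by apply: measurableT_comp => //; exact: measurable_funB.
- by apply: emeasurable_funD; exact/measurable_EFinP.
move=> om _; rewrite -EFinD lee_fin.
apply: le_trans (min_perturb (e := D c n om) (expR_gt0 _) l0 _) _.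
  by apply: le_trans (lratio_ge c n om); rewrite -expRD addrAC.
rewrite lerD2l /q; have := abs_le_sqr (D c n om) k0.
move=> /(ler_wpM2l l0); rewrite mulrDr => /le_trans; apply.
by rewrite lerD2l le_eqVlt; apply/orP; left; apply/eqP; field; rewrite gt_eqF.
Qed.

Variables (b : nat -> R) (eps : R).
Hypothesis eps0 : 0 < eps.
Variables (n : nat) (c : nat -> R) (Th : set (nat -> R)) (psi : @test R) (alpha B : R).
Hypothesis hTh :
  forall c', (forall j, c' j = c j \/ c' j = - c j) -> exists2 th, Th th &
     forall j, b j * th j = if (j < n)%N then eps * c' j else 0.
Hypothesis level : (law xi b eps (fun=> 0%R) [set y | psi y = true] <= alpha%:E)%E.
Hypothesis hB : forall th, Th th -> (law xi b eps th [set y | psi y = false] <= B%:E)%E.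

(** Taken at l = 1: [min (expR x) 1 >= 1 - |x|] at x = Z - v / 4, and both [Z] and [D] are small in
    mean square when [v] is small. No normal approximation enters. *)
Lemma lower_small (k : R) : 0 < k ->
  1 - alpha - (v c n / 4 + k + (v c n / 2 + quad4_var * \sum_(j < n) (c j ^+ 4 / 12) ^+ 2) / (2 * k)) <= B.
Proof.
move=> k0.
have := lratio_trunc c n ler01 k0.
have := bayes_bound xi_indep xi_gauss ler01 hTh level hB.
set q := quad4_var * _.
move=> h1 h2.
have mZ : measurable_fun setT (Z c n).
  exact: (@measurable_wsum _ (fun j => c j ^+ 2 / 2) n measurable_chi).
have v0 : 0 <= v c n by apply: sumr_ge0 => j _; rewrite exprn_even_ge0.
have h3 : (1 <= \int[P]_om (Num.min (expR (Z c n om - v c n / 4)) 1)%:E +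
    (v c n / 4 + k / 2 + v c n / 2 / (2 * k))%:E)%E.
  pose s om : R := v c n / 4 + k / 2 + (2 * k)^-1 * Z c n om ^+ 2.
  have A0 : 0 <= v c n / 4 + k / 2 by rewrite addr_ge0// divr_ge0// ltW.
  have B0 : 0 <= (2 * k)^-1 by rewrite invr_ge0 mulr_ge0// ltW.
  have mZ2 := measurable_funX 2 mZ.
  have Es : (\int[P]_om (s om)%:E = (v c n / 4 + k / 2 + v c n / 2 / (2 * k))%:E)%E.
    rewrite (affine_expectation mZ2 (fun om => sqr_ge0 (Z c n om)) A0 B0 (EZ c n)).
    by rewrite [in RHS](mulrC _ (2 * k)^-1).
  have s0 om : 0 <= s om by rewrite addr_ge0// mulr_ge0// sqr_ge0.
  have ms : measurable_fun setT s.
    by apply: measurable_funD => //; exact: measurable_funM.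
  have mm : measurable_fun setT (fun om => Num.min (expR (Z c n om - v c n / 4)) 1).
    apply: measurable_minr => //.
    by apply: measurableT_comp => //; exact: measurable_funB.
  rewrite -Es -ge0_integralD//; first last.
  - exact/measurable_EFinP.
  - by move=> om _; rewrite lee_fin.
  - exact/measurable_EFinP.
  rewrite -[leLHS](_ : \int[P]_om 1%:E = 1)%E; last first.
    by rewrite integral_cst// [X in (_ * X)%E](@probability_setT _ _ _ P) mule1.
  apply: ge0_le_integral => //.
  - by apply: emeasurable_funD; exact/measurable_EFinP.
  move=> om _; rewrite -EFinD lee_fin.
  have := abs_le_sqr (Z c n om) k0; rewrite [_ / (2 * k)]mulrC => hZ.
  have hE := expR_ge1Dx (Z c n om - v c n / 4).
  have hn : - `|Z c n om| <= Z c n om by rewrite lerNl -normrN ler_norm.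
  rewrite -lerBlDr le_min; apply/andP; split.
    by apply: le_trans hE; rewrite /s; lra.
  by rewrite gerBl.
have := le_trans h3 (leeD2r _ h2).
rewrite -addeA -EFinD => /le_trans /(_ (leeD2r _ h1)).
rewrite -EFinD lee_fin !mul1r mulrDl => h4.
lra.
Qed.

Lemma lower_clt (u t k0 k : R) (w : nat -> R) : 0 < u -> 0 <= k0 -> 0 < k ->
  (forall j, c j ^+ 2 = 2 * u * w j) -> 2 * \sum_(j < n) w j ^+ 2 = 1 ->
  (forall x, `|fine (P [set om | chi_sum xi w n om <= x]) - Phi x| <= k0) ->
  forall l, l = expR (u * t - u ^+ 2 / 2) ->
  Phi (t - u) + l * (1 - Phi t - alpha) -
    l * (k0 + k / 2 + quad4_var * (\sum_(j < n) (c j ^+ 4 / 12) ^+ 2) / (2 * k)) <= B.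
Proof.
move=> u0 k00 k1 cw w2 hcdf l le.
have l0 : 0 <= l by rewrite le expR_ge0.
(* With c^2 = 2 u w and unit variance of [chi_sum], the mean term is exactly the one of the Gaussian
   shift by u. *)
have vE : v c n / 4 = u ^+ 2 / 2.
  rewrite /v (eq_bigr (fun j : 'I_n => 4 * u ^+ 2 * w j ^+ 2)); last first.
    move=> j _; have -> : c j ^+ 4 = (c j ^+ 2) ^+ 2 by rewrite -exprM.
    by rewrite cw; ring.
  rewrite -mulr_sumr (_ : \sum_(i < n) w i ^+ 2 = 2^-1); last by lra.
  by field.
have ZE om : Z c n om = u * chi_sum xi w n om.
  rewrite /Z /chi_sum mulr_sumr; apply: eq_bigr => j _; rewrite cw.
  by field.
have h1 := bayes_bound xi_indep xi_gauss l0 hTh level hB.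
have := lratio_trunc c n l0 k1.
set q := quad4_var * _.
have -> : (\int[P]_om (Num.min (expR (Z c n om - v c n / 4)) l)%:E =
    \int[P]_om (trunc_exp u t (chi_sum xi w n om))%:E)%E.
  by apply: eq_integral => om _; rewrite ZE vE le.
move=> h2.
have h3 := gauss_trunc t (ltW u0).
have h4 := layer_cake t (measurable_chi_sum xi w n) u0 k00 hcdf.
have := le_trans h3 (le_trans h4 (leeD2r _ (le_trans h2 (leeD2r _ h1)))).
rewrite -!EFinD lee_fin -le.
lra.
Qed.

End lower_bound.

(** * Tests *)

Section anderson.
Context {R : realType}.
Notation gauss := (@gauss R).
Notation Phi := (@Phi R).
Implicit Types q m : R.

Let mabs q : measurable_fun setT (fun z : R => (\1_[set z : R | `|z| <= q] z : R)%:E).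
Proof.
apply/measurable_EFinP; apply: measurable_indic.
have := @normr_measurable R setT measurableT _ (measurable_itv `]-oo, q]); rewrite setTI.
by congr measurable; apply/seteqP; split => z /=; rewrite in_itv.
Qed.

Let mabsC q : measurable_fun setT (fun z : R => (1 - \1_[set z : R | `|z| <= q] z : R)%:E).
Proof.
apply/measurable_EFinP; apply: measurable_funB => //.
by apply/measurable_EFinP; exact: mabs.
Qed.

Let i01 q z : 0 <= (\1_[set z : R | `|z| <= q] z : R) <= 1.
Proof. by rewrite indicE; case: (_ \in _); rewrite ?lexx ?ler01. Qed.

(* By symmetry the shifted mass is the integral of [tilt m], which is increasing
   in [|z|]: it is compared with its value at [|z| = q], according to whether
   that value is below or above [1]. *)
Lemma gauss_shift_ball q m : 0 <= q ->
  (\int[gauss]_z (\1_[set z : R | (`|z| <= q)%R] (z + m))%:E <=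
   \int[gauss]_z (\1_[set z : R | (`|z| <= q)%R] z)%:E)%E.
Proof.
move=> q0; set A := [set z : R | _].
have tiltE (f : R -> \bar R) : measurable_fun setT f -> (forall x, 0 <= f x)%E ->
    (forall x, f (- x) = f x) ->
    (\int[gauss]_z f (z + m)%R = \int[gauss]_z (f z * (tilt m z)%:E))%E.
  move=> mf f0 fN; rewrite gauss_tilt//.
  have -> : (\int[gauss]_z f (z - m)%R = \int[gauss]_z f (z + m)%R)%E.
    rewrite -(@gauss_opp _ (fun z => f (z - m)%R))//; last first.
      by apply: measurableT_comp => //; exact: measurable_funB.
    by apply: eq_integral => z _; rewrite -opprD fN.
  rewrite -ge0_muleDl ?lee_fin ?invr_ge0// -EFinD.
  by rewrite (_ : 2^-1 + 2^-1 = 1 :> R) ?mul1e//; field.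
have AN z : \1_A (- z) = \1_A z :> R.
  by rewrite !indicE /A; congr (_%:R); congr nat_of_bool; apply/idP/idP; rewrite !inE /= normrN.
have tle z w : `|z| <= `|w| -> tilt m z <= tilt m w.
  move=> zw; rewrite ler_wpM2l ?expR_ge0// cosh_homo// !normrM.
  by rewrite ler_wpM2l.
have mt : measurable_fun setT (fun z => (tilt m z)%:E).
  by apply/measurable_EFinP; exact: measurable_tilt.
have [k1|k1] := leP (tilt m q) 1.
  have A0 z : (0 <= (\1_A z : R)%:E)%E by rewrite lee_fin; case/andP: (i01 q z).
  have AE z : (\1_A (- z) : R)%:E = (\1_A z)%:E by rewrite AN.
  rewrite (tiltE (fun z => (\1_A z)%:E) (mabs q) A0 AE).
  apply: ge0_le_integral => //.
  - by move=> z _; rewrite mule_ge0// lee_fin tilt_ge0.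
  - by apply: emeasurable_funM => //; exact: mabs.
  - exact: mabs.
  move=> z _; rewrite -EFinM lee_fin indicE; have [zA|_] := boolP (z \in A); last by rewrite mul0r.
  rewrite mul1r (le_trans _ k1)//; apply: tle.
  by move: zA; rewrite inE /A /= (ger0_norm q0).
have h : (\int[gauss]_z (1 - \1_A z)%:E <= \int[gauss]_z (1 - \1_A (z + m))%:E)%E.
  have A0 z : (0 <= (1 - \1_A z : R)%:E)%E.
    by rewrite lee_fin subr_ge0; case/andP: (i01 q z).
  have AE z : (1 - \1_A (- z) : R)%:E = (1 - \1_A z)%:E by rewrite AN.
  rewrite (tiltE (fun z => (1 - \1_A z)%:E) (mabsC q) A0 AE).
  apply: ge0_le_integral => //.
  - exact: mabsC.
  - by apply: emeasurable_funM => //; exact: mabsC.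
  move=> z _; rewrite -EFinM lee_fin indicE; have [_|zA] := boolP (z \in A).
    by rewrite subrr mul0r.
  rewrite subr0 mul1r (le_trans (ltW k1))//; apply: tle.
  by move: zA; rewrite notin_setE /A /= (ger0_norm q0) => /negP; rewrite -ltNge => /ltW.
have splitE (f : R -> R) : measurable_fun setT f -> (forall z, 0 <= f z <= 1) ->
    (\int[gauss]_z (1 - f z)%:E = (1 - \int[gauss]_z f z)%:E)%E /\
    (\int[gauss]_z (f z)%:E = (\int[gauss]_z f z)%:E)%E.
  move=> mf f01.
  have fi : gauss.-integrable setT (EFin \o f).
    apply: (@bounded_integrable _ _ _ _ _ 1) => // z.
    by have /andP[? ?] := f01 z; rewrite ger0_norm.
  have ci : gauss.-integrable setT (EFin \o (fun=> 1 : R)) by exact: finite_measure_integrable_cst.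
  split; last exact: RintegralE.
  rewrite -[X in (X - _)%:E](Rintegral_cst_prob gauss 1) -RintegralB//.
  apply: RintegralE; have := integrableB measurableT ci fi.
  by congr integrable; apply/funext => z; rewrite /= EFinB.
have mA : measurable_fun setT (\1_A : R -> R) by apply/measurable_EFinP; exact: mabs.
have mAm : measurable_fun setT (fun z : R => \1_A (z + m) : R).
  by apply: measurableT_comp => //; exact: measurable_funD.
have [e1 e2] := splitE _ mA (i01 q).
have [e3 e4] := splitE _ mAm (fun z => i01 q (z + m)).
move: h; rewrite e1 e2 e3 e4 !lee_fin => h.
by rewrite -lerN2 -(lerD2l 1).
Qed.

Let gauss_Nray q : (gauss `]-oo, (- q)%R[ = (1 - Phi q)%:E)%E.
Proof.
rewrite -gauss_gt -(setIT `]q, +oo[%classic) -[RHS]integral_indic//.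
rewrite -(setIT `]-oo, (- q)%R[%classic) -[LHS]integral_indic//.
rewrite -(@gauss_opp _ (fun z => (\1_`]-oo, (- q)%R[ z)%:E))//; last first.
  by apply/measurable_EFinP; exact: measurable_indic.
apply: eq_integral => z _; rewrite !indicE; congr (_%:R)%:E; congr nat_of_bool.
by apply/idP/idP; rewrite !inE /= !in_itv /= ltrN2 andbT.
Qed.

Let tailE q : [set z : R | q < `|z|] = `]-oo, (- q)%R[ `|` `]q, +oo[.
Proof.
apply/seteqP; split => z /=; rewrite !in_itv /= andbT lter_normr ltrNr;
by [move=> /orP[]; [right|left]|move=> [->|->]; rewrite ?orbT].
Qed.

Lemma gauss_tail2 q : (gauss [set z : R | (q < `|z|)%R] <= (2 * (1 - Phi q))%:E)%E.
Proof.
rewrite tailE mulrDl mul1r EFinD -{1}gauss_Nray -gauss_gt.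
exact: (@measureU2 _ _ _ gauss).
Qed.

Lemma gauss_ball q : 0 <= q -> (gauss [set z : R | (`|z| <= q)%R] = (2 * Phi q - 1)%:E)%E.
Proof.
move=> q0.
have -> : [set z : R | `|z| <= q] = ~` [set z : R | q < `|z|].
  by apply/seteqP; split => z /=; rewrite leNgt => /negP.
have mtail : measurable [set z : R | q < `|z|] by rewrite tailE; exact: measurableU.
apply: etrans (@probability_setC _ _ _ gauss _ mtail) _.
have -> : (2 * Phi q - 1 = 1 - (1 - Phi q + (1 - Phi q))) by ring.
rewrite EFinB; congr (_ - _)%E; rewrite EFinD -{1}gauss_Nray -gauss_gt tailE.
apply: (@measureU _ _ _ gauss) => //; rewrite -subset0 => z /= [].
rewrite !in_itv /= andbT => h1 h2.
by have := lt_trans h2 h1; rewrite ltNge lerNl (le_trans _ q0)// oppr_le0.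
Qed.

End anderson.

Section tests.
Context {R : realType} {d : measure_display} {Om : measurableType d}.
Variables (P : probability Om R) (xi : nat -> {RV P >-> R}).
Hypothesis xi_indep : mutually_independent xi.
Hypothesis xi_gauss : forall j, standard_gaussian (xi j).
Notation obs := (@obs R).
Notation gauss := (@gauss R).
Notation Phi := (@Phi R).
Variables (b : nat -> R) (eps : R).
Hypothesis eps0 : 0 < eps.

Lemma threshold_test (f : obs -> R) (T : R) : measurable_fun setT f ->
  exists psi : @test R, forall y, psi y = (T < f y).
Proof.
move=> mf.
have mpsi : measurable_fun [set: obs] (fun y => T < f y).
  exact: measurable_fun_ltr.
pose psi : {mfun obs >-> bool} :=
  HB.pack (fun y : obs => T < f y) (isMeasurableFun.Build _ _ _ _ _ mpsi).
by exists psi.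
Qed.

Let mball q : measurable [set z : R | `|z| <= q].
Proof.
have := @normr_measurable R setT measurableT _ (measurable_itv `]-oo, q]); rewrite setTI.
by congr measurable; apply/seteqP; split => z /=; rewrite in_itv.
Qed.

(** Rejects when the first coordinate is large in absolute value. By [gauss_shift_ball] any shift of
    that coordinate makes acceptance at most as likely as under the null hypothesis. *)
Lemma unbiased_test alpha : 0 < alpha < 1 -> exists psi : @test R,
  (law xi b eps (fun=> 0%R) [set y | psi y = true] <= alpha%:E)%E /\
  forall th, (law xi b eps th [set y | psi y = false] <= (1 - alpha)%:E)%E.
Proof.
move=> /andP[a0 a1].
have [q hq] : exists q, Phi q = 1 - alpha / 2.
  by apply: Phi_surj; apply/andP; split; lra.
have mc : measurable_fun [set: obs] (fun y : obs => `|y 0%N|).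
  by apply: measurableT_comp => //; exact: measurable_coord.
have [psi psiE] := threshold_test (eps * q) mc; exists psi; split.
  rewrite /law /pushforward.
  rewrite (_ : _ @^-1` _ = xi 0%N @^-1` [set z : R | q < `|z|]); last first.
    apply/seteqP; split => om /=; rewrite psiE /observation mulr0 add0r normrM;
    by rewrite (ger0_norm (ltW eps0)) ltr_pM2l.
  rewrite (P_xi xi_gauss); last first.
    rewrite (_ : [set z : R | q < `|z|] = ~` [set z : R | `|z| <= q]); first exact: measurableC.
    by apply/seteqP; split => z /=; rewrite ltNge => /negP.
  by apply: le_trans (gauss_tail2 q) _; rewrite hq lee_fin; lra.
move=> th; pose m := b 0%N * th 0%N / eps.
have mA : measurable [set z : R | `|z + m| <= q].
  have mf : measurable_fun setT (fun z : R => z + m) by exact: measurable_funD.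
  by rewrite -[X in measurable X]setTI; exact: (mf measurableT _ (mball q)).
rewrite /law /pushforward.
rewrite (_ : _ @^-1` _ = xi 0%N @^-1` [set z : R | `|z + m| <= q]); last first.
  have e om : b 0%N * th 0%N + eps * xi 0%N om = eps * (xi 0%N om + m).
    by rewrite /m; field; rewrite gt_eqF.
  apply/seteqP; split => om /=;
    rewrite psiE /observation e normrM (ger0_norm (ltW eps0)) ltr_pM2l// leNgt.
    by move=> ->.
  by move/negbTE.
rewrite (P_xi xi_gauss)//.
(* For negative [q] the acceptance event would be empty, so the sign of this quantile need not be
   established. *)
have [q0|q0] := leP 0 q; last first.
  rewrite (_ : [set z : R | _] = set0) ?measure0 ?lee_fin; first lra.
  by apply/seteqP; split => // z /=; rewrite leNgt (lt_le_trans q0).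
rewrite -(setIT [set z : R | _]) -[leLHS]integral_indic//.
apply: (@le_trans _ _ (\int[gauss]_z (\1_[set z : R | (`|z| <= q)%R] (z + m))%:E)%E).
  rewrite le_eqVlt; apply/orP; left; apply/eqP; apply: eq_integral => z _.
  by rewrite !indicE; congr (_%:R)%:E; congr nat_of_bool; apply/idP/idP; rewrite !inE.
apply: le_trans (gauss_shift_ball m q0) _.
rewrite integral_indic// setIT -[leLHS]/(gauss _) gauss_ball// lee_fin hq; lra.
Qed.

End tests.

Section chi_square_test.
Context {R : realType} {d : measure_display} {Om : measurableType d}.
Variables (P : probability Om R) (xi : nat -> {RV P >-> R}).
Hypothesis xi_indep : mutually_independent xi.
Hypothesis xi_gauss : forall j, standard_gaussian (xi j).
Notation obs := (@obs R).
Notation gauss := (@gauss R).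
Variables (b : nat -> R) (eps : R).
Hypothesis eps0 : 0 < eps.

Lemma chebyshev_sqr (X : Om -> R) (v s : R) : measurable_fun setT X -> 0 < s ->
  (\int[P]_om (X om ^+ 2)%:E = v%:E)%E ->
  (P [set om | (s <= `|X om|)%R] <= (v / s ^+ 2)%:E)%E.
Proof.
move=> mX s0 Xv.
have mA : measurable [set om | s <= `|X om|].
  have mn : measurable_fun setT (fun om => `|X om|) by exact: measurableT_comp.
  have := mn measurableT _ (measurable_itv `[s, +oo[); rewrite setTI.
  by congr measurable; apply/seteqP; split => om /=; rewrite in_itv /= andbT.
have mX2 := measurable_funX 2 mX.
have mX2E : measurable_fun setT (fun om => (X om ^+ 2)%:E) by exact/measurable_EFinP.
have X0 om : setT om -> (0 <= (X om ^+ 2)%:E)%E by rewrite lee_fin sqr_ge0.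
have s20 : 0 <= (s ^+ 2)^-1 by rewrite invr_ge0 sqr_ge0.
rewrite mulrC EFinM -Xv -(ge0_integralZl P measurableT mX2E X0) ?lee_fin//.
rewrite -(setIT [set om | _]) -[leLHS]integral_indic//.
apply: ge0_le_integral => //.
- by apply/measurable_EFinP; exact: measurable_indic.
- by apply: emeasurable_funM => //; exact: measurable_cst.
move=> om _; rewrite -EFinM lee_fin indicE; have [oA|_] := boolP (om \in _); last first.
  by rewrite mulr_ge0 ?sqr_ge0.
move: oA; rewrite inE /= => sX.
rewrite mulrC ler_pdivlMr ?exprn_gt0// mul1r -(real_normK (num_real (X om))).
by rewrite lerXn2r// nnegrE// ltW.
Qed.

Lemma chi_sum_var (w : nat -> R) n :
  (\int[P]_om (chi_sum xi w n om ^+ 2)%:E = (2 * \sum_(j < n) w j ^+ 2)%:E)%E.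
Proof.
have := noise_weighted_variance xi_indep xi_gauss w n integrable_chi integrable_chi2 chi_mean.
by rewrite chi_var.
Qed.

(** Under an alternative the statistic gains its mean h and a linear Gaussian term of variance at
    most 4 W h. Chebyshev at distance dl (h + K), with 4 h K <= (h + K)^2, gives an error free of h,
    hence uniform over alternatives. *)
Lemma chi_test (w : nat -> R) n W T : 0 <= W -> (forall j, 0 <= w j) ->
  (forall j, (j < n)%N -> w j <= W) ->
  exists psi : @test R,
    (law xi b eps (fun=> 0%R) [set y | psi y = true] =
       P [set om | (T < chi_sum xi w n om)%R])%E /\
    forall (th : nat -> R) (h : R), h = \sum_(j < n) w j * (b j * th j / eps) ^+ 2 ->
    forall K dl : R, 0 < K -> 0 < dl ->
    (law xi b eps th [set y | psi y = false] <=
      P [set om | (chi_sum xi w n om <= T - h + dl * (h + K))%R] + (W / (dl ^+ 2 * K))%:E)%E.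
Proof.
move=> W0 w0 wW.
have en : eps != 0 by rewrite gt_eqF.
pose f (y : obs) : R := \sum_(j < n) w j * ((y j / eps) ^+ 2 - 1).
have mf : measurable_fun setT f.
  apply: (@measurable_sum_coord _ n (fun j z => w j * ((z / eps) ^+ 2 - 1))) => j.
  apply: measurable_funM => //; apply: measurable_funB => //.
  by apply: measurable_funX; exact: measurable_funM.
have [psi psiE] := threshold_test T mf; exists psi.
have mS := measurable_chi_sum xi w n.
split.
  have f0 om : f (observation xi b eps (fun=> 0) om) = chi_sum xi w n om.
    by apply: eq_bigr => j _; rewrite /observation mulr0 add0r mulrAC divff// mul1r.
  by rewrite /law /pushforward; congr (P _); apply/seteqP; split => om /=; rewrite psiE f0.
move=> th h hE K dl K0 dl0.
pose c j := b j * th j / eps.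
pose M om : R := \sum_(j < n) (2 * w j * c j) * xi j om.
have mM : measurable_fun setT M.
  apply: (@measurable_sum_xi _ _ _ P xi n (fun j z => 2 * w j * c j * z)) => j.
  exact: measurable_funM.
have h0 : 0 <= h.
  by rewrite hE; apply: sumr_ge0 => j _; rewrite mulr_ge0// sqr_ge0.
have fE om : f (observation xi b eps th om) = chi_sum xi w n om + M om + h.
  rewrite /f /chi_sum /M hE -!big_split /=; apply: eq_bigr => j _.
  by rewrite /observation /chi /c; field.
pose s := dl * (h + K).
have s0 : 0 < s by rewrite mulr_gt0// ltr_wpDl.
have EM : (\int[P]_om (M om ^+ 2)%:E = (\sum_(j < n) (2 * w j * c j) ^+ 2)%:E)%E.
  have i1 : gauss.-integrable setT (EFin \o (fun z : R => z)) by exact: (gauss_integrableX 1).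
  have i2 : gauss.-integrable setT (EFin \o (fun z : R => z ^+ 2)) by exact: gauss_integrableX.
  have := noise_weighted_variance xi_indep xi_gauss (fun j => 2 * w j * c j) n i1 i2 gauss_mean.
  by rewrite gauss_var mul1r.
have cheb := chebyshev_sqr mM s0 EM.
set A := [set om | (chi_sum xi w n om <= T - h + dl * (h + K))%R].
set B := [set om | (s <= `|M om|)%R] in cheb.
have mA : measurable A.
  have := mS measurableT _ (measurable_itv `]-oo, (T - h + dl * (h + K))]); rewrite setTI.
  by congr measurable; apply/seteqP; split => om /=; rewrite in_itv.
have mB : measurable B.
  have mn : measurable_fun setT (fun om => `|M om|) by exact: measurableT_comp.
  have := mn measurableT _ (measurable_itv `[s, +oo[); rewrite setTI.
  by congr measurable; apply/seteqP; split => om /=; rewrite in_itv /= andbT.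
apply: (@le_trans _ _ (P (A `|` B))).
  rewrite /law /pushforward; apply: le_measure; rewrite ?inE; last 2 first.
  - exact: measurableU.
  - move=> om /=; rewrite psiE fE => /negbT; rewrite -leNgt => hT.
    have [hA|hA] := leP (chi_sum xi w n om) (T - h + dl * (h + K)); first by left.
    right; rewrite /B /= -normrN (le_trans _ (ler_norm _))//; rewrite /s; lra.
  - rewrite -[X in measurable X]setTI; apply: (measurable_observation xi b eps th) => //.
    exact: measurable_test.
apply: le_trans (measureU2 P mA mB) _.
rewrite leeD2l// (le_trans cheb)// lee_fin.
have S1 : \sum_(j < n) (2 * w j * c j) ^+ 2 <= 4 * W * h.
  rewrite hE mulr_sumr; apply: ler_sum => j _.
  rewrite (_ : (2 * w j * c j) ^+ 2 = 4 * w j * (w j * c j ^+ 2)); last by ring.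
  apply: ler_wpM2r; first by rewrite mulr_ge0 ?sqr_ge0.
  by rewrite ler_pM2l ?ltr0n// wW.
apply: (@le_trans _ _ (4 * W * h / s ^+ 2)).
  by rewrite ler_wpM2r// invr_ge0 sqr_ge0.
have dK0 : 0 < dl ^+ 2 * K by rewrite mulr_gt0// exprn_gt0.
rewrite ler_pdivrMr ?exprn_gt0// [leRHS]mulrAC ler_pdivlMr// /s exprMn.
have := sqr_ge0 (h - K); have : 0 <= W * dl ^+ 2 by rewrite mulr_ge0// sqr_ge0.
move=> h1 h2; have := mulr_ge0 h1 h2; rewrite -subr_ge0 => h3.
rewrite -subr_ge0 (_ : _ - _ = W * dl ^+ 2 * (h - K) ^+ 2); last by ring.
by rewrite mulr_ge0.
Qed.

End chi_square_test.

(** * The extremal problem *)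

Section extremal.
Context {R : realType}.
Variables (a b : nat -> R) (r : R).
Hypothesis a_pos : forall j, 0 < a j.
Hypothesis b_pos : forall j, 0 < b j.
Hypothesis a_nondecreasing : forall i j : nat, (i <= j)%N -> a i <= a j.
Hypothesis a_infty : a @ \oo --> +oo.
Hypothesis r_pos : 0 < r.
Implicit Types (eta th : nat -> R) (n : nat).

Definition pairing n eta eta' : R := \sum_(j < n) b j ^+ 4 * eta j * eta' j.

(* [eta] stands for the squares of a sequence: in these variables the constraints
   are linear and the objective is convex. *)
Definition fin_alt n eta := [/\ forall j, 0 <= eta j,
  forall j, (n <= j)%N -> eta j = 0,
  \sum_(j < n) a j ^+ 2 * eta j <= 1 & r ^+ 2 <= \sum_(j < n) eta j].

Let nneseries_fin (f : nat -> R) n : (forall j, (n <= j)%N -> f j = 0) ->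
  (forall j, 0 <= f j) ->
  (\sum_(0 <= k <oo) (f k)%:E = (\sum_(j < n) f j)%:E)%E.
Proof.
move=> fn f0; rewrite (nneseries_split 0 n)//; last by move=> k _; rewrite lee_fin.
rewrite eseries0 ?adde0; last by move=> k nk _; rewrite fn.
by rewrite add0n sumEFin big_mkord.
Qed.

Lemma fin_alt_Theta n eta th : fin_alt n eta -> (forall j, th j ^+ 2 = eta j) ->
  Theta a r th /\ sum_b4th4 b th = (pairing n eta eta)%:E.
Proof.
move=> [eta0 etan aeta reta] thE.
have e1 : (\sum_(0 <= k <oo) (th k ^+ 2)%:E = (\sum_(j < n) eta j)%:E)%E.
  rewrite -(@nneseries_fin (fun k => eta k) n)//.
  by apply: eq_eseriesr => k _; rewrite thE.
have th4 k : th k ^+ 4 = eta k ^+ 2 by rewrite -thE -exprM.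
split; last first.
  rewrite /sum_b4th4 /pairing -(@nneseries_fin (fun k => b k ^+ 4 * eta k * eta k) n).
  - by apply: eq_eseriesr => k _; rewrite th4 expr2 mulrA.
  - by move=> j nj; rewrite etan// mulr0.
  - by move=> j; rewrite mulr_ge0// mulr_ge0// exprn_ge0// ltW.
split; first split.
- by rewrite /ell2 /= e1 ltry.
- rewrite (_ : (\sum_(0 <= k <oo) _ = (\sum_(j < n) a j ^+ 2 * eta j)%:E)%E) ?lee_fin//.
  rewrite -(@nneseries_fin (fun k => a k ^+ 2 * eta k) n).
  + by apply: eq_eseriesr => k _; rewrite thE.
  + by move=> j nj; rewrite etan// mulr0.
  + by move=> j; rewrite mulr_ge0// sqr_ge0.
- rewrite /ell2_norm e1 /= -(ger0_norm (ltW r_pos)) -sqrtr_sqr.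
  by rewrite ler_wsqrtr.
Qed.

(** Brings the series constraints to finite sums: [tau] is the squared norm, and monotonicity of a
    charges the mass beyond n at least a_n^2 per unit. *)
Lemma Theta_tail th : Theta a r th -> exists2 tau, r ^+ 2 <= tau &
  forall n, 0 <= tau - \sum_(j < n) th j ^+ 2 /\
   \sum_(j < n) a j ^+ 2 * th j ^+ 2 + a n ^+ 2 * (tau - \sum_(j < n) th j ^+ 2) <= 1.
Proof.
move=> [[th2 ath] rth].
have fin : (\sum_(0 <= k <oo) (th k ^+ 2)%:E \is a fin_num)%E.
  by rewrite ge0_fin_numE//; apply: nneseries_ge0 => k _ _; rewrite lee_fin sqr_ge0.
exists (fine (\sum_(0 <= k <oo) (th k ^+ 2)%:E)%E).
  move: rth; rewrite /ell2_norm => h.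
  rewrite -[leRHS]sqr_sqrtr ?lerXn2r ?nnegrE ?sqrtr_ge0 ?(ltW r_pos)//.
  by rewrite fine_ge0//; apply: nneseries_ge0 => k _ _; rewrite lee_fin sqr_ge0.
move=> n; set T := fine _.
pose t : \bar R := (\sum_(n <= k <oo) (th k ^+ 2)%:E)%E.
have t0 : (0 <= t)%E by apply: nneseries_ge0 => k _ _; rewrite lee_fin sqr_ge0.
have TE : (T%:E = (\sum_(j < n) th j ^+ 2)%:E + t)%E.
  rewrite /T fineK// (nneseries_split 0 n)//; last by move=> k _; rewrite lee_fin sqr_ge0.
  by rewrite add0n sumEFin big_mkord.
have tE : t = (T - \sum_(j < n) th j ^+ 2)%:E.
  by rewrite EFinB TE addeAC subee// add0e.
split; first by rewrite -lee_fin -tE.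
rewrite -lee_fin EFinD EFinM -tE; apply: le_trans ath.
rewrite [leRHS](nneseries_split 0 n)//; last first.
  by move=> k _; rewrite lee_fin mulr_ge0 ?sqr_ge0.
rewrite add0n sumEFin big_mkord leeD2l// -nneseriesZl//; last first.
  by move=> k _; rewrite lee_fin sqr_ge0.
rewrite eseries_cond [leRHS]eseries_cond; apply: lee_nneseries => [k _ _|k /= nk].
  by rewrite mule_ge0// lee_fin sqr_ge0.
rewrite -EFinM lee_fin ler_wpM2r ?sqr_ge0// lerXn2r ?nnegrE ?(ltW (a_pos _))//.
exact: a_nondecreasing.
Qed.

Lemma tail_small (k : R) n : 0 < k -> exists2 N, (n <= N)%N & (a N ^+ 2)^-1 <= k.
Proof.
move=> k0.
(* The bound 1 makes a_N^2 at least a_N, hence at least 1 / k. *)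
have /cvgryPge/(_ (Num.max 1 k^-1))[N0 _ hN] := a_infty.
exists (maxn n N0); first exact: leq_maxl.
have := hN (maxn n N0) (leq_maxr _ _); rewrite /= ge_max => /andP[h1 h2].
rewrite -[leRHS]invrK lef_pV2 ?posrE ?invr_gt0 ?exprn_gt0//.
by rewrite (le_trans h2)// expr2 ler_peMr// ltW.
Qed.

(* The mass [t] beyond index [n] goes to index [0], where [a] is smallest, so that
   the ellipsoid constraint is preserved. *)
Definition move_tail n (t : R) eta j : R :=
  if j == 0%N then eta 0%N + t else if (j < n)%N then eta j else 0.

Lemma sum_move_tail n t eta (f : nat -> R -> R) : (0 < n)%N ->
  \sum_(j < n) f j (move_tail n t eta j) =
  \sum_(j < n) f j (eta j) + (f 0%N (eta 0%N + t) - f 0%N (eta 0%N)).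
Proof.
case: n => // n _; rewrite !big_ord_recl /= {1}/move_tail eqxx.
rewrite (eq_bigr (fun i : 'I_n => f (lift ord0 i) (eta (lift ord0 i)))); last first.
  by move=> i _; rewrite /move_tail /= /bump /= ltnS ltn_ord.
by ring.
Qed.

Lemma fin_alt_move_tail n th tau : (0 < n)%N -> r ^+ 2 <= tau ->
  (forall n, 0 <= tau - \sum_(j < n) th j ^+ 2 /\
   \sum_(j < n) a j ^+ 2 * th j ^+ 2 + a n ^+ 2 * (tau - \sum_(j < n) th j ^+ 2) <= 1) ->
  fin_alt n (move_tail n (tau - \sum_(j < n) th j ^+ 2) (fun j => th j ^+ 2)).
Proof.
move=> n0 rt H; have [t0 h] := H n; set t := tau - _ in t0 h *.
split.
- move=> j; rewrite /move_tail; case: ifP => _; first by rewrite addr_ge0// sqr_ge0.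
  by case: ifP => _ //; exact: sqr_ge0.
- by move=> j nj; rewrite /move_tail gtn_eqF ?(leq_trans n0)// ltnNge nj.
- rewrite (sum_move_tail _ _ (fun j x => a j ^+ 2 * x))//; apply: le_trans h.
  rewrite lerD2l mulrDr addrAC subrr add0r ler_wpM2r//.
  by rewrite lerXn2r ?nnegrE ?(ltW (a_pos _))// a_nondecreasing.
- by rewrite (sum_move_tail _ _ (fun _ x => x))// addrAC subrr add0r /t subrKC.
Qed.

Lemma fin_alt_le n eta j : fin_alt n eta -> eta j <= (a 0%N ^+ 2)^-1.
Proof.
move=> [eta0 etan h _]; have a0 : 0 < a 0%N ^+ 2 by rewrite exprn_gt0.
have [jn|nj] := ltnP j n; last by rewrite etan// invr_ge0 ltW.
rewrite -[leRHS]mul1r ler_pdivlMr//; apply: le_trans h.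
rewrite (bigD1 (Ordinal jn))//= -[leLHS]addr0 lerD//; last first.
  by apply: sumr_ge0 => i _; rewrite mulr_ge0// sqr_ge0.
by rewrite mulrC ler_wpM2r// lerXn2r ?nnegrE ?(ltW (a_pos _))// a_nondecreasing.
Qed.

Lemma sum_widen n N eta (f : nat -> R -> R) : (n <= N)%N -> fin_alt n eta ->
  (forall j, f j 0 = 0) -> \sum_(j < N) f j (eta j) = \sum_(j < n) f j (eta j).
Proof.
move=> nN [_ etan _ _] f0.
rewrite -(subnKC nN) big_split_ord /= [X in _ + X]big1 ?addr0//.
by move=> i _; rewrite etan ?f0// leq_addr.
Qed.

Lemma fin_alt_widen n N eta : (n <= N)%N -> fin_alt n eta -> fin_alt N eta.
Proof.
move=> nN feta; have [eta0 etan h1 h2] := feta; split => //.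
- by move=> j Nj; rewrite etan// (leq_trans nN).
- by rewrite (sum_widen (f := fun j x => a j ^+ 2 * x) nN feta)// => j; rewrite mulr0.
- by rewrite (sum_widen (f := fun _ x => x) nN feta).
Qed.

(** Segments stay in the linear constraint set, so a lower bound m on the quadratic form applies
    along them. Small s yields the variational inequality, also for near minimizers. *)
Lemma fin_alt_convex n eta eta' (s m : R) : fin_alt n eta -> fin_alt n eta' ->
  0 <= s <= 1 -> (forall z, fin_alt n z -> m <= pairing n z z) ->
  m <= (1 - s) ^+ 2 * pairing n eta eta + 2 * s * (1 - s) * pairing n eta eta' +
    s ^+ 2 * pairing n eta' eta'.
Proof.
move=> [h1 h2 h3 h4] [g1 g2 g3 g4] /andP[s0 s1] hm.
have s10 : 0 <= 1 - s by rewrite subr_ge0.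
pose z j := (1 - s) * eta j + s * eta' j.
have fz : fin_alt n z.
  split.
  - by move=> j; rewrite addr_ge0// mulr_ge0.
  - by move=> j nj; rewrite /z h2// g2// !mulr0 addr0.
  - rewrite (eq_bigr (fun j : 'I_n => (1 - s) * (a j ^+ 2 * eta j) + s * (a j ^+ 2 * eta' j))); last first.
      by move=> j _; rewrite /z; ring.
    rewrite big_split /= -!mulr_sumr.
    apply: (le_trans (lerD (ler_wpM2l s10 h3) (ler_wpM2l s0 g3))).
    by rewrite !mulr1 subrK.
  - rewrite big_split /= -!mulr_sumr.
    have -> : r ^+ 2 = (1 - s) * r ^+ 2 + s * r ^+ 2 by ring.
    by rewrite lerD// ler_wpM2l.
apply: le_trans (hm _ fz) _; rewrite le_eqVlt; apply/orP; left; apply/eqP.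
rewrite /pairing !mulr_sumr -!big_split /=; apply: eq_bigr => j _.
by rewrite /z; ring.
Qed.

Lemma pairing_ge0 n eta eta' : fin_alt n eta -> fin_alt n eta' -> 0 <= pairing n eta eta'.
Proof.
move=> [h _ _ _] [g _ _ _]; apply: sumr_ge0 => j _.
by rewrite mulr_ge0// mulr_ge0// exprn_ge0// ltW.
Qed.

(** Common bound for the errors caused by [move_tail]. The moved mass is at most p = 1 / a_n^2 and
    entries are at most q = 1 / a_0^2: the quadratic form grows by at most 3 b_0^4 q p, a pairing by
    b_0^4 q p, a weight by b_0^2 p. *)
Definition trunc_err n : R :=
  (3 * b 0%N ^+ 4 * (a 0%N ^+ 2)^-1 + b 0%N ^+ 2) * (a n ^+ 2)^-1.

Lemma trunc_err_small (k : R) n : 0 < k -> exists N, [/\ (n <= N)%N, (0 < N)%N & trunc_err N <= k].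
Proof.
move=> k0; set C := 3 * b 0%N ^+ 4 * (a 0%N ^+ 2)^-1 + b 0%N ^+ 2.
have C0 : 0 < C.
  by rewrite addr_gt0 ?exprn_gt0// mulr_gt0 ?invr_gt0 ?exprn_gt0// mulr_gt0 ?exprn_gt0.
have [N nN hN] := tail_small n.+1 (divr_gt0 k0 C0).
exists N; split; [exact: ltnW|exact: leq_ltn_trans nN|].
by rewrite /trunc_err -/C mulrC -ler_pdivlMr.
Qed.

(** The truncation differs from the squares of [th] only by the gain at index 0 and the loss beyond
    n. Hence [zeta] is constrained at index 0 alone. *)
Lemma truncation n th : (0 < n)%N -> Theta a r th -> exists eta,
  [/\ fin_alt n eta, forall j, (j < n)%N -> th j ^+ 2 <= eta j,
   pairing n eta eta <= \sum_(j < n) b j ^+ 4 * th j ^+ 4 + trunc_err n,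
   forall zeta, 0 <= zeta 0%N <= (a 0%N ^+ 2)^-1 ->
     pairing n eta zeta <= \sum_(j < n) b j ^+ 4 * th j ^+ 2 * zeta j + trunc_err n
   & forall j, b j ^+ 2 * eta j <= b j ^+ 2 * th j ^+ 2 + trunc_err n].
Proof.
move=> n0 /Theta_tail[tau rtau H].
have feta := fin_alt_move_tail n0 rtau H; have [t0 ht] := H n; set t := tau - _ in feta t0 ht *.
set eta := move_tail n t _ in feta *; exists eta.
have an : 0 < a n ^+ 2 by rewrite exprn_gt0.
have tn : t <= (a n ^+ 2)^-1.
  rewrite -[leRHS]mul1r ler_pdivlMr// mulrC; apply: le_trans ht.
  by rewrite lerDr; apply: sumr_ge0 => j _; rewrite mulr_ge0 ?sqr_ge0.
have tn0 : (a n ^+ 2)^-1 <= (a 0%N ^+ 2)^-1.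
  rewrite lef_pV2 ?posrE ?exprn_gt0// lerXn2r ?nnegrE ?(ltW (a_pos _))//.
  exact: a_nondecreasing.
have th0 : th 0%N ^+ 2 + t <= (a 0%N ^+ 2)^-1.
  by have := fin_alt_le 0%N feta; rewrite /eta /move_tail eqxx.
have thp := sqr_ge0 (th 0%N).
have b4 : 0 <= b 0%N ^+ 4 by rewrite exprn_ge0// ltW.
have b2 : 0 <= b 0%N ^+ 2 by rewrite exprn_ge0// ltW.
rewrite /trunc_err; move: (a n ^+ 2)^-1 (a 0%N ^+ 2)^-1 tn tn0 th0 => p q tn tn0 th0.
have p0 := le_trans t0 tn; have q0 := le_trans p0 tn0.
have bqp : 0 <= b 0%N ^+ 4 * q * p := mulr_ge0 (mulr_ge0 b4 q0) p0.
have bp : 0 <= b 0%N ^+ 2 * p := mulr_ge0 b2 p0.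
split => //.
- move=> j jn; rewrite /eta /move_tail jn; case: ifP => [/eqP->|//].
  by rewrite lerDl.
- rewrite /pairing (sum_move_tail _ _ (fun j x => b j ^+ 4 * x * x))//.
  rewrite (eq_bigr (fun j : 'I_n => b j ^+ 4 * th j ^+ 4)); last first.
    by move=> j _; rewrite -mulrA -exprD.
  rewrite lerD2l; set y := th 0%N ^+ 2 in thp th0 *.
  have : b 0%N ^+ 4 * (t * (2 * y + t)) <= b 0%N ^+ 4 * (p * (3 * q)).
    by apply: ler_wpM2l => //; apply: ler_pM => //; lra.
  lra.
- move=> zeta /andP[z0 zq].
  rewrite /pairing (sum_move_tail _ _ (fun j x => b j ^+ 4 * x * zeta j))// lerD2l.
  have : b 0%N ^+ 4 * (t * zeta 0%N) <= b 0%N ^+ 4 * (p * q).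
    by rewrite ler_wpM2l// ler_pM.
  lra.
- move=> j; rewrite /eta /move_tail; case: ifP => [/eqP->|_].
    have : b 0%N ^+ 2 * t <= b 0%N ^+ 2 * p by rewrite ler_wpM2l.
    lra.
  have bj : 0 <= b j ^+ 2 by rewrite exprn_ge0// ltW.
  have : 0 <= b j ^+ 2 * th j ^+ 2 by rewrite mulr_ge0 ?sqr_ge0.
  by case: ifP => _ ?; lra.
Qed.

Lemma partial_sum_b4th4 n th : ((\sum_(j < n) b j ^+ 4 * th j ^+ 4)%:E <= sum_b4th4 b th)%E.
Proof.
rewrite /sum_b4th4 (nneseries_split 0 n)//; last first.
  by move=> k _; rewrite lee_fin mulr_ge0// ?exprn_even_ge0// exprn_ge0// ltW.
rewrite add0n -[X in (X%:E <= _)%E](big_mkord xpredT (fun j => b j ^+ 4 * th j ^+ 4)).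
rewrite -sumEFin leeDl//.
by apply: nneseries_ge0 => k _ _; rewrite lee_fin mulr_ge0// ?exprn_even_ge0// exprn_ge0// ltW.
Qed.

Lemma objective_fin_alt eps n eta : 0 < eps -> fin_alt n eta ->
  (u2 a b eps r <= ((2 * eps ^+ 4)^-1 * pairing n eta eta)%:E)%E.
Proof.
move=> e0 feta; have [eta0 _ _ _] := feta.
have [T S] := fin_alt_Theta (th := fun j => Num.sqrt (eta j)) feta (fun j => sqr_sqrtr (eta0 j)).
by apply: ereal_inf_lbound; eexists; first exact: T; rewrite /objective S.
Qed.

(** V is u^2 with its factor in eps removed. It is also the infimum over finitely supported
    sequences, so later arguments deal with finite sums. *)
Lemma u2_value eps : 0 < eps -> Theta a r !=set0 -> exists2 V, 0 <= V &
  [/\ u2 a b eps r = ((2 * eps ^+ 4)^-1 * V)%:E,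
   forall n eta, fin_alt n eta -> V <= pairing n eta eta &
   forall k, 0 < k -> exists n eta, [/\ (0 < n)%N, fin_alt n eta & pairing n eta eta <= V + k]].
Proof.
move=> e0 [th0 Tth0]; have c0 : 0 < 2 * eps ^+ 4 by rewrite mulr_gt0// exprn_gt0.
have [eta1 [f1 _ _ _ _]] := truncation (n := 1) isT Tth0.
have s0 th : (0 <= sum_b4th4 b th)%E.
  by have := partial_sum_b4th4 0 th; rewrite big_ord0.
have u0 : (0 <= u2 a b eps r)%E.
  by apply: le_ereal_inf_tmp => _ [th _ <-]; rewrite mule_ge0// lee_fin invr_ge0 ltW.
have ufin : u2 a b eps r \is a fin_num.
  by rewrite ge0_fin_numE// (le_lt_trans (objective_fin_alt e0 f1))// ltry.
exists (2 * eps ^+ 4 * fine (u2 a b eps r)); first by apply: mulr_ge0; [exact: ltW|exact: fine_ge0].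
split.
- by rewrite mulrA mulVf ?gt_eqF// mul1r fineK.
- move=> n eta /(objective_fin_alt e0).
  by rewrite -{1}(fineK ufin) lee_fin mulrC ler_pdivlMr// mulrC.
move=> k k0.
have [_ [th Tth <-] thk] : exists2 x, [set objective b eps th | th in Theta a r] x &
    (x < u2 a b eps r + ((2 * eps ^+ 4)^-1 * (k / 2))%:E)%E.
  by apply: lb_ereal_inf_adherent => //; rewrite mulr_gt0 ?divr_gt0 ?invr_gt0.
have [n [_ n0 en]] := trunc_err_small 0 (divr_gt0 k0 (ltr0n R 2)).
have [eta [feta _ h _ _]] := truncation n0 Tth.
exists n, eta; split => //; apply: le_trans h _.
rewrite [k in leRHS]splitr addrA lerD//.
have : (((2 * eps ^+ 4)^-1)%:E * (\sum_(j < n) b j ^+ 4 * th j ^+ 4)%:E <=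
   u2 a b eps r + ((2 * eps ^+ 4)^-1 * (k / 2))%:E)%E.
  apply: le_trans (ltW thk); rewrite lee_wpmul2l ?lee_fin ?invr_ge0 ?(ltW c0)//.
  exact: partial_sum_b4th4.
rewrite -{1}(fineK ufin) -EFinM -EFinD lee_fin.
rewrite -[X in _ <= X + _ -> _](mulKf (lt0r_neq0 c0)) -mulrDr ler_pM2l// invr_gt0//.
Qed.

Lemma sum_pairing n (th zeta : nat -> R) :
  \sum_(j < n) b j ^+ 4 * th j ^+ 2 * zeta j = pairing n zeta (fun j => th j ^+ 2).
Proof. by apply: eq_bigr => j _; exact: mulrAC. Qed.

(** An approximate variational inequality for a near minimizer among sequences supported on n
    coordinates. It makes the mean of the statistic at least half its nominal value. *)
Lemma separation V : 0 < V -> (forall n eta, fin_alt n eta -> V <= pairing n eta eta) ->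
  Theta a r !=set0 -> exists n eta, [/\ (0 < n)%N, fin_alt n eta &
    forall th, Theta a r th ->
      pairing n eta eta / 2 <= pairing n eta (fun j => th j ^+ 2)].
Proof.
move=> V0 hV [th0 Tth0].
(* [n] is fixed from V alone, so that every alternative can be truncated at this n and compared with
   the same near minimizer, at a loss V / 8. *)
have [n [_ n0 en]] := trunc_err_small 0 (divr_gt0 V0 (ltr0n R 8)).
have [eta0 [f0 _ _ _ _]] := truncation n0 Tth0.
pose A := [set pairing n eta eta | eta in fin_alt n].
have infA : has_inf A.
  split; first by exists (pairing n eta0 eta0), eta0.
  by exists V => _ [eta feta <-]; exact: hV.
have Vm : V <= inf A.
  by apply: lb_le_inf => [|_ [eta feta <-]]; [exact: infA.1|exact: hV].
have hm eta : fin_alt n eta -> inf A <= pairing n eta eta.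
  by move=> feta; apply: ge_inf; [exact: infA.2|exists eta].
move: (inf A) (fun e e0 => @inf_adherent R A e e0 infA) Vm hm => m adh Vm hm.
pose q := (a 0%N ^+ 2)^-1; have q0 : 0 <= q by rewrite invr_ge0 sqr_ge0.
pose B := \sum_(j < n) b j ^+ 4 * q * q.
have B0 : 0 <= B.
  by apply: sumr_ge0 => j _; rewrite mulr_ge0// mulr_ge0// exprn_ge0// ltW.
have hB eta : fin_alt n eta -> pairing n eta eta <= B.
  move=> feta; have [e0 _ _ _] := feta; apply: ler_sum => j _.
  have b4 : 0 <= b j ^+ 4 by rewrite exprn_ge0// ltW.
  have le := fin_alt_le j feta.
  by rewrite -mulrA -[leRHS]mulrA ler_wpM2l// ler_pM.
have m0 : 0 < m := lt_le_trans V0 Vm.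
(* This step makes the quadratic term s (m + B) equal to m / 8. With a near minimality gap s m / 8,
   also of order s, [fin_alt_convex] divided by 2 s leaves a pairing of at least 7 m / 8. *)
pose s := m / (8 * (m + B)).
have mB : 0 < 8 * (m + B) by rewrite mulr_gt0// ltr_pwDl.
have s0 : 0 < s by rewrite divr_gt0.
have sE : s * (m + B) = m / 8.
  by rewrite /s; field; rewrite gt_eqF// ltr_pwDl.
have s1 : s <= 1 / 8.
  by rewrite ler_pdivrMr//; lra.
have [_ [eta feta <-]] : exists2 x, A x & x < m + s * m / 8.
  by apply: adh; rewrite divr_gt0// mulr_gt0.
move: sE s0 s1; move: s => s sE s0 s1 etam.
exists n, eta; split => // th Tth.
have [eta' [f' _ _ h _]] := truncation n0 Tth.
have sI : 0 <= s <= 1 by apply/andP; split; lra.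
have cv := fin_alt_convex feta f' sI hm.
have [e0 _ _ _] := feta.
have hP : pairing n eta' eta <= pairing n eta (fun j => th j ^+ 2) + V / 8.
  have := h eta; rewrite e0 (fin_alt_le 0%N feta) => /(_ isT).
  by rewrite sum_pairing => /le_trans; apply; rewrite lerD2l.
have PC : pairing n eta eta' = pairing n eta' eta.
  by apply: eq_bigr => j _; rewrite mulrAC.
have P0 : 0 <= pairing n eta' eta by exact: pairing_ge0.
rewrite PC in cv.
have Q1 := hm _ feta; have Q2 := hB _ f'.
have P78 : 7 / 8 * m <= pairing n eta' eta.
  move: (pairing n eta' eta) (pairing n eta eta) (pairing n eta' eta') P0 etam Q1 Q2 cv.
  move=> P S S' P0 etam Q1 Q2 cv.
  have c1 : (1 - s) ^+ 2 * S <= (1 - s) ^+ 2 * m + s * m / 8.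
    have : (1 - s) ^+ 2 * (S - m) <= 1 * (S - m).
      by rewrite ler_wpM2r// ?subr_ge0// expr_le1//; lra.
    lra.
  have c2 : s ^+ 2 * S' <= s ^+ 2 * B by rewrite ler_wpM2l ?sqr_ge0.
  have c3 : 0 <= s ^+ 2 * P by rewrite mulr_ge0 ?sqr_ge0.
  have : s * (7 / 8 * m) <= s * P.
    have : s * (s * (m + B)) = s * (m / 8) by rewrite sE.
    lra.
  by rewrite ler_pM2l.
have : s * m / 8 <= m / 8 by rewrite ler_pM2r// ler_piMl//; lra.
lra.
Qed.

(** First-order condition at a minimum, with the limit s -> 0 replaced by an explicit small s. *)
Lemma le_of_quadratic (x y : R) : (forall s, 0 < s <= 1 -> 0 <= x + s * y) -> 0 <= x.
Proof.
move=> h; rewrite leNgt; apply/negP => x0.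
pose q := `|y| + `|x|; have q0 : 0 < q by rewrite ltr_wpDl// normr_gt0 lt_eqF.
have s0 : 0 < `|x| / (2 * q) by rewrite divr_gt0 ?normr_gt0 ?lt_eqF// mulr_gt0.
have := h (`|x| / (2 * q)); rewrite s0 ler_pdivrMr ?mulr_gt0// mul1r.
have -> : `|x| <= 2 * q by rewrite /q; have := normr_ge0 y; have := normr_ge0 x; lra.
move=> /(_ isT).
have : `|x| / (2 * q) * y <= `|x| / (2 * q) * q.
  by rewrite ler_wpM2l ?(ltW s0)// /q (le_trans (ler_norm y))// lerDl.
have -> : `|x| / (2 * q) * q = `|x| / 2 by field; rewrite gt_eqF.
by rewrite ltr0_norm//; lra.
Qed.

(** [thb] may have infinite support, so the segment joins [eta] to a truncation of [thb]; for fixed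
    s the truncation error is sent to 0, and only then is s. *)
Lemma variational_inequality S thb : Theta a r thb ->
  (forall n, \sum_(j < n) b j ^+ 4 * thb j ^+ 4 <= S) ->
  (forall n eta, fin_alt n eta -> S <= pairing n eta eta) ->
  forall n eta, fin_alt n eta -> S <= pairing n eta (fun j => thb j ^+ 2).
Proof.
move=> Tb hS hmin n eta feta; rewrite -subr_ge0 -(pmulr_rge0 _ (ltr0n R 2)).
set X := pairing n eta _; set S' := pairing n eta eta.
(* The coefficient of s^2 in (1 - s)^2 S + 2 s (1 - s) X + s^2 S' - S; the linear coefficient is 2
   (X - S). *)
apply: (@le_of_quadratic _ (S - 2 * X + S')) => s /andP[s0 s1].
rewrite -(pmulr_rge0 _ s0).
apply/ler_addgt0Pr => k k0; rewrite -lerBlDr.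
have [N [nN N0 eN]] := trunc_err_small n (divr_gt0 k0 (ltr0n R 2)).
have [z [fz _ h1 h2 _]] := truncation N0 Tb.
have fN := fin_alt_widen nN feta.
have sI : 0 <= s <= 1 by rewrite s1 ltW.
have := fin_alt_convex fz fN sI (hmin N).
have -> : pairing N eta eta = S'.
  by apply: (sum_widen (f := fun j x => b j ^+ 4 * x * x) nN feta) => j; rewrite mulr0.
have z1 : pairing N z z <= S + k / 2 by apply: le_trans h1 _; rewrite lerD.
have z2 : pairing N z eta <= X + k / 2.
  have [e0 _ _ _] := feta; have := h2 eta; rewrite e0 (fin_alt_le 0%N feta) => /(_ isT).
  rewrite (sum_widen (f := fun j x => b j ^+ 4 * thb j ^+ 2 * x) nN feta); last first.
    by move=> j; rewrite mulr0.
  by rewrite sum_pairing -/X => /le_trans; apply; rewrite lerD2l.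
move: (pairing N z z) (pairing N z eta) z1 z2 => p q z1 z2 cv.
have d1 : (1 - s) ^+ 2 * p <= (1 - s) ^+ 2 * (S + k / 2) by rewrite ler_wpM2l ?sqr_ge0.
have d2 : 2 * s * (1 - s) * q <= 2 * s * (1 - s) * (X + k / 2).
  by rewrite ler_wpM2l// mulr_ge0//; lra.
have d3 : 0 <= s ^+ 2 * k by rewrite mulr_ge0 ?sqr_ge0// ltW.
lra.
Qed.

(** A finitely supported replacement for the extremal sequence that keeps, up to k, its value, its
    largest weight and its variational inequality. *)
Lemma extremal_approximation eps thb : 0 < eps -> is_extremal a b eps r thb ->
  exists2 S, 0 < S & u2 a b eps r = ((2 * eps ^+ 4)^-1 * S)%:E /\
   forall k, 0 < k -> exists n eta, [/\ (0 < n)%N, fin_alt n eta,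
     S <= pairing n eta eta <= S + k,
     forall j, b j ^+ 2 * eta j <= omega0 b thb * Num.sqrt (2 * S) + k &
     forall th, Theta a r th -> S - k <= pairing n eta (fun j => th j ^+ 2)].
Proof.
move=> e0 [Tb ob]; have c0 : 0 < 2 * eps ^+ 4 by rewrite mulr_gt0// exprn_gt0.
have [S S0 [uE hmin _]] := u2_value e0 (ex_intro _ thb Tb).
have sE : sum_b4th4 b thb = S%:E.
  have := ob; rewrite uE /objective EFinM.
  by move/(congr1 (mule (2 * eps ^+ 4)%:E)); rewrite !muleA -!EFinM divff ?gt_eqF// ?mul1e ?mul1r.
have hS n : \sum_(j < n) b j ^+ 4 * thb j ^+ 4 <= S.
  by rewrite -lee_fin -sE partial_sum_b4th4.
have b4 j : 0 < b j ^+ 4 by rewrite exprn_gt0.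
have hj j : (b j ^+ 2 * thb j ^+ 2) ^+ 2 <= S.
  apply: le_trans (hS j.+1); rewrite big_ord_recr /= exprMn -!exprM lerDr.
  by apply: sumr_ge0 => i _; apply: mulr_ge0; [exact: ltW|exact: exprn_even_ge0].
have Sp : 0 < S.
  (* If S = 0 then [thb] vanishes, and [Theta_tail] gives r^2 <= 1 / a_N^2 for every N, which fails
     for large N. *)
  rewrite lt_neqAle S0 andbT; apply/eqP => S00.
  have z j : thb j ^+ 2 = 0.
    apply/eqP; have := hj j; rewrite -S00.
    rewrite le_eqVlt ltNge sqr_ge0 orbF sqrf_eq0 mulf_eq0.
    by rewrite gt_eqF ?exprn_gt0.
  have [tau rt H] := Theta_tail Tb.
  have [N _ hN] := tail_small 0 (divr_gt0 (exprn_gt0 2 r_pos) (ltr0n R 2)).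
  have [_] := H N; rewrite !big1 => [|j _|j _]; rewrite ?z ?mulr0//.
  rewrite subr0 add0r mulrC -ler_pdivlMr ?exprn_gt0// mul1r => h.
  by have := le_trans rt (le_trans h hN); have := exprn_gt0 2 r_pos; lra.
exists S => //; split => // k k0.
have [n [_ n0 en]] := trunc_err_small 0 k0.
have [eta [feta etab h1 h2 h3]] := truncation n0 Tb.
exists n, eta; split => //.
- by rewrite hmin//= (le_trans h1)// lerD.
- move=> j; apply: le_trans (h3 j) _; rewrite lerD//.
  have sq0 : 0 < Num.sqrt (2 * S) by rewrite sqrtr_gt0 mulr_gt0.
  rewrite -ler_pdivrMr//; apply: ub_le_sup; last by exists j => //; rewrite sE.
  (* [sup] is an upper bound only for a bounded set; here every weight is at most 1, as its square
     is at most S / (2 S). *)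
  exists 1 => _ [i _ <-]; rewrite sE /= ler_pdivrMr// mul1r.
  rewrite -[leLHS](ger0_norm (mulr_ge0 (sqr_ge0 (b i)) (sqr_ge0 (thb i)))) -sqrtr_sqr ler_wsqrtr//.
  by rewrite (le_trans (hj i))//; lra.
(* S <= <z, thb^2> by the variational inequality, <z, thb^2> <= <th^2, thb^2> + k by truncation of
   [th], and [eta] dominates thb^2 below n. *)
- move=> th Tth; have [z [fz _ _ g _]] := truncation n0 Tth.
  have vi := variational_inequality Tb hS hmin fz.
  have tb0 : 0 <= thb 0%N ^+ 2 <= (a 0%N ^+ 2)^-1.
    by rewrite sqr_ge0 (le_trans (etab _ n0))// (fin_alt_le _ feta).
  have := g (fun j => thb j ^+ 2) tb0.
  have : \sum_(j < n) b j ^+ 4 * th j ^+ 2 * thb j ^+ 2 <= pairing n eta (fun j => th j ^+ 2).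
    apply: ler_sum => j _; rewrite mulrAC ler_wpM2r ?sqr_ge0//.
    by rewrite ler_wpM2l ?(ltW (b4 _))// etab.
  lra.
Qed.

End extremal.

(** * Bounds at a fixed noise level *)

Section sublevel.
Context {R : realType} {d : measure_display} {Om : measurableType d}.
Variable X : Om -> R.
Hypothesis mX : measurable_fun setT X.

Lemma measurable_sublevel x : measurable [set om | X om <= x].
Proof.
have := mX measurableT (measurable_itv `]-oo, x]); rewrite setTI.
by congr measurable; apply/seteqP; split => om /=; rewrite in_itv.
Qed.

Lemma measurable_superlevel x : measurable [set om | x < X om].
Proof.
have := mX measurableT (measurable_itv `]x, +oo[); rewrite setTI.
by congr measurable; apply/seteqP; split => om /=; rewrite in_itv /= andbT.
Qed.

Lemma chebyshev_sub (P : probability Om R) (v s : R) A : measurable A ->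
  (forall om, A om -> s <= `|X om|) -> 0 < s ->
  (\int[P]_om (X om ^+ 2)%:E)%E = v%:E -> (P A <= (v / s ^+ 2)%:E)%E.
Proof.
move=> mA As s0 Xv; apply: le_trans (chebyshev_sqr mX s0 Xv).
apply: le_measure; rewrite ?inE//.
have mn : measurable_fun setT (fun om => `|X om|) by exact: measurableT_comp.
have := mn measurableT _ (measurable_itv `[s, +oo[); rewrite setTI.
by congr measurable; apply/seteqP; split => om /=; rewrite in_itv /= andbT.
Qed.

End sublevel.

Section bounds.
Context {R : realType} {d : measure_display} {Om : measurableType d}.
Variables (P : probability Om R) (xi : nat -> {RV P >-> R}).
Hypothesis xi_indep : mutually_independent xi.
Hypothesis xi_gauss : forall j, standard_gaussian (xi j).
Variables (a b : nat -> R).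
Hypothesis a_pos : forall j, 0 < a j.
Hypothesis b_pos : forall j, 0 < b j.
Hypothesis a_nondecreasing : forall i j : nat, (i <= j)%N -> a i <= a j.
Hypothesis a_infty : a @ \oo --> +oo.
Implicit Types (eta th : nat -> R) (n : nat) (Th : set (nat -> R)).

(** Reduces to a real bound B on the second kind error: the supremum is not -oo because [Th] is
    nonempty, and +oo is trivial. *)
Lemma beta_ge eps alpha Th x : Th !=set0 ->
  (forall (psi : @test R) B, (law xi b eps (fun=> 0%R) [set y | psi y = true] <= alpha%:E)%E ->
    (forall th, Th th -> (law xi b eps th [set y | psi y = false] <= B%:E)%E) -> x <= B) ->
  (x%:E <= beta xi b eps alpha Th)%E.
Proof.
move=> [th0 Th0] h; apply: le_ereal_inf_tmp => _ [psi level <-].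
set A := [set _ | _ in _]; have hA th : Th th ->
    (law xi b eps th [set y | psi y = false] <= ereal_sup A)%E.
  by move=> Tth; apply: ereal_sup_ubound; exists th.
have := hA _ Th0; case E : (ereal_sup A) => [B| |]; first 1 last.
- by move=> _; exact: leey.
- by rewrite leeNy_eq => /eqP A0; have := measure_ge0 P (observation xi b eps th0 @^-1` [set y | psi y = false]); rewrite -[X in (_ <= X)%E]/(law xi b eps th0 _) A0.
by move=> _; rewrite lee_fin; apply: (h psi) => // th /hA; rewrite E.
Qed.

Lemma beta_le eps alpha Th x (psi : @test R) :
  (law xi b eps (fun=> 0%R) [set y | psi y = true] <= alpha%:E)%E ->
  (forall th, Th th -> (law xi b eps th [set y | psi y = false] <= x)%E) ->
  (beta xi b eps alpha Th <= x)%E.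
Proof.
move=> level h; apply: (@le_trans _ _ (ereal_sup [set law xi b eps th [set y | psi y = false] | th in Th])).
  by apply: ereal_inf_lbound; exists psi.
by apply: ge_ereal_sup => _ [th Tth <-]; exact: h.
Qed.

Lemma alternatives eps r n eta : 0 < eps -> 0 < r -> fin_alt a r n eta ->
  forall c', (forall j, c' j = b j * Num.sqrt (eta j) / eps \/
                        c' j = - (b j * Num.sqrt (eta j) / eps)) ->
  exists2 th, Theta a r th & forall j, b j * th j = if (j < n)%N then eps * c' j else 0.
Proof.
move=> e0 r0 feta c' hc'; have [eta0 etan _ _] := feta.
have c2 j : (c' j / b j * eps) ^+ 2 = eta j.
  rewrite -[RHS](sqr_sqrtr (eta0 j)).
  by case: (hc' j) => ->; field; rewrite !gt_eqF.
exists (fun j => if (j < n)%N then c' j / b j * eps else 0); last first.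
  move=> j; case: ifP => _; last by rewrite mulr0.
  by field; rewrite gt_eqF.
apply: (fin_alt_Theta b_pos r0 feta _).1 => j.
by case: ltnP => [//|nj]; rewrite etan// expr0n.
Qed.

(** [us] is the analogue of u for [eta], and [w] its weights in the normalization of [omega0], for
    which [chi_sum] has variance 1. The last clause is the mean of the statistic under [th]. *)
Lemma normalization eps r n eta : 0 < eps -> fin_alt a r n eta -> 0 < pairing b n eta eta ->
  exists us w, [/\ 0 < us, us ^+ 2 = (2 * eps ^+ 4)^-1 * pairing b n eta eta &
   [/\ forall j, w j = b j ^+ 2 * eta j / Num.sqrt (2 * pairing b n eta eta),
   2 * \sum_(j < n) w j ^+ 2 = 1,
   forall j, (b j * Num.sqrt (eta j) / eps) ^+ 2 = 2 * us * w j &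
   forall th, \sum_(j < n) w j * (b j * th j / eps) ^+ 2 =
     us * (pairing b n eta (fun j => th j ^+ 2) / pairing b n eta eta)]].
Proof.
move=> e0 feta; have [eta0 _ _ _] := feta; set p := pairing b n eta eta => p0.
have : 0 < Num.sqrt (2 * p) by rewrite sqrtr_gt0 mulr_gt0.
have : Num.sqrt (2 * p) ^+ 2 = 2 * p by rewrite sqr_sqrtr// mulr_ge0 ?(ltW p0).
move: (Num.sqrt _) => s sE s0.
exists (s / (2 * eps ^+ 2)), (fun j => b j ^+ 2 * eta j / s); split.
- by rewrite divr_gt0// mulr_gt0// exprn_gt0.
- by rewrite expr_div_n sE; field; rewrite gt_eqF.
split => //.
- rewrite (eq_bigr (fun j : 'I_n => s ^- 2 * (b j ^+ 4 * eta j * eta j))); last first.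
    by move=> j _; field; rewrite gt_eqF.
  by rewrite -mulr_sumr -/(pairing b n eta eta) -/p sE; field; rewrite gt_eqF.
- move=> j; rewrite -{2}[eta j](sqr_sqrtr (eta0 j)).
  by field; rewrite !gt_eqF.
- move=> th; rewrite -[p](mulKf (_ : 2 != 0 :> R))// -sE /pairing mulr_suml mulr_sumr.
  by apply: eq_bigr => j _; field; rewrite !gt_eqF.
Qed.
Lemma beta_le_unbiased eps alpha Th : 0 < eps -> 0 < alpha < 1 ->
  (beta xi b eps alpha Th <= (1 - alpha)%:E)%E.
Proof.
move=> e0 alpha01.
have [psi [level power]] := unbiased_test xi_gauss b e0 alpha01.
by apply: beta_le level _ => th _; exact: power.
Qed.

Lemma sum_sqr_le n (v : nat -> R) : (forall j, 0 <= v j) ->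
  \sum_(j < n) v j ^+ 2 <= (\sum_(j < n) v j) ^+ 2.
Proof.
move=> v0; rewrite expr2 mulr_suml; apply: ler_sum => j _.
by rewrite expr2 ler_wpM2l// (bigD1 j)//= lerDl sumr_ge0.
Qed.

Lemma beta_ge_small alpha kappa : 0 < kappa -> exists2 delta, 0 < delta &
  forall eps r, 0 < eps -> 0 < r -> Theta a r !=set0 -> u a b eps r <= delta ->
    ((1 - alpha - kappa)%:E <= beta xi b eps alpha (Theta a r))%E.
Proof.
move=> k0; set q : R := quad4_var; have q0 : 0 <= q by exact: quad4_var_ge0.
(* In [lower_small] with k = kappa / 4 each of the three error terms has to be at most kappa / 4; v0
   <= 1 lets the sum of squares of c^4 / 12 be bounded by v0 as well. *)
pose v0 := Num.min 1 (Num.min kappa (kappa ^+ 2 / (8 * (1 + q)))).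
have v0p : 0 < v0.
  by rewrite !lt_min ltr01 k0 divr_gt0 ?exprn_gt0// mulr_gt0// ltr_pwDl.
have v01 : v0 <= 1 by rewrite ge_min lexx.
have v0k : v0 <= kappa by rewrite !ge_min lexx !orbT.
have v0q : v0 * (1 + q) <= kappa ^+ 2 / 8.
  rewrite -ler_pdivlMr ?ltr_pwDl// -mulrA -invfM.
  by rewrite !ge_min lexx !orbT.
(* The near minimizer has v <= 2 u^2 + v0 / 2, and u <= v0 / 4 <= 1 / 4 gives 2 u^2 <= v0 / 2. *)
exists (v0 / 4); first by rewrite divr_gt0.
move=> eps r e0 r0 Tr ud.
have [V V0 [uE _ hV]] := u2_value a_pos b_pos a_nondecreasing a_infty r0 e0 Tr.
have c0 : 0 < 2 * eps ^+ 4 by rewrite mulr_gt0// exprn_gt0.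
have [n [eta [_ feta pV]]] := hV _ (mulr_gt0 c0 (divr_gt0 v0p (ltr0n R 4))).
have [eta0 _ _ _] := feta.
have VE : V = 2 * eps ^+ 4 * u a b eps r ^+ 2.
  rewrite /u sqr_sqrtr ?uE/= ?mulVKf ?gt_eqF//.
  by apply: mulr_ge0 => //; rewrite invr_ge0 ltW.
pose c j := b j * Num.sqrt (eta j) / eps.
have vE : \sum_(j < n) c j ^+ 4 = pairing b n eta eta / eps ^+ 4.
  rewrite /pairing mulr_suml; apply: eq_bigr => j _.
  rewrite /c -{2 3}[eta j](sqr_sqrtr (eta0 j)).
  by field; rewrite gt_eqF.
have vle : \sum_(j < n) c j ^+ 4 <= v0.
  rewrite vE ler_pdivrMr ?exprn_gt0//; apply: le_trans pV _; rewrite VE.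
  have u0 : 0 <= u a b eps r := sqrtr_ge0 _.
  have u1 : u a b eps r ^+ 2 <= v0 / 4.
    apply: (@le_trans _ _ (1 * (v0 / 4))); last by rewrite mul1r.
    by rewrite expr2 ler_pM//; lra.
  have e4 : 0 <= eps ^+ 4 by rewrite exprn_ge0// ltW.
  have := ler_wpM2l e4 u1; lra.
apply: beta_ge => // psi B level hB.
have := lower_small xi_indep xi_gauss (alternatives e0 r0 feta) level hB (divr_gt0 k0 (ltr0n R 4)).
rewrite -/c -/q; apply: le_trans.
have s2 : \sum_(j < n) (c j ^+ 4 / 12) ^+ 2 <= v0.
  apply: (@le_trans _ _ ((\sum_(j < n) c j ^+ 4 / 12) ^+ 2)).
    by apply: (sum_sqr_le _ (v := fun j => c j ^+ 4 / 12)) => j; rewrite divr_ge0// exprn_even_ge0.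
  rewrite -mulr_suml.
  have s0 : 0 <= \sum_(j < n) c j ^+ 4.
    by apply: sumr_ge0 => j _; exact: exprn_even_ge0.
  apply: (@le_trans _ _ (1 * v0)); last by rewrite mul1r.
  by rewrite expr2 ler_pM//; lra.
have := ler_wpM2l q0 s2.
set X := q * \sum_(j < n) _ => hX.
set Y := \sum_(j < n) _ in vle *.
have : (Y / 2 + X) / (2 * (kappa / 4)) <= kappa / 4.
  rewrite ler_pdivrMr; last by lra.
  by lra.
lra.
Qed.

(** Chebyshev suffices for both errors. The weights are bounded by 1 through their normalization,
    and T = 1 / alpha gives the level alpha^2 <= alpha. *)
Lemma beta_le_large alpha kappa : 0 < alpha < 1 -> 0 < kappa -> exists M,
  forall eps r, 0 < eps -> 0 < r -> Theta a r !=set0 -> M <= u a b eps r ->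
    (beta xi b eps alpha (Theta a r) <= kappa%:E)%E.
Proof.
move=> /andP[al0 al1] k0; pose T := alpha^-1; pose s0 := 1 + 4 / kappa.
have T0 : 0 < T by rewrite invr_gt0.
have s01 : 1 <= s0 by rewrite lerDl divr_ge0// ltW.
have s0k : s0^-1 <= kappa / 4.
  have -> : kappa / 4 = (4 / kappa)^-1 by rewrite invf_div.
  have p4 : 0 < 4 / kappa by rewrite divr_gt0.
  by rewrite lef_pV2 ?posrE ?(lt_le_trans ltr01 s01)// /s0 ler_wpDl.
have TE : T^-1 = alpha by rewrite invrK.
have s0E : kappa * s0 = kappa + 4 by rewrite /s0; field; rewrite gt_eqF.
move: T s0 T0 s01 s0k TE s0E => T s0 T0 s01 s0k TE s0E.
(* The mean h of the statistic is at least us / 2, so this M forces h >= 4 T + 4 s0. *)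
exists (2 * (4 * T + 4 * s0)) => eps r e0 r0 Tr Mu.
have c0 : 0 < 2 * eps ^+ 4 by rewrite mulr_gt0// exprn_gt0.
have [V V0 [uE hV _]] := u2_value a_pos b_pos a_nondecreasing a_infty r0 e0 Tr.
have uV : u a b eps r ^+ 2 = (2 * eps ^+ 4)^-1 * V.
  rewrite /u sqr_sqrtr ?uE//=.
  by apply: mulr_ge0 => //; rewrite invr_ge0 ltW.
have u0 : 0 < u a b eps r by apply: lt_le_trans Mu; lra.
have Vp : 0 < V by have := exprn_gt0 2 u0; rewrite uV pmulr_rgt0 ?invr_gt0.
have [n [eta [_ feta hsep]]] := separation a_pos b_pos a_nondecreasing a_infty r0 Vp hV Tr.
have p0 : 0 < pairing b n eta eta := lt_le_trans Vp (hV _ _ feta).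
have [us [w [us0 usE [wE w2 _ hw]]]] := normalization e0 feta p0.
have uus : u a b eps r <= us.
  rewrite -(@ler_pXn2r _ 2)// ?nnegrE ?(ltW u0) ?(ltW us0)// uV usE ler_pM2l ?invr_gt0//.
  exact: hV.
have [eta0 _ _ _] := feta.
have w0 j : 0 <= w j by rewrite wE divr_ge0 ?sqrtr_ge0// mulr_ge0// exprn_ge0// ltW.
have w1 j : (j < n)%N -> w j <= 1.
  move=> jn; rewrite -(@ler_pXn2r _ 2) ?nnegrE ?w0// expr1n -w2.
  rewrite (bigD1 (Ordinal jn))//= mulrDr.
  have : 0 <= \sum_(i < n | i != Ordinal jn) w i ^+ 2.
    by apply: sumr_ge0 => i _; exact: sqr_ge0.
  have := sqr_ge0 (w j); lra.
have X2 := chi_sum_var xi_indep xi_gauss w n; rewrite w2 in X2.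
have mX : measurable_fun setT (chi_sum xi w n) by exact: measurable_chi_sum.
have [psi [level power]] := chi_test xi_indep xi_gauss b e0 T ler01 w0 w1.
apply: (@beta_le _ _ _ _ psi).
  rewrite level; apply: le_trans (chebyshev_sub mX (measurable_superlevel mX T) _ T0 X2) _.
    by move=> om /= h; rewrite (le_trans (ltW h))// ler_norm.
  rewrite lee_fin div1r -exprVn TE.
  by rewrite expr2 ler_piMr// ltW.
move=> th Tth.
have hge : us / 2 <= \sum_(j < n) w j * (b j * th j / eps) ^+ 2.
  rewrite hw ler_pM2l// ler_pdivlMr// mulrC.
  exact: hsep.
set h := \sum_(j < n) _ in hge.
have h0 : 4 * T + 4 * s0 <= h by lra.
have hp : 0 < h by lra.
(* With K = h / 2 and dl = 1 / 2 the threshold becomes T - h / 4 <= - s0, and the variance term is 8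
   / h. *)
apply: le_trans (power th h erefl (h / 2) 2^-1 _ _) _ => //; first by rewrite divr_gt0.
have -> : kappa = kappa / 2 + kappa / 2 by rewrite -splitr.
rewrite EFinD leeD//; last first.
  rewrite lee_fin.
  have -> : 1 / (2^-1 ^+ 2 * (h / 2)) = 8 / h :> R by field; rewrite gt_eqF.
  rewrite ler_pdivrMr//; apply: (@le_trans _ _ (kappa / 2 * (4 * s0))); last first.
    by rewrite ler_pM2l ?divr_gt0//; lra.
  by lra.
have s0p : 0 < s0 by lra.
apply: le_trans (chebyshev_sub mX (measurable_sublevel mX _) _ s0p X2) _.
  move=> om /= hom; apply: (@le_trans _ _ (- chi_sum xi w n om)); first by lra.
  by rewrite -normrN ler_norm.
rewrite lee_fin div1r -exprVn.
have i0 : 0 <= s0^-1 by rewrite invr_ge0 ltW.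
have : s0^-1 ^+ 2 <= s0^-1.
  by rewrite expr2 ler_piMr// invf_le1.
lra.
Qed.

End bounds.

Section gaussian_bounds.
Context {R : realType} {d : measure_display} {Om : measurableType d}.
Variables (P : probability Om R) (xi : nat -> {RV P >-> R}).
Hypothesis xi_indep : mutually_independent xi.
Hypothesis xi_gauss : forall j, standard_gaussian (xi j).
Variables (a b : nat -> R).
Hypothesis a_pos : forall j, 0 < a j.
Hypothesis b_pos : forall j, 0 < b j.
Hypothesis a_nondecreasing : forall i j : nat, (i <= j)%N -> a i <= a j.
Hypothesis a_infty : a @ \oo --> +oo.

Lemma normalized_extremal eps r thb rho : 0 < eps -> 0 < r -> is_extremal a b eps r thb ->
  0 < rho <= 1 -> exists n (eta : nat -> R) (us : R) (w : nat -> R), [/\ fin_alt a r n eta, 0 < us,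
    0 <= u a b eps r <= us & us <= (1 + rho) * u a b eps r] /\
   [/\ forall j, 0 <= w j <= omega0 b thb + rho, 2 * \sum_(j < n) w j ^+ 2 = 1,
    forall j, (b j * Num.sqrt (eta j) / eps) ^+ 2 = 2 * us * w j &
    forall th, Theta a r th ->
      (1 - 2 * rho) * us <= \sum_(j < n) w j * (b j * th j / eps) ^+ 2].
Proof.
move=> e0 r0 ext /andP[rho0 rho1].
have [S S0 [uE hext]] := extremal_approximation a_pos b_pos a_nondecreasing a_infty r0 e0 ext.
have c0 : 0 < 2 * eps ^+ 4 by rewrite mulr_gt0// exprn_gt0.
have uS : u a b eps r ^+ 2 = (2 * eps ^+ 4)^-1 * S.
  rewrite /u sqr_sqrtr ?uE//=.
  by apply: mulr_ge0; [rewrite invr_ge0 ltW|exact: ltW].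
have u0 : 0 <= u a b eps r := sqrtr_ge0 _.
have q0 : 0 < Num.sqrt (2 * S) by rewrite sqrtr_gt0 mulr_gt0.
(* Absolute errors are made relative to S: the first bound controls [us] and the mean, the second
   the weights. *)
have k0 : 0 < Num.min (rho * S) (rho * Num.sqrt (2 * S)) by rewrite lt_min !mulr_gt0.
have [n [eta [_ feta /andP[pS Sp] wle hth]]] := hext _ k0.
set k := Num.min _ _ in k0 Sp wle hth.
have kS : k <= rho * S by rewrite ge_min lexx.
have kq : k <= rho * Num.sqrt (2 * S) by rewrite ge_min lexx orbT.
have p0 : 0 < pairing b n eta eta := lt_le_trans S0 pS.
have [us [w [us0 usE [wE w2 cw hw]]]] := normalization e0 feta p0.
have [eta0 _ _ _] := feta.
exists n, eta, us, w; split; split => //.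
- rewrite u0 -(@ler_pXn2r _ 2)// ?nnegrE ?(ltW us0)// uS usE ler_pM2l ?invr_gt0//.
- rewrite -(@ler_pXn2r _ 2)// ?nnegrE ?(ltW us0)//; last first.
    by rewrite mulr_ge0// addr_ge0// ltW.
  rewrite exprMn uS usE [leRHS]mulrCA ler_pM2l ?invr_gt0//; apply: le_trans Sp _.
  have : 0 <= (rho + rho ^+ 2) * S by rewrite mulr_ge0 ?addr_ge0 ?sqr_ge0// ltW.
  lra.
- move=> j; rewrite wE divr_ge0 ?sqrtr_ge0//=; last by rewrite mulr_ge0// exprn_ge0// ltW.
  have sp0 : 0 < Num.sqrt (2 * pairing b n eta eta) by rewrite sqrtr_gt0 mulr_gt0.
  have om0 : 0 <= omega0 b thb + rho.
    rewrite -(pmulr_lge0 _ q0) mulrDl; apply: (le_trans _ (lerD (lexx _) kq)).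
    by apply: le_trans (wle j); rewrite mulr_ge0// exprn_ge0// ltW.
  rewrite ler_pdivrMr//; apply: le_trans (wle j) _.
  apply: (@le_trans _ _ ((omega0 b thb + rho) * Num.sqrt (2 * S))).
    by rewrite [leRHS]mulrDl lerD.
  by rewrite ler_wpM2l// ler_wsqrtr// ler_pM2l.
- move=> th Tth; rewrite hw mulrC ler_pM2l// ler_pdivlMr//.
  apply: le_trans (hth _ Tth).
  have [r2|r2] := leP (2 * rho) 1.
    apply: (@le_trans _ _ ((1 - 2 * rho) * (S + rho * S))).
      by rewrite ler_wpM2l//; [lra|rewrite (le_trans Sp)// lerD].
    have : 0 <= rho ^+ 2 * S by rewrite mulr_ge0 ?sqr_ge0// ltW.
    lra.
  apply: (@le_trans _ _ ((1 - 2 * rho) * S)).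
    by rewrite ler_wnM2l//; lra.
  lra.
Qed.

Lemma beta_gaussian_le alpha t M kappa : Phi t = 1 - alpha -> 1 <= M -> 0 < kappa <= 1 ->
  exists2 delta, 0 < delta & forall eps r thb, 0 < eps -> 0 < r ->
    is_extremal a b eps r thb -> u a b eps r <= M -> omega0 b thb <= delta ->
    (beta xi b eps alpha (Theta a r) <= (Phi (t - u a b eps r) + kappa)%:E)%E.
Proof.
move=> tE M1 /andP[kp0 kp1]; have k50 : 0 < kappa / 5 by rewrite divr_gt0.
have tT : t < t + kappa / 5 by rewrite ltrDl.
(* A threshold strictly above t: the gap [Phi T - Phi t] absorbs the error of the normal
   approximation, and the level does not exceed alpha. *)
set T := t + kappa / 5 in tT.
pose k0 := Num.min (kappa / 5) (Phi T - Phi t).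
have k0p : 0 < k0 by rewrite lt_min k50 subr_gt0 Phi_lt.
have k0k : k0 <= kappa / 5 by rewrite ge_min lexx.
have k0T : k0 <= Phi T - Phi t by rewrite ge_min lexx orbT.
move: k0 k0p k0k k0T => k0 k0p k0k k0T.
have [W0 W0p hclt] := clt xi_indep xi_gauss k0p.
have M10 : 0 < 5 * (M + 1) by lra.
(* Five equal shares of kappa: the raised threshold, the loss in the mean, dl (M + 1), the normal
   approximation, and the variance term W / dl^2. *)
pose dl := kappa / (5 * (M + 1)).
have dl0 : 0 < dl by rewrite divr_gt0.
have dlE : dl * (M + 1) = kappa / 5 by rewrite /dl; field; rewrite gt_eqF//; lra.
have dl1 : dl <= 1 by rewrite ler_pdivrMr//; lra.
move: dl dl0 dlE dl1 => dl dl0 dlE dl1.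
pose W := Num.min W0 (kappa / 5 * dl ^+ 2).
have Wp : 0 < W by rewrite lt_min W0p mulr_gt0// exprn_gt0.
have WW0 : W <= W0 by rewrite ge_min lexx.
have Wdl : W <= kappa / 5 * dl ^+ 2 by rewrite ge_min lexx orbT.
move: W Wp WW0 Wdl => W Wp WW0 Wdl.
pose rho := Num.min 1 (Num.min (W / 2) (kappa / (20 * M))).
have M20 : 0 < 20 * M by lra.
have rho0 : 0 < rho by rewrite !lt_min ltr01 divr_gt0//= divr_gt0.
have rho1 : rho <= 1 by rewrite ge_min lexx.
have rhoW : rho <= W / 2 by rewrite !ge_min lexx !orbT.
have rhoM : 4 * rho * M <= kappa / 5.
  have : rho <= kappa / (20 * M) by rewrite !ge_min lexx !orbT.
  by rewrite ler_pdivlMr//; lra.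
move: rho rho0 rho1 rhoW rhoM => rho rho0 rho1 rhoW rhoM.
exists (W / 2); first by rewrite divr_gt0.
move=> eps r thb e0 r0 ext uM oW.
have rhoI : 0 < rho <= 1 by rewrite rho0.
have [n [eta [us [w [[feta us0 /andP[u0 uus] usu] [wI w2 cw hw]]]]]] :=
  normalized_extremal e0 r0 ext rhoI.
have w0 j : 0 <= w j by have /andP[] := wI j.
have wW j : w j <= W by have /andP[_] := wI j; lra.
have w0' (j : nat) : (j < n)%N -> w j <= W by move=> _; exact: wW.
have w0'' (j : nat) : (j < n)%N -> w j <= W0 by move=> _; exact: le_trans (wW j) WW0.
have {}hclt := hclt w n w0 w0'' w2.
have mX : measurable_fun setT (chi_sum xi w n) by exact: measurable_chi_sum.
have finP (A : set Om) : measurable A -> (P A = (fine (P A))%:E)%E.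
  by move=> mA; rewrite fineK// fin_num_measure.
have [psi [level power]] := chi_test xi_indep xi_gauss b e0 T (ltW Wp) w0 w0'.
apply: (@beta_le _ _ _ _ _ _ _ _ _ _ psi).
  rewrite level.
  have -> : [set om | T < chi_sum xi w n om] = ~` [set om | chi_sum xi w n om <= T].
    by apply/seteqP; split => om /=; rewrite leNgt; [move=> ->|move/negP; rewrite negbK].
  rewrite probability_setC; last exact: measurable_sublevel.
  rewrite (finP _ (measurable_sublevel mX T)) -EFinB lee_fin.
  have := hclt T; rewrite ler_norml => /andP[h1 h2]; lra.
move=> th Tth.
set h := \sum_(j < n) w j * (b j * th j / eps) ^+ 2 in power.
have hge := hw _ Tth.
apply: le_trans (power th _ erefl 1 dl ltr01 dl0) _.
move: hge; rewrite -/h => hge.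
rewrite (finP _ (measurable_sublevel mX _)) -EFinD lee_fin mulr1.
have WD : W / dl ^+ 2 <= kappa / 5 by rewrite ler_pdivrMr ?exprn_gt0.
have := hclt (T - h + dl * (h + 1)); rewrite ler_norml => /andP[_ h2].
have ineq : T - h + dl * (h + 1) <= t - u a b eps r + 3 * (kappa / 5).
  have hu : u a b eps r - kappa / 5 <= h.
    apply: le_trans hge.
    have : rho * us <= rho * (2 * M).
      rewrite ler_pM2l//; apply: le_trans usu _.
      by rewrite ler_pM//; lra.
    lra.
  have d1 : (1 - dl) * (u a b eps r - kappa / 5) <= (1 - dl) * h.
    by rewrite ler_wpM2l ?subr_ge0.
  have d2 : dl * u a b eps r <= dl * M by rewrite ler_pM2l.
  have d3 : 0 <= dl * (kappa / 5) by rewrite mulr_ge0// ltW.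
  by rewrite /T; lra.
have h3 := Phi_homo ineq.
have [|h4 h5] := andP (Phi_lipschitz (x := t - u a b eps r) (y := t - u a b eps r + 3 * (kappa / 5)) _).
  by rewrite lerDl mulr_ge0// ltW.
lra.
Qed.

Lemma beta_gaussian_ge alpha t M kappa : Phi t = 1 - alpha -> 1 <= M -> 0 < kappa ->
  exists2 delta, 0 < delta & forall eps r thb, 0 < eps -> 0 < r ->
    is_extremal a b eps r thb -> u a b eps r <= M -> omega0 b thb <= delta ->
    ((Phi (t - u a b eps r) - kappa)%:E <= beta xi b eps alpha (Theta a r))%E.
Proof.
move=> tE M1 kp0; have k50 : 0 < kappa / 5 by rewrite divr_gt0.
(* A bound for the multiplier l = exp (us t - us^2 / 2), valid since us <= 2 M; errors multiplied by
   l are therefore kept of order kappa / (5 L). *)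
pose L := expR (2 * M * `|t|); have L0 : 0 < L by exact: expR_gt0.
move: (erefl L); rewrite {1}/L; move: L L0 => L L0 LE.
have kL0 : 0 < kappa / (5 * L) by rewrite divr_gt0// mulr_gt0.
have kLE : L * (kappa / (5 * L)) = kappa / 5 by field; rewrite gt_eqF.
move: (kappa / (5 * L)) kL0 kLE => k kk0 kLE.
have [W0 W0p hclt] := clt xi_indep xi_gauss kk0.
set q : R := quad4_var; have q0 : 0 <= q by exact: quad4_var_ge0.
pose D := q * (2 * M) ^+ 4 + 1.
have D0 : 0 < D by rewrite ltr_wpDl// mulr_ge0// exprn_even_ge0.
pose W := Num.min 1 (Num.min W0 (2 * k ^+ 2 / D)).
have Wp : 0 < W by rewrite !lt_min ltr01 W0p divr_gt0// mulr_gt0// exprn_gt0.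
have W1 : W <= 1 by rewrite ge_min lexx.
have WW0 : W <= W0 by rewrite !ge_min lexx !orbT.
have WD : W * D <= 2 * k ^+ 2 by rewrite -ler_pdivlMr// !ge_min lexx !orbT.
move: W Wp W1 WW0 WD => W Wp W1 WW0 WD.
pose rho := Num.min 1 (Num.min (W / 2) (kappa / (5 * M))).
have M5 : 0 < 5 * M by lra.
have rho0 : 0 < rho by rewrite !lt_min ltr01 divr_gt0//= divr_gt0.
have rho1 : rho <= 1 by rewrite ge_min lexx.
have rhoW : rho <= W / 2 by rewrite !ge_min lexx !orbT.
have rhoM : rho * M <= kappa / 5.
  have : rho <= kappa / (5 * M) by rewrite !ge_min lexx !orbT.
  by rewrite ler_pdivlMr//; lra.
move: rho rho0 rho1 rhoW rhoM => rho rho0 rho1 rhoW rhoM.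
exists (W / 2); first by rewrite divr_gt0.
move=> eps r thb e0 r0 ext uM oW.
have rhoI : 0 < rho <= 1 by rewrite rho0.
have [n [eta [us [w [[feta us0 /andP[u0 uus] usu] [wI w2 cw hw]]]]]] :=
  normalized_extremal e0 r0 ext rhoI.
have w0 j : 0 <= w j by have /andP[] := wI j.
have wW j : w j <= W by have /andP[_] := wI j; lra.
have w0'' (j : nat) : (j < n)%N -> w j <= W0 by move=> _; exact: le_trans (wW j) WW0.
have {}hclt := hclt w n w0 w0'' w2.
have usM : us <= u a b eps r + rho * M.
  apply: le_trans usu _; rewrite mulrDl mul1r lerD2l.
  by rewrite ler_pM2l.
have us2M : us <= 2 * M.
  have : rho * M <= 1 * M by rewrite ler_wpM2r//; lra.
  lra.
apply: beta_ge => [|psi B level hB]; first by exists thb; exact: ext.1.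
have := lower_clt xi_indep xi_gauss (alternatives b_pos e0 r0 feta) level hB us0 (ltW kk0) kk0 cw w2 hclt (t := t) erefl.
(* Truncating at the quantile t makes the terms in l cancel: the expected value of the truncated
   ratio above t is exactly l * alpha. *)
rewrite -/q tE (_ : 1 - (1 - alpha) - alpha = 0); last by ring.
rewrite mulr0 addr0; apply: le_trans.
have lL : expR (us * t - us ^+ 2 / 2) <= L.
  rewrite -LE ler_expR; apply: (@le_trans _ _ (us * t)).
    by rewrite gerBl divr_ge0// sqr_ge0.
  apply: (@le_trans _ _ (us * `|t|)); first by rewrite ler_pM2l// ler_norm.
  by rewrite ler_wpM2r.
have l0 : 0 <= expR (us * t - us ^+ 2 / 2) by exact: expR_ge0.
move: (expR _) lL l0 => l lL l0.
have s8 : \sum_(j < n) ((b j * Num.sqrt (eta j) / eps) ^+ 4 / 12) ^+ 2 <= (2 * M) ^+ 4 * W.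
  apply: (@le_trans _ _ (\sum_(j < n) (2 * M) ^+ 4 * W * w j ^+ 2)).
    apply: ler_sum => j _.
    have -> (x : R) : (x ^+ 4 / 12) ^+ 2 = (x ^+ 2) ^+ 4 / 144 by field.
    rewrite cw.
    have u4 : us ^+ 4 <= (2 * M) ^+ 4 by rewrite lerXn2r ?nnegrE ?(ltW us0)//; lra.
    have w21 : w j ^+ 2 <= W.
      rewrite expr2; apply: (@le_trans _ _ (W * 1)); last by rewrite mulr1.
      by rewrite ler_pM// (le_trans (wW j)).
    have : us ^+ 4 * w j ^+ 2 * w j ^+ 2 <= (2 * M) ^+ 4 * W * w j ^+ 2.
      rewrite ler_wpM2r ?sqr_ge0// ler_pM ?sqr_ge0// exprn_even_ge0//.
    have : 0 <= (us * w j) ^+ 4 by exact: exprn_even_ge0.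
    lra.
  rewrite -mulr_sumr ler_piMr//; first by rewrite mulr_ge0 ?(ltW Wp)// exprn_even_ge0.
  lra.
have S1 : q * (\sum_(j < n) ((b j * Num.sqrt (eta j) / eps) ^+ 4 / 12) ^+ 2) <= 2 * k ^+ 2.
  apply: le_trans (ler_wpM2l q0 s8) _; apply: le_trans WD; rewrite /D; lra.
have S2 : q * (\sum_(j < n) ((b j * Num.sqrt (eta j) / eps) ^+ 4 / 12) ^+ 2) / (2 * k) <= k.
  rewrite ler_pdivrMr ?mulr_gt0//; apply: le_trans S1 _; lra.
move: (q * _ / _) S2 => Z S2.
have S3 : l * (k + k / 2 + Z) <= 3 * (kappa / 5).
  apply: (@le_trans _ _ (l * (3 * k))); first by rewrite ler_wpM2l//; lra.
  have : l * k <= L * k by rewrite ler_wpM2r// ltW.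
  lra.
have /Phi_lipschitz/andP[_] : t - us <= t - u a b eps r by lra.
lra.
Qed.

End gaussian_bounds.

(** Restricting to k <= 1 costs nothing and matches [beta_gaussian_le]; the case k = 1 shows that f
    is finite near 0. *)
Lemma cvg_right0E (R : realType) (f : R -> \bar R) :
  (forall k, 0 < k <= 1 -> \forall e \near 0^'+, ((- k)%:E <= f e <= k%:E)%E) ->
  f @ 0^'+ --> 0%E.
Proof.
move=> h; apply/fine_cvgP; split.
  have := h 1; rewrite ltr01 lexx => /(_ isT); apply: filterS => e /andP[h1 h2].
  by rewrite fin_numElt (lt_le_trans _ h1) ?ltNyr// (le_lt_trans h2) ?ltry.
apply/cvgr0Pnorm_le => k k0.
have k1 : 0 < Num.min k 1 <= 1 by rewrite lt_min k0 ltr01 ge_min lexx orbT.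
apply: filterS (h _ k1) => e /=; case: (f e) => [x| |]//=; last by move=> _; rewrite normr0 ltW.
rewrite !lee_fin => /andP[h1 h2].
have hk : Num.min k 1 <= k by rewrite ge_min lexx.
by rewrite ler_norml (le_trans h2 hk) andbT (le_trans _ h1)// lerN2.
Qed.

Theorem theorem4p2 (R : realType)
    (d : measure_display) (Om : measurableType d) (P : probability Om R)
    (xi : nat -> {RV P >-> R})
    (xi_indep : mutually_independent xi)
    (xi_gauss : forall j, standard_gaussian (xi j))
    (a b : nat -> R)
    (b_pos : forall j, 0 < b j)
    (a_pos : forall j, 0 < a j)
    (a_nondecreasing : forall i j : nat, (i <= j)%N -> a i <= a j)
    (a_infty : a @ \oo --> +oo)
    (alpha : R) (alpha_gt0 : 0 < alpha) (alpha_lt1 : alpha < 1)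
    (r : R -> R)
    (r_pos : forall eps, 0 < eps -> 0 < r eps)
    (Theta_nonempty : forall eps, 0 < eps -> Theta a (r eps) !=set0) :
  (* (a) *)
  ((fun eps => u a b eps (r eps)) @ 0^'+ --> (0 : R) ->
   (fun eps => beta xi b eps alpha (Theta a (r eps)) - (1 - alpha)%:E)%E
     @ 0^'+ --> 0%E)
  /\
  (* (b) *)
  (forall theta_bar : R -> nat -> R,
     (forall eps, 0 < eps ->
        is_extremal a b eps (r eps) (theta_bar (r eps))) ->
     bounded_near (fun eps => u a b eps (r eps)) (0 : R)^'+ ->
     (fun eps => omega0 b (theta_bar (r eps))) @ 0^'+ --> (0 : R) ->
     (fun eps => beta xi b eps alpha (Theta a (r eps))
                 - (Phi (Phi_inv (1 - alpha) - u a b eps (r eps)))%:E)%E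
       @ 0^'+ --> 0%E)
  /\
  (* (c) *)
  ((fun eps => u a b eps (r eps)) @ 0^'+ --> +oo ->
   (fun eps => beta xi b eps alpha (Theta a (r eps))) @ 0^'+ --> 0%E).
Proof.
have alpha01 : 0 < alpha < 1 by rewrite alpha_gt0.
have pos : \forall e \near (0 : R)^'+, 0 < e by exact: nbhs_right_gt.
split; last split.
- move=> u0; apply: cvg_right0E => k /andP[k0 _].
  have [delta d0 hd] := beta_ge_small xi_indep xi_gauss a_pos b_pos a_nondecreasing a_infty alpha k0.
  have /cvgr0_norm_le/(_ _ d0) ud := u0.
  near=> e; have e0 : 0 < e by near: e.
  have ue : u a b e (r e) <= delta by apply: le_trans (ler_norm _) _; near: e.
  rewrite leeBrDr// leeBlDr// -!EFinD.
  rewrite [- k + _]addrC hd//=; [|exact: r_pos|exact: Theta_nonempty].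
  apply: le_trans (beta_le_unbiased xi_gauss b _ e0 alpha01) _.
  by rewrite lee_fin lerDr ltW.
- move=> thb ext [M0 [_ hM]] om0; apply: cvg_right0E => k k01.
  set t := Phi_inv _.
  have tE : Phi t = 1 - alpha by apply: Phi_invK; rewrite subr_gt0 alpha_lt1 gtrBl.
  pose M := Num.max 1 (M0 + 1).
  have M1 : 1 <= M by rewrite le_max lexx.
  have uM : \forall e \near (0 : R)^'+, `|u a b e (r e)| <= M.
    by apply: hM; rewrite lt_max ltrDl ltr01 orbT.
  have k0 : 0 < k by have /andP[] := k01.
  have [d1 d10 hd1] := beta_gaussian_le xi_indep xi_gauss a_pos b_pos a_nondecreasing a_infty tE M1 k01.
  have [d2 d20 hd2] := beta_gaussian_ge xi_indep xi_gauss a_pos b_pos a_nondecreasing a_infty tE M1 k0.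
  have /cvgr0_norm_le/(_ _ d10) od1 := om0.
  have /cvgr0_norm_le/(_ _ d20) od2 := om0.
  near=> e; have e0 : 0 < e by near: e.
  have ue : u a b e (r e) <= M by apply: le_trans (ler_norm _) _; near: e.
  have oe1 : omega0 b (thb (r e)) <= d1 by apply: le_trans (ler_norm _) _; near: e.
  have oe2 : omega0 b (thb (r e)) <= d2 by apply: le_trans (ler_norm _) _; near: e.
  rewrite leeBrDr// leeBlDr// -!EFinD ![_ + Phi _]addrC.
  rewrite (hd2 e (r e) (thb (r e)))//; [|exact: r_pos|exact: ext].
  by rewrite (hd1 e (r e) (thb (r e)))//; [exact: r_pos|exact: ext].
- move=> uoo; apply: cvg_right0E => k /andP[k0 _].
  have [M hM] := beta_le_large xi_indep xi_gauss a_pos b_pos a_nondecreasing a_infty alpha01 k0.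
  have /cvgryPge/(_ M) uM := uoo.
  near=> e; have e0 : 0 < e by near: e.
  rewrite hM//; [|exact: r_pos|exact: Theta_nonempty|by near: e].
  rewrite andbT; apply: (@le_trans _ _ 0%E); first by rewrite lee_fin oppr_le0 ltW.
  apply: beta_ge => [|psi B _ hB]; first exact: Theta_nonempty.
  have [th Tth] := Theta_nonempty _ e0.
  by rewrite -lee_fin; apply: le_trans (hB _ Tth); exact: (measure_ge0 P (_ @^-1` _)).
Unshelve. all: by end_near.
Qed.
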